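(* Let $k\ge 1$. There exists a constant $\beta>0$, independent of the mesh size $h$, such that $$\sup_{\tau_h\in\Sigma^s_h\setminus\{0\}}\frac{b^*_h(v_h,\tau_h)}{\|\tau_h\|}\ \ge\ \beta\,\|v_h\|_{H^1,h}\qquad\text{for all } v_h\in U_{h,0}.$$
   Context: Let $\Omega\subset\mathbb R^2$ be a bounded convex polygonal domain and $k$ a fixed polynomial degree. Mesh: $\mathcal T^{pr}_h$ is a shape-regular triangulation of $\Omega$ (primal mesh), $h$ is the maximal diameter of its triangles, $\mathcal F^{pr}_h$ is the set of its edges (primal edges), $\mathcal F^{pr,o}_h$ the interior ones, $\mathcal F^\partial_h$ those on $\partial\Omega$. Each primal triangle is divided into three sub-triangles by joining its barycenter to its three vertices; the refined triangulation is $\mathcal T_h$ and the set of newly generated edges (dual edges) is $\mathcal F^{dl}_h$. For an edge $e$, $h_e$ is its length and $n$ a fixed unit normal (outward if $e\subset\partial\Omega$). For an interior edge shared by $K^+,K^-\in\mathcal T_h$ with $n$ oriented from $K^+$ to $K^-$, the jump is $[\phi]_e=\phi|_{K^+}-\phi|_{K^-}$; for a boundary edge $[\phi]_e=\phi$ (same for vectors and tensors). $(\cdot,\cdot)_{\mathcal T_h}$, $(\cdot,\cdot)_{\mathcal F}$ are sums of $L^2$ inner products over elements/edges; $\|\cdot\|$ is the $L^2(\Omega)$ norm, $\|\cdot\|_K,\|\cdot\|_e$ the $L^2$ norms on $K$, $e$. $\mathcal P_k$ denotes polynomials of degree at most $k$. For matrix fields, $(\operatorname{div}\tau)_i=\partial_j\tau_{ij}$,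 $(\tau\cdot n)_i=\tau_{ij}n_j$; for vector fields $(\nabla v)_{ij}=\partial_jv_i$. Spaces: $U_h=\{v\in L^2(\Omega;\mathbb R^2): v|_K\in\mathcal P_k(K;\mathbb R^2)\ \forall K\in\mathcal T_h,\ [v]_e=0\ \forall e\in\mathcal F^{pr,o}_h\}$, $U_{h,0}=\{v\in U_h: v|_e=0\ \forall e\in\mathcal F^\partial_h\}$, $\Sigma_h=\{\tau\in L^2(\Omega;\mathbb R^{2\times2}):\tau|_K\in\mathcal P_k(K;\mathbb R^{2\times 2})\ \forall K\in\mathcal T_h,\ [\tau\cdot n]_e=0\ \forall e\in\mathcal F^{dl}_h\}$, $\Sigma^s_h=\{\tau\in\Sigma_h:\tau^{T}=\tau\}$. Form and norm: $b^*_h(v,\tau)=-(v,\operatorname{div}\tau)_{\mathcal T_h}+(v,[\tau\cdot n])_{\mathcal F^{pr}_h}$, and $\|v_h\|^2_{H^1,h}=\sum_{K\in\mathcal T_h}\|\nabla v_h\|_K^2+\sum_{e\in\mathcal F^{dl}_h}h_e^{-1}\|[v_h]\|_e^2$. The constant $\beta$ may depend on $\Omega$, $k$ and the shape-regularity of the mesh. *)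

(* Defs.v *)
From HB Require Import structures.
From mathcomp Require Import all_boot all_order all_algebra.
From mathcomp Require Import all_classical all_reals all_analysis.

Set Implicit Arguments.
Unset Strict Implicit.
Unset Printing Implicit Defensive.

Import Order.TTheory GRing.Theory Num.Theory.
Import numFieldNormedType.Exports.

Local Open Scope classical_set_scope.
Local Open Scope ring_scope.

(** * Plane geometry *)

(* The plane is [R * R], which carries the product Lebesgue measure.  Its
   library norm is the max norm, hence the explicit Euclidean distance; the
   topology is the same. *)
Definition vec (R : realType) (x : R * R) : 'cV[R]_2 :=
  \col_i (if i == 0 then x.1 else x.2).

Definition mdot (R : realType) (m n : nat) (A B : 'M[R]_(m, n)) : R :=
  \sum_i \sum_j A i j * B i j.

Definition edist (R : realType) (x y : R * R) : R :=
  Num.sqrt (mdot (vec (x - y)) (vec (x - y))).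

Definition diam (R : realType) (A : set (R * R)) : R :=
  sup [set d | exists x y, [/\ A x, A y & d = edist x y]].

(* Diameter of the largest disk contained in [A]. *)
Definition indiam (R : realType) (A : set (R * R)) : R :=
  sup [set d | exists c r, [/\ 0 <= r, d = 2 * r &
                 [set x | edist x c <= r] `<=` A]].

(* Convex hull of the points [p i], [i \in A]. *)
Definition hull (R : realType) (V : finType) (p : V -> R * R) (A : {set V}) :
    set (R * R) :=
  [set x | exists w : V -> R,
     [/\ forall i, 0 <= w i, \sum_(i in A) w i = 1 &
         x = \sum_(i in A) w i *: p i]].

Definition centroid (R : realType) (V : finType) (p : V -> R * R)
    (A : {set V}) : R * R :=
  #|A|%:R^-1 *: \sum_(i in A) p i.

Definition convex_polygonal_domain (R : realType) (Omega : set (R * R)) : Prop :=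
  Omega !=set0 /\
  exists (n : nat) (p : 'I_n -> R * R), Omega = (hull p [set: 'I_n]%SET)°.

(** * Triangulations *)

(* Cells and edges are sets of 3, resp. 2, vertex labels; the closed triangle
   or segment they stand for is the [hull] of the positions. *)
Record mesh (R : realType) (V : finType) := Mesh {
  pos : V -> R * R;
  cells : {set {set V}} }.

Definition sides (V : finType) (K : {set V}) : {set {set V}} :=
  [set e in powerset K | #|e| == 2%N]%SET.

Definition edges (R : realType) (V : finType) (M : mesh R V) : {set {set V}} :=
  (\bigcup_(K in cells M) sides K)%SET.

Definition geom (R : realType) (V : finType) (M : mesh R V) (A : {set V}) :
    set (R * R) :=
  hull (pos M) A.

(* The last condition is conformity: two distinct triangles meet in the hull
   of their common vertices, that is in nothing, a vertex or an edge. *)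
Definition triangulation (R : realType) (V : finType) (Omega : set (R * R))
    (M : mesh R V) : Prop :=
  [/\ forall K, K \in cells M -> #|K| = 3%N /\ (geom M K)° !=set0,
      \bigcup_(K in [set` cells M]) geom M K = closure Omega &
      forall K L, K \in cells M -> L \in cells M -> K != L ->
        geom M K `&` geom M L = geom M (K :&: L)%SET].

Definition shape_regular (R : realType) (V : finType) (gamma : R)
    (M : mesh R V) : Prop :=
  forall K, K \in cells M -> diam (geom M K) <= gamma * indiam (geom M K).

(* [Omega] is open, so its boundary is [closure Omega `\` Omega]. *)
Definition boundary_edge (R : realType) (V : finType) (Omega : set (R * R))
    (M : mesh R V) (e : {set V}) : Prop :=
  geom M e `<=` closure Omega `\` Omega.

(* Barycentric refinement: [inl a] is the primal vertex [a] and [inr K] the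
   barycenter of the primal triangle [K]. *)
Definition refine (R : realType) (V : finType) (M : mesh R V) :
    mesh R (V + {set V})%type :=
  Mesh (fun q => match q with
                 | inl a => pos M a
                 | inr K => centroid (pos M) K
                 end)
       (\bigcup_(K in cells M)
          [set inr K |: (inl @: (e : {set V})) | e : {set V} in sides K])%SET.

Definition primal_edges (R : realType) (V : finType) (M : mesh R V) :
    {set {set (V + {set V})%type}} :=
  [set inl @: e | e : {set V} in edges M]%SET.

Definition dual_edges (R : realType) (V : finType) (M : mesh R V) :
    {set {set (V + {set V})%type}} :=
  (edges (refine M) :\: primal_edges M)%SET.

(** * Integration *)

Definition int_cell (R : realType) (V : finType) (M : mesh R V) (K : {set V})
    (f : R * R -> R) : R :=
  (\int[(@lebesgue_measure R \x @lebesgue_measure R)%E]_(x in geom M K) f x)%R.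

(* Arc length integral; it does not depend on the order of [a] and [b]. *)
Definition int_edge (R : realType) (V : finType) (M : mesh R V) (e : {set V})
    (f : R * R -> R) : R :=
  if enum e is [:: a; b] then
    edist (pos M a) (pos M b) *
    (\int[@lebesgue_measure R]_(s in `[0%R, 1%R])
       f ((1 - s) *: pos M a + s *: pos M b))%R
  else 0.

(** * Piecewise polynomial fields *)

Definition poly_le (R : realType) (k : nat) (f : R * R -> R) : Prop :=
  exists c : nat -> nat -> R, forall x,
    f x = \sum_(i < k.+1) \sum_(j < k.+1 | (i + j <= k)%N)
            c i j * x.1 ^+ i * x.2 ^+ j.

(* A piecewise polynomial field [phi] in L^2 is determined, up to null sets, by
   its restrictions to the cells, and is given by this family: [phi K] is the
   restriction to the cell [K], extended to the plane by the same polynomials.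
   Traces on the sides of [K] and derivatives on [K] are thus values and
   derivatives of [phi K].  Sets of labels that are not cells play no role. *)
Notation dgfield R V m n := ({set V} -> R * R -> 'M[R]_(m, n)).

Definition piecewise_poly (R : realType) (V : finType) (m n k : nat)
    (M : mesh R V) (phi : dgfield R V m n) : Prop :=
  forall K, K \in cells M -> forall i j, poly_le k (fun x => phi K x i j).

Definition unitv (R : realType) (j : 'I_2) : R * R :=
  if j == 0 then (1, 0) else (0, 1).

Definition grad (R : realType) (v : R * R -> 'cV[R]_2) (x : R * R) : 'M[R]_2 :=
  \matrix_(i, j) 'D_(unitv R j) (fun y => v y i 0) x.

Definition divg (R : realType) (tau : R * R -> 'M[R]_2) (x : R * R) : 'cV[R]_2 :=
  \col_i \sum_j 'D_(unitv R j) (fun y => tau y i j) x.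

(* [+1] if [nu] points out of [K] through its side [e] (so that [K] is K^+),
   and [-1] if it points into [K] (so that [K] is K^-). *)
Definition orientation (R : realType) (V : finType) (M : mesh R V)
    (nu : {set V} -> 'cV[R]_2) (K e : {set V}) : R :=
  Num.sg (mdot (nu e) (vec (centroid (pos M) e - centroid (pos M) K))).

Definition unit_normals (R : realType) (V : finType) (Omega : set (R * R))
    (M : mesh R V) (nu : {set V} -> 'cV[R]_2) : Prop :=
  forall e, e \in edges M ->
    [/\ mdot (nu e) (nu e) = 1,
        forall x y, geom M e x -> geom M e y -> mdot (nu e) (vec (x - y)) = 0 &
        boundary_edge Omega M e -> forall K, K \in cells M -> e \in sides K ->
          orientation M nu K e = 1].

(* The signed sum over the cells adjacent to [e] is phi|_{K^+} - phi|_{K^-}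
   on an interior edge, and phi on a boundary edge. *)
Definition jump (R : realType) (V : finType) (m n : nat) (M : mesh R V)
    (nu : {set V} -> 'cV[R]_2) (phi : dgfield R V m n) (e : {set V})
    (x : R * R) : 'M[R]_(m, n) :=
  \sum_(K in cells M | e \in sides K) orientation M nu K e *: phi K x.

Definition jump_normal (R : realType) (V : finType) (M : mesh R V)
    (nu : {set V} -> 'cV[R]_2) (tau : dgfield R V 2 2) (e : {set V})
    (x : R * R) : 'cV[R]_2 :=
  jump M nu (fun K y => tau K y *m nu e) e x.

(* Trace of a field on an edge across which it does not jump, as the mean of
   the (equal) traces from the adjacent cells. *)
Definition trace_on (R : realType) (V : finType) (m n : nat) (M : mesh R V)
    (phi : dgfield R V m n) (e : {set V}) (x : R * R) : 'M[R]_(m, n) :=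
  #|[set K in cells M | e \in sides K]%SET|%:R^-1 *:
    \sum_(K in cells M | e \in sides K) phi K x.

Definition L2norm (R : realType) (V : finType) (m n : nat) (M : mesh R V)
    (phi : dgfield R V m n) : R :=
  Num.sqrt (\sum_(K in cells M) int_cell M K (fun x => mdot (phi K x) (phi K x))).

Definition nonzero (R : realType) (V : finType) (m n : nat) (M : mesh R V)
    (phi : dgfield R V m n) : Prop :=
  exists K x, [/\ K \in cells M, geom M K x & phi K x != 0].

(** * Staggered spaces, bilinear form and norm

    [M] is the primal mesh, the fields live on [refine M]. *)

Definition Uh (R : realType) (V : finType) (Omega : set (R * R)) (k : nat)
    (M : mesh R V) (nu : {set (V + {set V})%type} -> 'cV[R]_2)
    (v : dgfield R (V + {set V})%type 2 1) : Prop :=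
  piecewise_poly k (refine M) v /\
  forall e, e \in primal_edges M -> ~ boundary_edge Omega (refine M) e ->
    forall x, geom (refine M) e x -> jump (refine M) nu v e x = 0.

Definition Uh0 (R : realType) (V : finType) (Omega : set (R * R)) (k : nat)
    (M : mesh R V) (nu : {set (V + {set V})%type} -> 'cV[R]_2)
    (v : dgfield R (V + {set V})%type 2 1) : Prop :=
  Uh Omega k M nu v /\
  forall e, e \in primal_edges M -> boundary_edge Omega (refine M) e ->
    forall x, geom (refine M) e x -> trace_on (refine M) v e x = 0.

Definition Sigmah (R : realType) (V : finType) (k : nat) (M : mesh R V)
    (nu : {set (V + {set V})%type} -> 'cV[R]_2)
    (tau : dgfield R (V + {set V})%type 2 2) : Prop :=
  piecewise_poly k (refine M) tau /\
  forall e, e \in dual_edges M ->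
    forall x, geom (refine M) e x -> jump_normal (refine M) nu tau e x = 0.

Definition Sigmahs (R : realType) (V : finType) (k : nat) (M : mesh R V)
    (nu : {set (V + {set V})%type} -> 'cV[R]_2)
    (tau : dgfield R (V + {set V})%type 2 2) : Prop :=
  Sigmah k M nu tau /\
  forall K, K \in cells (refine M) ->
    forall x, geom (refine M) K x -> (tau K x)^T = tau K x.

Definition bstar (R : realType) (V : finType) (M : mesh R V)
    (nu : {set (V + {set V})%type} -> 'cV[R]_2)
    (v : dgfield R (V + {set V})%type 2 1)
    (tau : dgfield R (V + {set V})%type 2 2) : R :=
  - \sum_(K in cells (refine M))
      int_cell (refine M) K (fun x => mdot (v K x) (divg (tau K) x))
  + \sum_(e in primal_edges M)
      int_edge (refine M) e (fun x =>
        mdot (trace_on (refine M) v e x) (jump_normal (refine M) nu tau e x)).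

Definition H1norm (R : realType) (V : finType) (M : mesh R V)
    (nu : {set (V + {set V})%type} -> 'cV[R]_2)
    (v : dgfield R (V + {set V})%type 2 1) : R :=
  Num.sqrt
    (\sum_(K in cells (refine M))
       int_cell (refine M) K (fun x => mdot (grad (v K) x) (grad (v K) x))
     + \sum_(e in dual_edges M)
         (diam (geom (refine M) e))^-1 *
         int_edge (refine M) e (fun x =>
           mdot (jump (refine M) nu v e x) (jump (refine M) nu v e x))).

(* Main.v *)
(* On a primal triangle with barycenter c, let A_0 + A_1 + A_2 = 0 be the arms
   from c to the vertices, so that the i-th sub-triangle is
   {c + s A_i + t A_(i+1)}.  In the oblique components u_1 = A_i.v,
   u_2 = A_(i+1).v and
   tau = p (A_i A_(i+1)^T + A_(i+1) A_i^T) + q A_i A_i^T + r A_(i+1) A_(i+1)^T,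
   the form b^*_h restricted to a primal triangle no longer depends on the shape
   of the triangle.  The fields v annihilated by every admissible tau on this
   reference configuration have vanishing strains and vanishing spoke jumps
   (testing with bubbles kills the diagonal strains, and an orthogonal
   polynomial argument does the rest), so by finite dimensionality some tau with
   |tau|^2 <= C b(v, tau) controls the strains and the jumps of v by b(v, tau).
   After scaling by the Jacobian the choices on the individual triangles add up.

   It remains to bound the gradient by the strains and the jumps, a discrete
   Korn inequality.  Pointwise |grad v|^2 <= 2 |eps(v)|^2 + 2 det(grad v), and
   the determinant is a divergence: its boundary terms cancel on primal edges,
   where v is continuous (or zero), while on dual edges they contain the jump of
   v, up to point values at barycenters and at vertices.  Around a vertex the
   cells form cycles, or chains ending where v = 0, so a constant may be
   subtracted along each of them; shape regularity bounds their number. *)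
From HB Require Import structures.
Require Import Defs.
From mathcomp Require Import all_boot all_order all_algebra.
From mathcomp Require Import all_classical all_reals all_analysis.
From mathcomp Require Import measurable_realfun polyXY ring lra zify.

Import Order.TTheory GRing.Theory Num.Theory.
Import numFieldNormedType.Exports.

Local Open Scope classical_set_scope.
Local Open Scope ring_scope.

Set Implicit Arguments.
Unset Strict Implicit.
Unset Printing Implicit Defensive.

(** * Polynomials on the reference triangle *)

(** The obstacle is a degree count. A shear component [p = s t w] vanishes on both spokes of a
    sub-triangle and isolates the shear strain, but [w] must have degree at most [k - 2] while the
    strain may have degree [k - 1]. The missing top degree is carried by one polynomial [Q] of
    degree [k], orthogonal on the unit interval with weight [x] to all lower degrees: its reflected
    derivative is orthogonal, with weight [s t] on the triangle, to the functions of one variable of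
    degree at most [k - 2]. Once its multiples are split off, the square test is admissible, and a
    linear system in a few scalars per sub-triangle remains, whose solutions have neither strain nor
    jump. Reference integrals are algebraic functionals of polynomials, identified with Lebesgue
    integrals once, so the finite dimensional arguments involve no measure theory. Uniformity holds
    because the reference constants are fixed by [k], while the geometry enters only through
    [|A_i|^2 <= 2 gamma J] and the number of cells at a vertex. *)

Section affine_change_of_variables.
Context {R : realType}.
Notation mu := (@lebesgue_measure R).

Lemma preimage_affine_pos (al be a b : R) : 0 < al ->
  (fun x => al * x + be) @^-1` `]a, b] = `](a - be) / al, (b - be) / al]%classic.
Proof.
move=> al0; apply/seteqP; split=> x /=; rewrite !in_itv/= => /andP[h1 h2].
  by rewrite ltr_pdivrMr// ler_pdivlMr//; apply/andP; split; lra.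
by move: h1 h2; rewrite ltr_pdivrMr// ler_pdivlMr// => h1 h2; apply/andP; split; lra.
Qed.

Lemma preimage_affine_neg (al be a b : R) : al < 0 ->
  (fun x => al * x + be) @^-1` `]a, b] = `[(b - be) / al, (a - be) / al[%classic.
Proof.
move=> al0; apply/seteqP; split=> x /=; rewrite !in_itv/= => /andP[h1 h2].
  by rewrite ler_ndivrMr// ltr_ndivlMr//; apply/andP; split; lra.
by move: h1 h2; rewrite ler_ndivrMr// ltr_ndivlMr// => h1 h2; apply/andP; split; lra.
Qed.

Lemma measurable_affine (al be : R) :
  measurable_fun setT (fun x : measurableTypeR R => al * x + be : measurableTypeR R).
Proof. by apply: measurable_funD => //; apply: measurable_funM. Qed.

Definition affine (al be : R) (x : measurableTypeR R) : measurableTypeR R :=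
  al * x + be.

Definition affine_push (al be : R) :
  {measure set (measurableTypeR R) -> \bar R}.
Proof.
unshelve refine (pushforward mu (affine al be) : {measure set _ -> \bar R}).
exact: measurable_affine.
Defined.

(** Lebesgue measure is determined by its values on half-open intervals; a negative slope reverses
    the interval and moves the excluded endpoint, which leaves the length unchanged. *)
Lemma affine_pushE (al be : R) (A : set R) (al0 : al != 0) : measurable A ->
  mscale (NngNum (normr_ge0 al)) (affine_push al be) A = mu A.
Proof.
move=> mA; apply/esym/lebesgue_measure_unique => //= _ [[a b]] _ <-.
rewrite /mscale /= /pushforward /= /affine.
have [al_gt0|al_lt0|/eqP] := ltgtP 0 al; last by rewrite eq_sym (negPf al0).
  rewrite preimage_affine_pos// !lebesgue_measure_itv/= !lte_fin gtr0_norm//.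
  rewrite ltr_pM2r ?invr_gt0// ltrD2r; case: ifP => _; last by rewrite mule0.
  by rewrite -EFinB -EFinB -EFinM; congr EFin; field.
rewrite preimage_affine_neg// !lebesgue_measure_itv/= !lte_fin ltr0_norm//.
rewrite ltr_nM2r ?invr_lt0// ltrD2r; case: ifP => _; last by rewrite mule0.
by rewrite -EFinB -EFinB -EFinM; congr EFin; field.
Qed.

Lemma ge0_integral_affine (al be : R) (g : R -> \bar R) : al != 0 ->
  measurable_fun setT g -> (forall x, 0 <= g x)%E ->
  (\int[mu]_x g x = (`|al|%R)%:E * \int[mu]_x g (al * x + be)%R)%E.
Proof.
move=> al0 mg g0.
transitivity (\int[mscale (NngNum (normr_ge0 al)) (affine_push al be)]_x g x)%E.
  by apply: eq_measure_integral => A mA _; apply/esym/affine_pushE.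
rewrite ge0_integral_mscale//=; congr (_ * _)%E.
by rewrite ge0_integral_pushforward//; exact: measurable_affine.
Qed.

Definition cross (x y : R * R) : R := x.1 * y.2 - x.2 * y.1.

Definition affmap (c a b : R * R) (z : R * R) : R * R :=
  (c.1 + z.1 * a.1 + z.2 * b.1, c.2 + z.1 * a.2 + z.2 * b.2).

Lemma measurable_affmap (c a b : R * R) :
  measurable_fun setT (affmap c a b : measurableTypeR R * measurableTypeR R -> 
     measurableTypeR R * measurableTypeR R).
Proof.
by apply/measurable_fun_pairP; split; apply: measurable_funD => //;
  try (apply: measurable_funD => //); apply: measurable_funM.
Qed.

Lemma measurable_pair_fst (g : R * R -> \bar R) (x : R) :
  measurable_fun setT g -> measurable_fun setT (fun y => g (x, y)).
Proof. by move=> mg; apply: measurableT_comp. Qed.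

Lemma measurable_pair_snd (g : R * R -> \bar R) (y : R) :
  measurable_fun setT g -> measurable_fun setT (fun x => g (x, y)).
Proof. by move=> mg; apply: measurableT_comp. Qed.

Lemma tonelli1 (g : R * R -> \bar R) : measurable_fun setT g ->
  (forall z, 0 <= g z)%E ->
  (\int[mu \x mu]_z g z = \int[mu]_x \int[mu]_y g (x, y))%E.
Proof. by move=> mg g0; exact: (@fubini_tonelli1 _ _ _ _ _ mu mu g mg g0). Qed.

Lemma tonelli2 (g : R * R -> \bar R) : measurable_fun setT g ->
  (forall z, 0 <= g z)%E ->
  (\int[mu \x mu]_z g z = \int[mu]_y \int[mu]_x g (x, y))%E.
Proof.
move=> mg g0; apply: etrans (tonelli1 mg g0) _.
exact: (@fubini_tonelli _ _ _ _ _ mu mu g mg g0).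
Qed.

Lemma integral_swap (g : R * R -> \bar R) : measurable_fun setT g ->
  (forall z, 0 <= g z)%E ->
  (\int[mu \x mu]_z g z = \int[mu \x mu]_z g (z.2, z.1))%E.
Proof.
move=> mg g0; rewrite tonelli1// (@tonelli2 (fun z => g (z.2, z.1)))//.
by apply: measurableT_comp => //; exact: measurable_fun_pair.
Qed.

(** Tonelli splits the planar map into two substitutions on lines: a vertical one of slope
    [cross a b / a.1] with an offset depending on [x], then a horizontal one of slope [a.1]. *)
Lemma ge0_integral_affmap0 (c a b : R * R) (g : R * R -> \bar R) :
  a.1 != 0 -> cross a b != 0 -> measurable_fun setT g -> (forall z, 0 <= g z)%E ->
  (\int[mu \x mu]_z g z =
   (`|cross a b|%R)%:E * \int[mu \x mu]_z g (affmap c a b z))%E.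
Proof.
move=> a1 D0 mg g0.
pose be x := c.2 + (x - c.1) * a.2 / a.1.
pose D := cross a b / a.1.
have D1 : D != 0 by rewrite mulf_neq0// invr_neq0.
pose h (z : R * R) := g (z.1, D * z.2 + be z.1).
have mh : measurable_fun setT h.
  apply: measurableT_comp => //; apply: measurable_fun_pair => //=.
  apply: measurable_funD; first by apply: measurable_funM.
  apply: measurable_funD => //; do 2!apply: measurable_funM => //.
  exact: measurable_funB.
have mga : measurable_fun setT (fun z => g (affmap c a b z)).
  by apply: measurableT_comp => //; exact: measurable_affmap.
transitivity (\int[mu]_x ((`|D|%R)%:E * \int[mu]_y h (x, y)))%E.
  rewrite tonelli1//; apply: eq_integral => x _.
  rewrite (@ge0_integral_affine D (be x) (fun y => g (x, y)))//.
  exact: measurable_pair_fst.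
rewrite ge0_integralZl//; last first.
  by move=> x _; apply: integral_ge0 => y _; exact: g0.
  exact: (@measurable_fun_fubini_tonelli_F _ _ _ _ _ mu h mh (fun z => g0 _)).
have h0 z : (0 <= h z)%E by exact: g0.
rewrite -(tonelli1 mh h0) (tonelli2 mh h0).
have -> : (\int[mu]_y \int[mu]_x h (x, y) =
  \int[mu]_t ((`|a.1|%R)%:E * \int[mu]_s g (affmap c a b (s, t))))%E.
  apply: eq_integral => t _.
  rewrite (@ge0_integral_affine a.1 (c.1 + t * b.1) (fun x => h (x, t)))//; last first.
    exact: measurable_pair_snd.
  congr (_ * _)%E; apply: eq_integral => s _; rewrite /h /affmap /= /be /D /cross.
  by congr (g (_, _)); [ring | field].
rewrite ge0_integralZl//; last first.
  by move=> x _; apply: integral_ge0 => y _; exact: g0.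
  exact: (@measurable_fun_fubini_tonelli_G _ _ _ _ _ mu (fun z => g (affmap c a b z)) mga (fun z => g0 _)).
rewrite muleA -EFinM -normrM divfK//; congr (_ * _)%E.
by rewrite (tonelli2 mga)// => z; exact: g0.
Qed.

(** If [a.1] vanishes, nondegeneracy forces [b.1 != 0]; exchanging the two reference coordinates
    exchanges the roles of [a] and [b]. *)
Lemma ge0_integral_affmap (c a b : R * R) (g : R * R -> \bar R) :
  cross a b != 0 -> measurable_fun setT g -> (forall z, 0 <= g z)%E ->
  (\int[mu \x mu]_z g z =
   (`|cross a b|%R)%:E * \int[mu \x mu]_z g (affmap c a b z))%E.
Proof.
move=> D0 mg g0; have [a1|a1] := eqVneq a.1 0; last exact: ge0_integral_affmap0.
have b1 : b.1 != 0.
  by apply: contra D0 => /eqP b1; rewrite /cross a1 b1 mul0r mulr0 subrr.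
have E : cross a b = - cross b a by rewrite /cross; ring.
rewrite (@ge0_integral_affmap0 c b a)//; last by rewrite -oppr_eq0 -E.
rewrite E normrN; congr (_ * _)%E.
rewrite integral_swap//; last first.
  by apply: measurableT_comp => //; exact: measurable_affmap.
by apply: eq_integral => z _; rewrite /affmap/=; congr (g (_, _)); ring.
Qed.

(** A positive finite factor distributes even over infinite differences, so positive and negative
    parts can be recombined without integrability. *)
Lemma EFin_pos_muleBr (r : R) (x y : \bar R) : 0 < r ->
  (r%:E * (x - y) = r%:E * x - r%:E * y)%E.
Proof.
move=> r0; case: x y => [x| |] [y| |] //=;
  rewrite ?gt0_muley ?gt0_muleNy ?lte_fin//= ?gt0_muley ?gt0_muleNy ?lte_fin//.
by rewrite -EFinB -!EFinM -EFinB mulrBr.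
Qed.

Lemma integral_affmap (c a b : R * R) (g : R * R -> \bar R) :
  cross a b != 0 -> measurable_fun setT g ->
  (\int[mu \x mu]_z g z =
   (`|cross a b|%R)%:E * \int[mu \x mu]_z g (affmap c a b z))%E.
Proof.
move=> D0 mg; rewrite integralE [in RHS]integralE.
rewrite EFin_pos_muleBr ?normr_gt0//; congr (_ - _)%E.
  rewrite (@ge0_integral_affmap c a b _ D0)//; last exact: measurable_funepos.
  by congr (_ * _)%E; apply: eq_integral => z _; rewrite !unlock.
rewrite (@ge0_integral_affmap c a b _ D0)//; last exact: measurable_funeneg.
  by congr (_ * _)%E; apply: eq_integral => z _; rewrite !unlock.
Qed.
End affine_change_of_variables.

(** * Algebraic integration of polynomials on the interval and the triangle *)

Section polynomial_integrals.
Context {R : realType}.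
Implicit Types (p q m n : {poly R}) (F G : {poly {poly R}}).

Section primitive.
Context {S : comUnitRingType}.

(** The inverse of zero is zero, so the term [i = 0] vanishes and the primitive is zero at the
    origin. The coefficient ring is general because the same operator also integrates the outer
    variable of a polynomial in two variables. *)
Definition prim (p : {poly S}) : {poly S} :=
  \poly_(i < (size p).+1) (p`_i.-1 * i%:R^-1).

Lemma coef_prim (p : {poly S}) i : (prim p)`_i = p`_i.-1 * i%:R^-1.
Proof.
rewrite coef_poly; case: i => [|i]; first by rewrite invr0 mulr0 ltn0Sn.
by case: ltnP => //=; rewrite ltnS => /leq_sizeP->//; rewrite mul0r.
Qed.

Lemma prim_is_linear : linear prim.
Proof.
move=> a p q; apply/polyP => i.
by rewrite !(coefD, coefZ, coef_prim) mulrDl mulrA.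
Qed.
HB.instance Definition _ :=
  GRing.isLinear.Build S {poly S} {poly S} _ prim prim_is_linear.

Lemma horner_prim0 (p : {poly S}) : (prim p).[0] = 0.
Proof. by rewrite horner_coef0 coef_prim invr0 mulr0. Qed.

Hypothesis natu : forall i, i.+1%:R \is a @GRing.unit S.

Lemma deriv_prim (p : {poly S}) : (prim p)^`() = p.
Proof.
by apply/polyP => i; rewrite coef_deriv coef_prim -[LHS]mulr_natr mulrVK.
Qed.

Lemma prim_deriv (p : {poly S}) : prim p^`() = p - (p.[0])%:P.
Proof.
apply/polyP => -[|i]; rewrite coef_prim coefB coefC /= ?invr0 ?mulr0.
  by rewrite horner_coef0 subrr.
by rewrite coef_deriv -[X in X / _]mulr_natr mulrK ?subr0.
Qed.
End primitive.

Lemma natunit i : i.+1%:R \is a @GRing.unit R.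
Proof. by rewrite unitfE pnatr_eq0. Qed.

Lemma polynatunit i : i.+1%:R \is a @GRing.unit {poly R}.
Proof. by rewrite -polyC_natr poly_unitE size_polyC pnatr_eq0 /= coefC/= natunit. Qed.

Definition int01 p : R := (prim p).[1].

(** For a fixed inner variable [t] the upper limit of the first integration is [1 - t];
    [integral_reftri] identifies the result with the integral over the reference triangle. *)
Definition tri F : R := int01 (prim F).[1 - 'X].

Lemma int01D : {morph int01 : p q / p + q}.
Proof. by move=> p q; rewrite /int01 linearD hornerD. Qed.
Lemma int01N : {morph int01 : p / - p}.
Proof. by move=> p; rewrite /int01 linearN hornerN. Qed.
Lemma int01B : {morph int01 : p q / p - q}.
Proof. by move=> p q; rewrite int01D int01N. Qed.
Lemma int010 : int01 0 = 0. Proof. by rewrite /int01 linear0 horner0. Qed.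
Lemma int01Z c p : int01 (c *: p) = c * int01 p.
Proof. by rewrite /int01 linearZ hornerZ. Qed.
Lemma int01C c : int01 c%:P = c.
Proof.
have {1}-> : c%:P = (c *: 'X)^`() by rewrite derivZ derivX alg_polyC.
by rewrite /int01 prim_deriv ?natunit//; [rewrite !hornerE subr0|exact: natunit].
Qed.
Lemma int01_deriv p : int01 p^`() = p.[1] - p.[0].
Proof. by rewrite /int01 prim_deriv ?hornerE//; exact: natunit. Qed.
Lemma int01_rev p : int01 (p \Po (1 - 'X)) = int01 p.
Proof.
have -> : p \Po (1 - 'X) = - ((prim p) \Po (1 - 'X))^`().
  rewrite deriv_comp deriv_prim; last exact: natunit.
  by rewrite derivB derivX -polyC1 derivC sub0r mulrN1 opprK.
rewrite int01N int01_deriv !horner_comp !hornerE subrr subr0 horner_prim0.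
by rewrite /int01 sub0r opprK.
Qed.

Lemma triD : {morph tri : F G / F + G}.
Proof. by move=> F G; rewrite /tri linearD hornerD int01D. Qed.
Lemma triN : {morph tri : F / - F}.
Proof. by move=> F; rewrite /tri linearN hornerN int01N. Qed.
Lemma triB : {morph tri : F G / F - G}.
Proof. by move=> F G; rewrite triD triN. Qed.
Lemma tri0 : tri 0 = 0. Proof. by rewrite /tri linear0 horner0 int010. Qed.
Lemma triZ c F : tri (c%:P *: F) = c * tri F.
Proof. by rewrite /tri linearZ hornerZ mul_polyC int01Z. Qed.
Lemma tri_sum I (r : seq I) (P : pred I) (E : I -> {poly {poly R}}) :
  tri (\sum_(i <- r | P i) E i) = \sum_(i <- r | P i) tri (E i).
Proof. exact: (big_morph _ triD tri0). Qed.
Lemma int01_sum I (r : seq I) (P : pred I) (E : I -> {poly R}) :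
  int01 (\sum_(i <- r | P i) E i) = \sum_(i <- r | P i) int01 (E i).
Proof. exact: (big_morph _ int01D int010). Qed.

Lemma prim_map_polyC n : prim n^:P = (prim n)^:P.
Proof.
apply/polyP => i; rewrite coef_prim !coef_map/= coef_prim polyCM; congr (_ * _).
case: i => [|i]; first by rewrite !invr0.
rewrite -polyC_natr; apply: (mulrI (polynatunit i)).
rewrite -[X in X * _]polyC_natr divrr; last first.
  by rewrite polyC_natr polynatunit.
by rewrite -[X in X * _]polyC_natr -polyCM divff ?pnatr_eq0.
Qed.

(* The outer variable of [F] is integrated first. *)
Lemma tri_mul m n : tri (m%:P * n^:P) = int01 (m * (prim n \Po (1 - 'X))).
Proof.
by rewrite /tri mul_polyC linearZ hornerZ /= prim_map_polyC.
Qed.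

(** The [size p] distinct points [a / (i + 1)] are roots, one more than the degree allows. *)
Lemma poly_itv_eq0 (a : R) p : 0 < a ->
  (forall x, 0 <= x <= a -> p.[x] = 0) -> p = 0.
Proof.
move=> a0 h; apply/eqP/negPn/negP => p0.
pose s := [seq a / i.+1%:R | i <- iota 0 (size p)].
have us : uniq s.
  rewrite map_inj_uniq ?iota_uniq// => i j /(mulfI (lt0r_neq0 a0))/invr_inj/eqP.
  by rewrite eqr_nat eqSS => /eqP.
have rs : all (root p) s.
  apply/allP => x /mapP[i _ ->]; apply/eqP/h.
  apply/andP; split; first by rewrite divr_ge0 ?ler0n// ltW.
  by rewrite ler_pdivrMr ?ltr0n// ler_peMr ?ler1n// ltW.
by have := max_poly_roots p0 rs us; rewrite size_map size_iota ltnn.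
Qed.

Lemma poly_ext p q : (forall x, p.[x] = q.[x]) -> p = q.
Proof.
move=> h; apply/eqP; rewrite -subr_eq0; apply/eqP.
by apply: (@poly_itv_eq0 1) => // x _; rewrite hornerE hornerN h subrr.
Qed.

Lemma horner2E F (s t : R) : F.[s, t] = (map_poly (horner_eval t) F).[s].
Proof.
by have /= := horner_map (horner_eval t) F s%:P; rewrite /horner_eval hornerC => ->.
Qed.

(** The box of side [1/2] lies inside the reference triangle, whence its use for the definiteness of
    [tri]. Each coefficient in the outer variable is a polynomial in [t] that vanishes on an
    interval. *)
Lemma bipoly_box_eq0 F :
  (forall s t, 0 <= s <= 2^-1 -> 0 <= t <= 2^-1 -> F.[s, t] = 0) -> F = 0.
Proof.
move=> h; apply/polyP => i; rewrite coef0.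
have h0 : 0 < 2^-1 :> R by rewrite invr_gt0.
apply: (poly_itv_eq0 h0) => t t01.
suff : map_poly (horner_eval t) F = 0.
  by move=> /(congr1 (fun p : {poly R} => p`_i)); rewrite coef_map coef0.
by apply: (poly_itv_eq0 h0) => s s01; rewrite -horner2E h.
Qed.

Lemma bipoly_ext F G : (forall s t, F.[s, t] = G.[s, t]) -> F = G.
Proof.
move=> h; apply/eqP; rewrite -subr_eq0; apply/eqP.
by apply: bipoly_box_eq0 => s t _ _; rewrite !hornerE h subrr.
Qed.

Lemma horner_prim_homo p (a : R) : (forall x, 0 <= x <= a -> 0 <= p.[x]) ->
  forall x y, 0 <= x -> x <= y -> y <= a -> (prim p).[x] <= (prim p).[y].
Proof.
move=> h x y x0 xy ya.
have [->//|xny] := eqVneq x y.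
have xlty : x < y by rewrite lt_neqAle xny.
apply: (@ger0_derive1_le_cc _ (horner (prim p)) x y) => //.
- move=> z /[!in_itv]/= /andP[xz zy].
  rewrite -derivE deriv_prim; last exact: natunit.
  by apply: h; rewrite (le_trans x0 (ltW xz))/= (le_trans (ltW zy) ya).
- exact/continuous_subspaceT/continuous_horner.
- by rewrite in_itv/= lexx.
- by rewrite in_itv/= lexx andbT.
Qed.

Lemma prim_ge0 p (a : R) : 0 <= a -> (forall x, 0 <= x <= a -> 0 <= p.[x]) ->
  0 <= (prim p).[a].
Proof.
by move=> a0 h; rewrite -(horner_prim0 p); apply: horner_prim_homo h _ _ _ _ _.
Qed.

(** The primitive is nondecreasing and vanishes at both ends of the interval, so it is zero, and
    with it its derivative [p]. *)
Lemma prim_eq0 p (a : R) : 0 < a -> (forall x, 0 <= x <= a -> 0 <= p.[x]) ->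
  (prim p).[a] = 0 -> p = 0.
Proof.
move=> a0 h pa0; rewrite -(deriv_prim natunit p).
suff -> : prim p = 0 by rewrite deriv0.
apply: (poly_itv_eq0 a0) => x /andP[x0 xa]; apply/eqP; rewrite eq_le.
rewrite -{1}pa0 -(horner_prim0 p).
by rewrite !(horner_prim_homo h)// ltW.
Qed.

Lemma int01_ge0 p : (forall x, 0 <= x <= 1 -> 0 <= p.[x]) -> 0 <= int01 p.
Proof. exact: prim_ge0. Qed.

Lemma int01_eq0 p : (forall x, 0 <= x <= 1 -> 0 <= p.[x]) -> int01 p = 0 ->
  p = 0.
Proof. exact: prim_eq0. Qed.

Lemma horner_inner F (t : R) :
  (prim F).[1 - 'X].[t] = (prim (map_poly (horner_eval t) F)).[1 - t].
Proof.
have -> : prim (map_poly (horner_eval t) F) = map_poly (horner_eval t) (prim F).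
  apply/polyP => i; rewrite coef_prim !coef_map /= coef_prim /horner_eval hornerM.
  congr (_ * _); case: i => [|i]; first by rewrite !invr0 horner0.
  apply: (mulrI (natunit i)); rewrite divff ?pnatr_eq0//.
  rewrite -[X in X * _](hornerC _ t) -hornerM polyC_natr divrr ?hornerC//.
  exact: polynatunit.
have /= := horner_map (horner_eval t) (prim F) (1 - 'X).
by rewrite /horner_eval !hornerE => ->.
Qed.

Lemma tri_ge0 F :
  (forall s t, 0 <= s -> 0 <= t -> s + t <= 1 -> 0 <= F.[s, t]) -> 0 <= tri F.
Proof.
move=> h; apply: int01_ge0 => t /andP[t0 t1]; rewrite horner_inner.
apply: prim_ge0; first by lra.
by move=> s /andP[s0 s1]; rewrite -horner2E h//; lra.
Qed.

Lemma tri_eq0 F :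
  (forall s t, 0 <= s -> 0 <= t -> s + t <= 1 -> 0 <= F.[s, t]) ->
  tri F = 0 -> F = 0.
Proof.
move=> h F0; apply: bipoly_box_eq0 => s t /andP[s0 s1] /andP[t0 t1].
have inner0 : (prim F).[1 - 'X] = 0.
  apply: int01_eq0 F0 => x /andP[x0 x1]; rewrite horner_inner.
  apply: prim_ge0; first by lra.
  by move=> y /andP[y0 y1]; rewrite -horner2E h//; lra.
rewrite horner2E; have -> : map_poly (horner_eval t) F = 0; last by rewrite horner0.
(* The bound [t <= 1/2] of the box keeps the slice from [0] to [1 - t] nondegenerate. *)
apply: (@prim_eq0 _ (1 - t)); first by lra.
  by move=> y /andP[y0 y1]; rewrite -horner2E h//; lra.
by rewrite -horner_inner inner0 horner0.
Qed.

Lemma bipoly_sum F : F = \sum_(i < size F) (F`_i)%:P * ('X^i)^:P.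
Proof.
rewrite -[LHS]coefK poly_def; apply: eq_bigr => i _.
by rewrite rmorphXn /= map_polyX mul_polyC.
Qed.

(** Fubini on the triangle for a product of functions of one variable. After a reflection the
    integrands differ by the derivative of [prim m * (prim n \Po (1 - 'X))], which vanishes at both
    ends. *)
Lemma int01_prim_swap m n :
  int01 (m * (prim n \Po (1 - 'X))) = int01 (n * (prim m \Po (1 - 'X))).
Proof.
rewrite -[RHS]int01_rev comp_polyM.
have -> : (prim m \Po (1 - 'X)) \Po (1 - 'X) = prim m.
  by rewrite -comp_polyA comp_polyB comp_polyX -polyC1 comp_polyC subKr comp_polyXr.
apply/eqP; rewrite -subr_eq0 -int01B; apply/eqP.
have -> : m * (prim n \Po (1 - 'X)) - (n \Po (1 - 'X)) * prim m =
  (prim m * (prim n \Po (1 - 'X)))^`().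
  rewrite derivM deriv_comp !deriv_prim ?derivB ?derivX -?polyC1 ?derivC;
    by [ring | exact: natunit].
rewrite int01_deriv !hornerM !horner_comp !hornerE subrr subr0.
by rewrite !horner_prim0 mulr0 mul0r subrr.
Qed.

Lemma swapXYM F G : swapXY (F * G) = swapXY F * swapXY G.
Proof. exact: rmorphM. Qed.

Lemma tri_swap F : tri (swapXY F) = tri F.
Proof.
rewrite [in LHS](bipoly_sum F) [in RHS](bipoly_sum F) raddf_sum !tri_sum; apply: eq_bigr => i _.
rewrite /= swapXYM swapXY_polyC swapXY_map_polyC [_ * _%:P]mulrC !tri_mul.
exact: int01_prim_swap.
Qed.

Lemma tri_mulC m n : tri (m%:P * n^:P) = int01 (n * (prim m \Po (1 - 'X))).
Proof. by rewrite tri_mul int01_prim_swap. Qed.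

Definition dY F := swapXY (swapXY F)^`().

(** With [tri_derivY], the divergence theorem on the reference triangle: [F.[1 - 'X]] is the trace
    on the hypotenuse, parametrised by [t]. *)
Lemma tri_derivX F : tri F^`() = int01 F.[1 - 'X] - int01 F.[0].
Proof.
rewrite /tri prim_deriv ?hornerE ?int01B//; exact: polynatunit.
Qed.

Lemma horner_swap_hyp F : (swapXY F).[1 - 'X] = F.[1 - 'X] \Po (1 - 'X).
Proof.
have E G (p : {poly R}) x : G.[p].[x] = G.[p.[x], x].
  rewrite horner2E; have /= := horner_map (horner_eval x) G p.
  by rewrite /horner_eval => ->.
apply: poly_ext => x; rewrite horner_comp (E (swapXY F)) (E F) horner2_swapXY.
by rewrite !hornerE subKr.
Qed.

Lemma tri_derivY F : tri (dY F) = int01 F.[1 - 'X] - int01 (swapXY F).[0].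
Proof.
by rewrite tri_swap tri_derivX horner_swap_hyp int01_rev.
Qed.
End polynomial_integrals.

(** * Agreement with the Lebesgue integral *)

Section lebesgue_polynomials.
Context {R : realType}.
Notation mu := (@lebesgue_measure R).
Implicit Types (p : {poly R}) (F : {poly {poly R}}).

Lemma integral_poly p (a : R) : 0 <= a ->
  (\int[mu]_(x in `[0%R, a]) (p.[x])%:E = ((prim p).[a])%:E)%E.
Proof.
rewrite le_eqVlt => /predU1P[<-|a0].
  by rewrite set_itv1 integral_set1 horner_prim0.
rewrite (@continuous_FTC2 _ _ (horner (prim p)))//; last 3 first.
- exact/continuous_subspaceT/continuous_horner.
- split => [x _||]; first exact: derivable_horner.
  + exact/cvg_at_right_filter/continuous_horner.
  + exact/cvg_at_left_filter/continuous_horner.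
- by move=> x _; rewrite -derivE deriv_prim//; exact: natunit.
by rewrite horner_prim0 sube0.
Qed.

Lemma Rintegral_int01 p : (\int[mu]_(x in `[0%R, 1%R]) p.[x] = int01 p)%R.
Proof. by rewrite /Rintegral integral_poly. Qed.

Lemma measurable_bipoly F :
  measurable_fun setT (fun z : R * R => F.[z.1, z.2]).
Proof.
have -> : (fun z : R * R => F.[z.1, z.2]) =
  (fun z => \sum_(i < size F) (F`_i).[z.2] * z.1 ^+ i).
  apply/funext => z; rewrite (horner_coef F) horner_sum; apply: eq_bigr => i _.
  by rewrite -polyC_exp mulrC mul_polyC hornerZ mulrC.
apply: measurable_sum => i; apply: measurable_funM; last exact: measurable_funX.
have mh : measurable_fun setT (horner (F`_i) : R -> R).
  by apply: continuous_measurable_fun; exact: continuous_horner.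
exact: (measurableT_comp mh).
Qed.

Definition reftri : set (R * R) :=
  [set z | [&& 0 <= z.1, 0 <= z.2 & z.1 + z.2 <= 1]].

Lemma measurable_reftri : measurable reftri.
Proof.
have -> : reftri = [set z : R * R | (fun=> 0%R) z <= z.1] `&`
   ([set z : R * R | (fun=> 0%R) z <= z.2] `&` [set z : R * R | z.1 + z.2 <= (fun=> 1%R) z]).
  apply/seteqP; split => z /=; first by move=> /and3P[].
  by move=> [? [? ?]]; apply/and3P.
have mle (f g : R * R -> R) : measurable_fun setT f -> measurable_fun setT g ->
    measurable [set z | f z <= g z].
  move=> mf mg; have := measurable_fun_ler mf mg measurableT (Y := [set true]).
  by rewrite setTI; apply.
apply: measurableI; first exact: mle.
by apply: measurableI; apply: mle => //; exact: measurable_funD.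
Qed.

Lemma ge0_integral_reftri F : (forall s t, 0 <= F.[s, t]) ->
  (\int[mu \x mu]_(z in reftri) (F.[z.1, z.2])%:E = (tri F)%:E)%E.
Proof.
move=> F0; rewrite integral_mkcond.
pose f := EFin \o (fun z : R * R => F.[z.1, z.2]).
have mf : measurable_fun setT f by apply/measurable_EFinP; exact: measurable_bipoly.
rewrite (@tonelli2 _ (f \_ reftri)); last 2 first.
- exact/(measurable_restrictT _ measurable_reftri)/measurable_funTS.
- by move=> z; rewrite patchE; case: ifP => // _; rewrite lee_fin F0.
rewrite /tri -[RHS](@integral_poly _ 1)// [RHS]integral_mkcond.
apply: eq_integral => t _; rewrite patchE mem_setE in_itv/=.
have [/andP[t0 t1]|t01] := boolP (0 <= t <= 1).
  rewrite horner_inner -integral_poly; last by lra.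
  rewrite [RHS]integral_mkcond; apply: eq_integral => s _.
  rewrite !patchE /f/= -horner2E.
  rewrite (_ : (s \in [set` _]) = (0 <= s <= 1 - t)); last by rewrite mem_setE in_itv.
  rewrite (_ : ((s, t) \in reftri) = (0 <= s <= 1 - t))//.
  apply/idP/idP; rewrite inE /reftri/= t0/= => /andP[-> h]; lra.
rewrite integral0_eq// => s _; rewrite patchE ifF//.
apply/negbTE; apply: contra t01; rewrite inE /reftri/= => /and3P[? ? ?].
by apply/andP; split; lra.
Qed.

(** [F] is the difference of the squares of [(F + 1) / 2] and [(F - 1) / 2], to each of which the
    nonnegative case applies. *)
Lemma integral_reftri F :
  (\int[mu \x mu]_(z in reftri) (F.[z.1, z.2])%:E = (tri F)%:E)%E.
Proof.
pose c : R := 2^-1.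
pose G : {poly {poly R}} := (c%:P *: (F + 1)) ^+ 2.
pose H : {poly {poly R}} := (c%:P *: (F - 1)) ^+ 2.
have FGH : F = G - H.
  have cc : 4 * (c * c) = 1 by rewrite /c; field.
  have -> : F = (4 * (c * c))%:P%:P * F by rewrite cc polyC1 mul1r.
  by rewrite /G /H -!mul_polyC !polyCM; ring.
have G0 s t : 0 <= G.[s, t] by rewrite /G !horner_exp sqr_ge0.
have H0 s t : 0 <= H.[s, t] by rewrite /H !horner_exp sqr_ge0.
have int E : (forall s t, 0 <= E.[s, t]) ->
    (mu \x mu)%E.-integrable reftri (EFin \o (fun z : R * R => E.[z.1, z.2])).
  move=> E0; apply/integrableP; split.
    apply/measurable_funTS/measurable_EFinP; exact: measurable_bipoly.
  under eq_integral => z _ do rewrite /= ger0_norm//.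
  by rewrite ge0_integral_reftri// ltry.
have := @integralB_EFin _ _ _ (mu \x mu)%E _ _ _ measurable_reftri (int _ G0) (int _ H0).
rewrite (ge0_integral_reftri G0) (ge0_integral_reftri H0) -EFinB -triB -FGH => <-.
by apply: eq_integral => z _; rewrite -EFinB {1}FGH !(hornerN, hornerD).
Qed.

Lemma Rintegral_affmap (c a b : R * R) (D : set (R * R)) (f : R * R -> R) F :
  cross a b != 0 -> measurable_fun setT f -> measurable D ->
  affmap c a b @^-1` D = reftri ->
  (forall z, f (affmap c a b z) = F.[z.1, z.2]) ->
  (\int[(mu \x mu)%E]_(x in D) f x = `|cross a b| * tri F)%R.
Proof.
move=> D0 mf mD DT fF; rewrite /Rintegral integral_mkcond.
rewrite (@integral_affmap _ c a b)//; last first.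
  by apply/(measurable_restrictT _ mD)/measurable_funTS/measurable_EFinP.
have -> : (\int[mu \x mu]_z ((EFin \o f) \_ D) (affmap c a b z) = (tri F)%:E)%E.
  rewrite -integral_reftri [RHS]integral_mkcond; apply: eq_integral => z _.
  rewrite !patchE -DT /= fF.
  have -> : (z \in affmap c a b @^-1` D) = (affmap c a b z \in D).
    by apply/idP/idP; rewrite !inE.
  by [].
by rewrite -EFinM.
Qed.
End lebesgue_polynomials.

(** * The orthogonal polynomial with weight x *)

Section orthogonal_polynomial.
Context {R : realType}.
Implicit Types (p q m n Q : {poly R}).

Lemma int01CM c p : int01 (c%:P * p) = c * int01 p.
Proof. by rewrite mul_polyC int01Z. Qed.

Lemma int01Xn i : int01 ('X^i : {poly R}) = i.+1%:R^-1.
Proof.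
have -> : 'X^i = (i.+1%:R^-1 *: 'X^(i.+1))^`() :> {poly R}.
  rewrite derivZ derivXn /= -scalerMnr scalerMnl -[X in X *: _]mulr_natr mulVf ?pnatr_eq0//.
  by rewrite scale1r.
by rewrite int01_deriv !hornerZ !hornerXn expr1n expr0n /= mulr1 mulr0 subr0.
Qed.

Lemma int01X : int01 ('X : {poly R}) = 2^-1.
Proof. by rewrite -['X]expr1 int01Xn. Qed.

Lemma int01_wsq_eq0 w p : (forall x, 0 <= x <= 1 -> 0 <= w.[x]) -> w != 0 ->
  int01 (w * p ^+ 2) = 0 -> p = 0.
Proof.
move=> w0 wn0 /int01_eq0 h; apply/eqP; rewrite -sqrf_eq0.
have /eqP : w * p ^+ 2 = 0.
  by apply: h => x x01; rewrite hornerM mulr_ge0 ?w0// horner_exp sqr_ge0.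
by rewrite mulf_eq0 (negPf wn0).
Qed.

(** Orthogonalisation of ['X^k] against lower degrees. The Gram matrix of weight [x] is invertible,
    since a row in its kernel is a polynomial whose weighted square has integral zero. *)
Lemma orthogonal_poly_exists k : exists Q : {poly R},
  [/\ Q \is monic, size Q = k.+1 &
      forall m, (size m <= k)%N -> int01 ('X * Q * m) = 0].
Proof.
pose G : 'M[R]_k := \matrix_(i, j) int01 ('X * 'X^i * 'X^j).
have rG (u : 'rV[R]_k) j : (u *m G) 0 j = int01 ('X * rVpoly u * 'X^j).
  rewrite mxE /rVpoly poly_def mulr_sumr mulr_suml int01_sum.
  apply: eq_bigr => i _; rewrite mxE valK /=.
  by rewrite -mul_polyC -int01CM; congr int01; ring.
have rGp (u : 'rV[R]_k) m : (size m <= k)%N -> u *m G = 0 ->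
    int01 ('X * rVpoly u * m) = 0.
  move=> mk uG; rewrite -[m]coefK poly_def mulr_sumr int01_sum big1// => i _.
  rewrite -mul_polyC mulrCA int01CM.
  have ik : (i < k)%N by rewrite (leq_trans (ltn_ord i)).
  by have /= := rG u (Ordinal ik); rewrite uG mxE => <-; rewrite mulr0.
have Gu : G \in unitmx.
  rewrite -row_free_unit -kermx_eq0; apply/eqP/row_matrixP => i.
  rewrite row0; set u := row i _.
  have uG : u *m G = 0 by rewrite -row_mul mulmx_ker row0.
  have := rGp u (rVpoly u) (size_poly _ _) uG.
  rewrite -mulrA -expr2 => /int01_wsq_eq0 h.
  rewrite -[u]rVpolyK h ?linear0 ?polyX_eq0//.
  by move=> x /andP[x0 _]; rewrite hornerX.
pose b : 'rV[R]_k := \row_j int01 ('X * 'X^k * 'X^j).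
pose w := - (b *m invmx G).
have wG : w *m G = - b by rewrite mulNmx mulmxKV.
have sw : (size (rVpoly w) <= k)%N by exact: size_poly.
have sX : (size (rVpoly w) < size ('X^k : {poly R}))%N by rewrite size_polyXn ltnS.
exists ('X^k + rVpoly w); split.
- by rewrite monicE lead_coefDl// lead_coefXn.
- by rewrite size_polyDl// size_polyXn.
move=> m mk; rewrite -[m]coefK poly_def mulr_sumr int01_sum big1// => i _.
rewrite -mul_polyC mulrCA int01CM mulrDr mulrDl int01D.
have ik : (i < k)%N by rewrite (leq_trans (ltn_ord i)).
have /= := rG w (Ordinal ik); rewrite wG !mxE /= => <-.
by rewrite subrr mulr0.
Qed.

(** Write [Q = Qd * 'X + Q(0)]. Orthogonality to [Qd] reduces the integral of the square of [Q] to
    [Q(0)] times that of [Q], so a vanishing mean would force [Q = 0]. *)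
Lemma orthogonal_poly_int k Q : Q \is monic -> size Q = k.+1 ->
  (forall m, (size m <= k)%N -> int01 ('X * Q * m) = 0) -> int01 Q != 0.
Proof.
move=> mQ sQ oQ; apply/negP => /eqP Q0.
suff Q1 : int01 (1 * Q ^+ 2) = 0.
  have /eqP : Q = 0.
    by apply: int01_wsq_eq0 Q1; rewrite ?oner_eq0// => x _; rewrite hornerE ler01.
  by rewrite -size_poly_eq0 sQ.
have [Qd [QE sQd]] : exists (Qd : {poly R}), Q = Qd * 'X + (Q`_0)%:P /\ (size Qd <= k)%N.
  exists (drop_poly 1 Q); split; last by rewrite size_drop_poly sQ subn1.
  rewrite -[LHS](poly_take_drop 1) expr1 addrC; congr (_ + _).
  apply/polyP => -[|i]; first by rewrite coef_take_poly coefC.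
  by rewrite coef_take_poly coefC.
have -> : 1 * Q ^+ 2 = 'X * Q * Qd + (Q`_0)%:P * Q.
  by rewrite mul1r expr2 {2}QE; ring.
by rewrite int01D int01CM Q0 mulr0 addr0 oQ.
Qed.

(** Integration by parts: [(1 - x) x^2 n] vanishes at both ends, and its derivative keeps a factor
    [x], which leaves [x Q] times a polynomial of degree below [k]. *)
Lemma orthogonal_poly_deriv k Q n :
  (forall m, (size m <= k)%N -> int01 ('X * Q * m) = 0) -> (size n < k)%N ->
  int01 ((1 - 'X) * 'X^2 * n * Q^`()) = 0.
Proof.
move=> oQ sn.
have -> : (1 - 'X) * 'X^2 * n * Q^`() =
  ((1 - 'X) * 'X^2 * n * Q)^`() -
  'X * Q * ((2%:P - 3%:P * 'X) * n + 'X * (1 - 'X) * n^`()).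
  rewrite expr2 !derivM !derivB !derivX -polyC1 derivC.
  rewrite !polyC_natr; ring.
rewrite int01B int01_deriv oQ ?subr0; last first.
  rewrite (leq_trans (size_polyD _ _))// geq_max; apply/andP; split.
    rewrite (leq_trans (size_polyMleq _ _))//.
    have : (size (2%:P - 3%:P * 'X : {poly R})%R <= 2)%N.
      rewrite (leq_trans (size_polyD _ _))// geq_max size_polyN mul_polyC.
      rewrite (leq_trans (size_polyC_leq1 _))//=.
      by rewrite (leq_trans (size_scale_leq _ _))// size_polyX.
    move: sn; lia.
  have [->|n0] := eqVneq n 0; first by rewrite deriv0 mulr0 size_poly0.
  rewrite (leq_trans (size_polyMleq _ _))//.
  have s2 : (size ('X * (1 - 'X) : {poly R})%R <= 3)%N.
    rewrite (leq_trans (size_polyMleq _ _))// size_polyX.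
    have : (size (1 - 'X : {poly R})%R <= 2)%N.
      by rewrite (leq_trans (size_polyD _ _))// size_polyN size_polyX size_poly1.
    lia.
  have := lt_size_deriv n0; move: s2 sn; lia.
rewrite !hornerM !hornerX.
have -> : (1 - 'X : {poly R}).[1] = 0 by rewrite !hornerE subrr.
by rewrite !(mul0r, mulr0) subrr.
Qed.
End orthogonal_polynomial.

(** * The form on the reference configuration *)

Section reference_form.
Context {R : realType}.
Notation bp := {poly {poly R}}.
Implicit Types (F G : bp) (m n : {poly R}).

(* Total degree at most [k]; the outer variable is [s], the inner one [t]. *)
Definition tdeg (k : nat) F : Prop := forall i j, (k < i + j)%N -> F`_i`_j = 0.

(* Traces on the sides [t = 0] and [s = 0]. *)
Definition sE F : {poly R} := (swapXY F).[0].
Definition tE F : {poly R} := F.[0].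

Record sfield := SField { fp : 'I_3 -> bp; fq : 'I_3 -> bp; fr : 'I_3 -> bp }.

(** Normal continuity across spoke [i], where sub-triangle [i] has trace [sE] and [i - 1] has trace
    [tE]. A normal [n] to [A_i] leaves [(A_(i+1).n) (p A_i + r A_(i+1))] on one side and
    [(A_(i-1).n) (p' A_i + q' A_(i-1))] on the other; inserting [A_(i-1) = - A_i - A_(i+1)] and
    comparing components gives [r = q'] and [r = p + p']. *)
Definition admissible (k : nat) (tau : sfield) : Prop :=
  [/\ forall i, [/\ tdeg k (fp tau i), tdeg k (fq tau i) & tdeg k (fr tau i)],
      forall i, sE (fr tau i) = tE (fq tau (i - 1)) &
      forall i, sE (fr tau i) = sE (fp tau i) + tE (fp tau (i - 1))].

(** The form after integration by parts on each sub-triangle: the hypotenuse terms cancel those on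
    the primal edges, so that strains and spoke traces remain, all with a plus sign. *)
Definition bhat (u1 u2 : 'I_3 -> bp) (tau : sfield) : R :=
  \sum_i (tri (fp tau i * (dY (u1 i) + (u2 i)^`()) + fq tau i * (u1 i)^`()
               + fr tau i * dY (u2 i))
          + int01 (sE (fp tau i) * sE (u1 i) + sE (fr tau i) * sE (u2 i))
          + int01 (tE (fp tau i) * tE (u2 i) + tE (fq tau i) * tE (u1 i))).

Lemma sED : {morph sE : F G / F + G}.
Proof. by move=> F G; rewrite /sE raddfD hornerD. Qed.
Lemma tED : {morph tE : F G / F + G}.
Proof. by move=> F G; rewrite /tE hornerD. Qed.
Lemma sEM : {morph sE : F G / F * G}.
Proof. by move=> F G; rewrite /sE swapXYM hornerM. Qed.
Lemma tEM : {morph tE : F G / F * G}.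
Proof. by move=> F G; rewrite /tE hornerM. Qed.
Lemma sE0 : sE 0 = 0. Proof. by rewrite /sE raddf0 horner0. Qed.
Lemma tE0 : tE 0 = 0. Proof. by rewrite /tE horner0. Qed.
Lemma horner0_mapC m : (m^:P).[0] = (m.[0])%:P :> {poly R}.
Proof. by have /= <- := horner_map polyC m 0; rewrite polyC0. Qed.
Lemma sE_inner m : sE m%:P = (m.[0])%:P.
Proof. by rewrite /sE swapXY_polyC horner0_mapC. Qed.
Lemma sE_outer m : sE m^:P = m.
Proof. by rewrite /sE swapXY_map_polyC hornerC. Qed.
Lemma tE_inner m : tE m%:P = m. Proof. by rewrite /tE hornerC. Qed.
Lemma tE_outer m : tE m^:P = (m.[0])%:P.
Proof. by rewrite /tE horner0_mapC. Qed.

Lemma tdeg0 k : tdeg k 0. Proof. by move=> i j _; rewrite !coef0. Qed.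
Lemma tdegD k F G : tdeg k F -> tdeg k G -> tdeg k (F + G).
Proof. by move=> hF hG i j ij; rewrite !coefD hF// hG// addr0. Qed.
Lemma tdegZ k c F : tdeg k F -> tdeg k (c%:P *: F).
Proof. by move=> hF i j ij; rewrite coefZ coefCM hF// mulr0. Qed.
Lemma tdegM k l F G : tdeg k F -> tdeg l G -> tdeg (k + l) (F * G).
Proof.
move=> hF hG i j ij; rewrite coefM coef_sum big1// => a _.
rewrite coefM big1// => b _.
have := ltn_ord a; have := ltn_ord b; rewrite !ltnS => hb ha.
have [ab|ab] := ltnP k (a + b); first by rewrite hF// mul0r.
by rewrite hG ?mulr0//; lia.
Qed.
Lemma tdegW k l F : (k <= l)%N -> tdeg k F -> tdeg l F.
Proof. by move=> kl hF i j ij; rewrite hF//; lia. Qed.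
Lemma tdeg_sum k I (r : seq I) (P : pred I) (E : I -> bp) :
  (forall i, P i -> tdeg k (E i)) -> tdeg k (\sum_(i <- r | P i) E i).
Proof.
move=> h; apply: (big_ind (tdeg k)) => //; [exact: tdeg0|exact: tdegD].
Qed.
Lemma tdeg_inner k m : (size m <= k.+1)%N -> tdeg k m%:P.
Proof.
move=> sm [|i] j ij; rewrite coefC/= ?coef0//.
by apply: nth_default; rewrite (leq_trans sm).
Qed.
Lemma tdeg_outer k m : (size m <= k.+1)%N -> tdeg k m^:P.
Proof.
move=> sm i [|j] ij; rewrite coef_map/= coefC/= ?coef0//.
by apply: nth_default; rewrite (leq_trans sm)// -(addn0 i).
Qed.
Lemma tdeg_deriv k F : tdeg k F -> tdeg k.-1 F^`().
Proof. by move=> hF i j ij; rewrite coef_deriv coefMn hF ?mul0rn//; lia. Qed.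
Lemma tdeg_swap k F : tdeg k F -> tdeg k (swapXY F).
Proof. by move=> hF i j ij; rewrite coef_swapXY hF// addnC. Qed.
Lemma tdeg_dY k F : tdeg k F -> tdeg k.-1 (dY F).
Proof. by move=> hF; apply/tdeg_swap/tdeg_deriv/tdeg_swap. Qed.
Lemma size_tE k F : tdeg k F -> (size (tE F) <= k.+1)%N.
Proof.
move=> hF; apply/leq_sizeP => j kj; rewrite /tE horner_coef0 hF//.
Qed.
Lemma size_sE k F : tdeg k F -> (size (sE F) <= k.+1)%N.
Proof. by move=> hF; apply: size_tE; exact: tdeg_swap. Qed.

Lemma dY_inner m : dY m%:P = (m^`())%:P.
Proof. by rewrite /dY swapXY_polyC deriv_map swapXY_map_polyC. Qed.
Lemma dY_outer m : dY m^:P = 0.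
Proof. by rewrite /dY swapXY_map_polyC derivC raddf0. Qed.

Lemma deriv_eq0 m : m^`() = 0 -> m = (m.[0])%:P.
Proof.
move=> /(congr1 prim); rewrite prim_deriv; last exact: natunit.
by rewrite linear0 => /subr0_eq.
Qed.
Lemma derivX_eq0 F : F^`() = 0 -> F = (tE F)%:P.
Proof.
move=> /(congr1 prim); rewrite prim_deriv; last exact: polynatunit.
by rewrite linear0 => /subr0_eq.
Qed.
Lemma derivY_eq0 F : dY F = 0 -> F = (sE F)^:P.
Proof.
move=> /(congr1 (@swapXY R)); rewrite swapXYK raddf0 => /derivX_eq0 h.
by rewrite -[LHS]swapXYK h swapXY_polyC.
Qed.

(* Every [p] extends to an admissible field, as the constraints prescribe [q] and
   [r] on the spokes only. *)
Definition ptest (p : 'I_3 -> bp) : sfield :=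
  SField p (fun i => (sE (p (i + 1)) + tE (p i))%:P)
           (fun i => (sE (p i) + tE (p (i - 1)))^:P).

Lemma ptest_admissible k p : (forall i, tdeg k (p i)) ->
  admissible k (ptest p).
Proof.
move=> hp; split=> i /=.
- split=> //; [apply: tdeg_inner | apply: tdeg_outer];
    rewrite (leq_trans (size_polyD _ _))// geq_max;
    by rewrite (size_sE (hp _)) (size_tE (hp _)).
- by rewrite sE_outer tE_inner subrK.
- by rewrite sE_outer.
Qed.

Definition single (i0 : 'I_3) F (i : 'I_3) : bp := if i == i0 then F else 0.

Lemma tdeg_single k i0 F : tdeg k F -> forall i, tdeg k (single i0 F i).
Proof. by move=> hF i; rewrite /single; case: ifP => _ //; exact: tdeg0. Qed.

Lemma reindexD1 (h : 'I_3 -> R) : \sum_i h (i + 1) = \sum_i h i.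
Proof. by rewrite [RHS](reindex_inj (addIr (1 : 'I_3))). Qed.

(** Without diagonal strains the extensions [q] and [r] act only through their spoke traces, which
    the constraints express by [p]. Shifting the index collects all terms containing a given
    component of [p]. *)
Lemma bhat_ptest u1 u2 i F :
  (forall j, (u1 j)^`() = 0) -> (forall j, dY (u2 j) = 0) ->
  bhat u1 u2 (ptest (single i F)) =
  tri (F * (dY (u1 i) + (u2 i)^`()))
  + int01 (sE F * (sE (u1 i) + sE (u2 i) + tE (u1 (i - 1))))
  + int01 (tE F * (tE (u2 i) + sE (u2 (i + 1)) + tE (u1 i))).
Proof.
move=> h1 h2; rewrite /bhat /=.
pose p := single i F; rewrite -/p.
transitivity (\sum_j (tri (p j * (dY (u1 j) + (u2 j)^`()))
  + int01 (sE (p j) * (sE (u1 j) + sE (u2 j) + tE (u1 (j - 1))))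
  + int01 (tE (p j) * (tE (u2 j) + sE (u2 (j + 1)) + tE (u1 j))))).
  rewrite !big_split /=.
  have -> : \sum_j int01 (tE (p j) * (tE (u2 j) + sE (u2 (j + 1)) + tE (u1 j))) =
    \sum_j int01 (tE (p j) * (tE (u2 j) + tE (u1 j))) +
    \sum_j int01 (tE (p (j - 1)) * sE (u2 j)).
    rewrite -[X in _ = _ + X]reindexD1 -big_split /=; apply: eq_bigr => j _.
    by rewrite addrK -int01D; congr int01; ring.
  have -> : \sum_j int01 (sE (p j) * (sE (u1 j) + sE (u2 j) + tE (u1 (j - 1)))) =
    \sum_j int01 (sE (p j) * (sE (u1 j) + sE (u2 j))) +
    \sum_j int01 (sE (p (j + 1)) * tE (u1 j)).
    rewrite -[X in _ = X + _]reindexD1 -[X in X = _]reindexD1 -big_split /=.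
    by apply: eq_bigr => j _; rewrite addrK -int01D; congr int01; ring.
  have -> : forall a b c d e : R, a + (b + c) + (d + e) = a + (b + e) + (d + c).
    by move=> *; ring.
  rewrite -!big_split /=; apply: eq_bigr => j _.
  rewrite h1 h2 !mulr0 !addr0 sE_outer tE_inner -!addrA.
  by congr (_ + _); rewrite -!int01D; congr int01; ring.
rewrite (bigD1 i)//= big1 ?addr0; first by rewrite /p /single eqxx.
by move=> j /negPf ji; rewrite /p /single ji !mul0r sE0 tE0 !mul0r tri0 int010 !addr0.
Qed.
End reference_form.

(** * Fields annihilated by all admissible stresses *)

Section kernel.
Context {R : realType}.
Notation bp := {poly {poly R}}.
Implicit Types (F G : bp) (m n : {poly R}).

Lemma prim1 : prim 1 = 'X :> {poly R}.
Proof.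
by rewrite -derivX prim_deriv ?hornerX ?subr0//; exact: natunit.
Qed.

Lemma tri_outer m : tri m^:P = int01 (m * (1 - 'X)).
Proof. by rewrite -[m^:P]mul1r -polyC1 tri_mulC prim1 comp_polyX. Qed.

Lemma tri_inner m : tri m%:P = int01 (m * (1 - 'X)).
Proof.
by rewrite -[m%:P]mulr1 -(rmorph1 (map_poly polyC)) tri_mul prim1 comp_polyX.
Qed.

Context (k : nat) (u1 u2 : 'I_3 -> bp).
Hypothesis k1 : (1 <= k)%N.
Hypothesis hu1 : forall i, tdeg k (u1 i).
Hypothesis hu2 : forall i, tdeg k (u2 i).
Hypothesis hker : forall tau, admissible k tau -> bhat u1 u2 tau = 0.

(** The test [q = s D] alone is admissible, as it vanishes on [s = 0], the only side where [q] is
    constrained; its degree is at most [k] because [D] has lost one degree. It leaves the integral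
    of [s D^2]. *)
Lemma kernel_strain1 i : (u1 i)^`() = 0.
Proof.
set D := (u1 i)^`(); pose q := single i ('X * D).
have tq j : tE (q j) = 0.
  by rewrite /q /single; case: ifP => _; rewrite ?tE0// tEM {1}/tE hornerX mul0r.
have adm : admissible k (SField (fun=> 0) q (fun=> 0)).
  split => j /=; rewrite ?tq ?sE0 ?tE0 ?addr0//; split; try exact: tdeg0.
  apply: tdeg_single; rewrite -(subnKC k1); apply: tdegM; last first.
    by rewrite subn1; exact: tdeg_deriv.
  by rewrite -(map_polyX polyC); apply: tdeg_outer; rewrite size_polyX.
have := hker adm; rewrite /bhat /= (bigD1 i)//= big1 => [|j /negPf ji]; last first.
  rewrite !mul0r tq sE0 tE0 /q /single ji !mul0r !addr0 tri0 int010 !add0r.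
  by rewrite ?addr0.
rewrite !mul0r tq sE0 tE0 /q /single eqxx !mul0r !addr0 int010 !add0r ?addr0.
rewrite -/D -mulrA -expr2 => /tri_eq0 h.
have : 'X * D ^+ 2 = 0.
  apply: h => s t s0 t0 _; rewrite !hornerM hornerX hornerC mulr_ge0//.
  by rewrite -expr2 sqr_ge0.
by move/eqP; rewrite mulf_eq0 polyX_eq0/= sqrf_eq0 => /eqP.
Qed.

Lemma kernel_strain2 i : dY (u2 i) = 0.
Proof.
set D := dY (u2 i); pose r := single i ('X%:P * D).
have tr j : sE (r j) = 0.
  rewrite /r /single; case: ifP => _; rewrite ?sE0// sEM sE_inner hornerX.
  by rewrite polyC0 mul0r.
have adm : admissible k (SField (fun=> 0) (fun=> 0) r).
  split => j /=; rewrite ?tr ?sE0 ?tE0 ?addr0//; split; try exact: tdeg0.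
  apply: tdeg_single; rewrite -(subnKC k1); apply: tdegM; last first.
    by rewrite subn1; exact: tdeg_dY.
  by apply: tdeg_inner; rewrite size_polyX.
have := hker adm; rewrite /bhat /= (bigD1 i)//= big1 => [|j /negPf ji]; last first.
  rewrite !mul0r tr sE0 tE0 /r /single ji !mul0r !addr0 tri0 int010 !add0r.
  by rewrite ?addr0.
rewrite !mul0r tr sE0 tE0 /r /single eqxx !mul0r !addr0 int010 !add0r ?addr0.
rewrite -/D -mulrA -expr2 => /tri_eq0 h.
have : 'X%:P * D ^+ 2 = 0.
  apply: h => s t s0 t0 _; rewrite !hornerM !hornerC hornerX mulr_ge0//.
  by rewrite -expr2 sqr_ge0.
by move/eqP; rewrite mulf_eq0 polyC_eq0 polyX_eq0/= sqrf_eq0 => /eqP.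
Qed.

Let f i := tE (u1 i).
Let g i := sE (u2 i).

Let u1E i : u1 i = (f i)%:P.
Proof. exact/derivX_eq0/kernel_strain1. Qed.
Let u2E i : u2 i = (g i)^:P.
Proof. exact/derivY_eq0/kernel_strain2. Qed.

Let sf i : (size (f i) <= k.+1)%N. Proof. exact: size_tE. Qed.
Let sg i : (size (g i) <= k.+1)%N. Proof. exact: size_sE. Qed.

Let keyeq i F : tdeg k F ->
  tri (F * ((f i)^`()%:P + (g i)^`()^:P))
  + int01 (sE F * (((f i).[0])%:P + g i + f (i - 1)))
  + int01 (tE F * (((g i).[0])%:P + g (i + 1) + f i)) = 0.
Proof.
move=> hF; have := hker (ptest_admissible (tdeg_single i hF)).
rewrite bhat_ptest; [|exact: kernel_strain1|exact: kernel_strain2].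
rewrite !u1E !u2E dY_inner deriv_map sE_inner tE_outer !sE_outer !tE_inner.
by [].
Qed.

(** The test [p = s m(s)] vanishes on the side [s = 0], so a single spoke contributes. Integrating
    [f'] over [t] gives [f(1 - s) - f(0)], whose constant cancels the one in the spoke term; [Psi]
    is the mirror image. *)
Let Phi i m : (size m <= k)%N ->
  int01 ('X * m * ((1 - 'X) * (g i)^`() + (f i \Po (1 - 'X)) + g i + f (i - 1))) = 0.
Proof.
move=> sm; have := @keyeq i ('X * m)^:P.
rewrite sE_outer tE_outer hornerM hornerX mul0r polyC0 mul0r int010 addr0.
have sXm : (size ('X * m)%R <= k.+1)%N.
  by rewrite (leq_trans (size_polyMleq _ _))// size_polyX.
move/(_ (tdeg_outer sXm)) => E; rewrite -[RHS]E.
rewrite [X in tri X]mulrDr triD [X in tri X + _]mulrC tri_mulC prim_deriv; last exact: natunit.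
rewrite -rmorphM /= tri_outer -!int01D; congr int01.
by rewrite comp_polyB comp_polyC; ring.
Qed.

Let Psi i m : (size m <= k)%N ->
  int01 ('X * m * ((1 - 'X) * (f i)^`() + (g i \Po (1 - 'X)) + g (i + 1) + f i)) = 0.
Proof.
move=> sm; have := @keyeq i ('X * m)%:P.
rewrite sE_inner tE_inner hornerM hornerX mul0r polyC0 mul0r int010 addr0.
have sXm : (size ('X * m)%R <= k.+1)%N.
  by rewrite (leq_trans (size_polyMleq _ _))// size_polyX.
move/(_ (tdeg_inner sXm)) => E; rewrite -[RHS]E.
rewrite [X in tri X]mulrDr triD tri_mul prim_deriv; last exact: natunit.
rewrite -polyCM tri_inner -!int01D; congr int01.
by rewrite comp_polyB comp_polyC; ring.
Qed.

Let int01_ibp m : int01 ((1 - 'X) * m^`()) = int01 m - m.[0].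
Proof.
have -> : (1 - 'X) * m^`() = ((1 - 'X) * m)^`() + m.
  by rewrite derivM derivB derivX -polyC1 derivC; ring.
by rewrite int01D int01_deriv !hornerM !hornerE subrr mul0r subr0; ring.
Qed.

(** The constant test [p = 1] supplies the equation missed by the tests that vanish on a side. *)
Let Eeq i : 2 * int01 (f i) + 2 * int01 (g i) + int01 (f (i - 1))
  + int01 (g (i + 1)) = 0.
Proof.
have h1 := @tdeg_inner R k 1.
rewrite size_poly1 in h1; move: (h1 isT) => {}h1.
rewrite -[RHS](keyeq i h1) sE_inner tE_inner hornerC.
rewrite !mul1r triD tri_inner tri_outer ![_ * (1 - _)]mulrC !int01_ibp.
by rewrite !int01D !int01C; ring.
Qed.

Let orth i F : tdeg k ('X * 'X%:P * F) ->
  tri ('X * 'X%:P * F * ((f i)^`()%:P + (g i)^`()^:P)) = 0.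
Proof.
move=> hF; have := keyeq i hF.
have -> : sE ('X * 'X%:P * F) = 0.
  by rewrite !sEM sE_inner hornerX polyC0 mulr0 mul0r.
have -> : tE ('X * 'X%:P * F) = 0.
  by rewrite !tEM {1}/tE hornerX !mul0r.
by rewrite !mul0r int010 !addr0.
Qed.
Section high_degree.
Context (Q : {poly R}).
Hypothesis mQ : Q \is monic.
Hypothesis sQ : size Q = k.+1.
Hypothesis oQ : forall m, (size m <= k)%N -> int01 ('X * Q * m) = 0.

(** Of degree exactly [k - 1], it supplements the polynomials of degree at most [k - 2]; the
    reflection turns the weights produced by [tri] into that of [orthogonal_poly_deriv]. *)
Let J := Q^`() \Po (1 - 'X).

Let size_onemX : size (1 - 'X : {poly R}) = 2%N.
Proof. by rewrite -opprB size_polyN -polyC1 size_XsubC. Qed.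

Let size_dQ : size Q^`() = k.
Proof.
have lQ : (Q^`())`_k.-1 != 0.
  rewrite coef_deriv prednK//; move/monicP: mQ; rewrite lead_coefE sQ /= => ->.
  by rewrite pnatr_eq0 -lt0n.
apply/eqP; rewrite eqn_leq; apply/andP; split.
  by rewrite -ltnS -sQ lt_size_deriv// monic_neq0.
rewrite leqNgt; apply: contra lQ => sk.
by apply/eqP/nth_default; rewrite -ltnS prednK.
Qed.

Let size_J : size J = k.
Proof. by rewrite /J size_comp_poly2. Qed.

Let J_decomp m : (size m <= k)%N ->
  exists a n, m = a *: J + n /\ (size n < k)%N.
Proof.
move=> sm; have J0 : J`_k.-1 != 0.
  by rewrite -{1}size_J -lead_coefE lead_coef_eq0 -size_poly_eq0 size_J -lt0n.
exists (m`_k.-1 / J`_k.-1), (m - (m`_k.-1 / J`_k.-1) *: J); split.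
  by rewrite addrC subrK.
rewrite -(prednK k1) ltnS; apply/leq_sizeP => j kj.
rewrite coefB coefZ; move: kj; rewrite leq_eqVlt => /predU1P[<-|kj].
  by rewrite divfK// subrr.
have kj' : (k <= j)%N by move: kj; rewrite -ltnS prednK.
have -> : m`_j = 0 by apply: nth_default; exact: leq_trans kj'.
have -> : J`_j = 0 by apply: nth_default; rewrite size_J.
by rewrite mulr0 subr0.
Qed.

(** Integrating out [t] turns the weight [s t] into [s (1 - s)^2 / 2], which the reflection sends to
    [(1 - x) x^2 / 2]. *)
Let orth_outer_outer m : (size m < k)%N ->
  tri ('X * 'X%:P * (J^:P * m^:P)) = 0.
Proof.
move=> sm.
have primX : prim 'X = 2^-1 *: 'X^2 :> {poly R}.
  have XE : 'X = (2^-1 *: 'X^2)^`() :> {poly R}.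
    rewrite derivZ derivXn /= expr1 -scalerMnr scalerMnl -[X in X *: _]mulr_natr.
    by rewrite mulVf ?pnatr_eq0// scale1r.
  rewrite [X in prim X]XE prim_deriv; last exact: natunit.
  by rewrite hornerZ hornerXn expr0n mulr0 polyC0 subr0.
have -> : 'X * 'X%:P * (J^:P * m^:P) = 'X%:P * ('X * J * m)^:P.
  by rewrite !rmorphM /= map_polyX; ring.
rewrite tri_mulC primX -int01_rev.
have -> : ('X * J * m * (2^-1 *: 'X^2 \Po (1 - 'X))) \Po (1 - 'X) =
   (2^-1)%:P * ((1 - 'X) * 'X^2 * (m \Po (1 - 'X)) * Q^`()).
  have rr (p : {poly R}) : (p \Po (1 - 'X)) \Po (1 - 'X) = p.
    by rewrite -comp_polyA comp_polyB comp_polyX -polyC1 comp_polyC subKr comp_polyXr.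
  by rewrite !comp_polyM /J !rr comp_polyX -mul_polyC; ring.
rewrite int01CM (orthogonal_poly_deriv oQ) ?mulr0//.
by rewrite size_comp_poly2.
Qed.

(** The primitive of ['X * m] is ['X^2 * N] with [N] no longer than [m], so that the weight
    [(1 - x) x^2] appears again after reflection. *)
Let orth_outer_inner m : (size m < k)%N ->
  tri ('X * 'X%:P * (J^:P * m%:P)) = 0.
Proof.
move=> sm.
have -> : 'X * 'X%:P * (J^:P * m%:P) = ('X * m)%:P * ('X * J)^:P.
  by rewrite !rmorphM /= map_polyX; ring.
pose N := \poly_(i < size m) (m`_i / i.+2%:R).
have pN : prim ('X * m) = 'X^2 * N.
  apply/polyP => i; rewrite coef_prim coefXM coefXnM coef_poly.
  case: i => [|[|i]] /=; rewrite ?mul0r// !subSS subn0.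
  by case: ltnP => // /(nth_default 0) ->; rewrite mul0r.
rewrite tri_mulC pN -int01_rev.
have -> : ('X * J * ('X^2 * N \Po (1 - 'X))) \Po (1 - 'X) =
   (1 - 'X) * 'X^2 * N * Q^`().
  have rr (p : {poly R}) : (p \Po (1 - 'X)) \Po (1 - 'X) = p.
    by rewrite -comp_polyA comp_polyB comp_polyX -polyC1 comp_polyC subKr comp_polyXr.
  by rewrite !comp_polyM /J !rr comp_polyX; ring.
by rewrite (orthogonal_poly_deriv oQ)// (leq_ltn_trans (size_poly _ _)).
Qed.

Let orth_inner_outer m : (size m < k)%N ->
  tri ('X * 'X%:P * (J%:P * m^:P)) = 0.
Proof.
move=> sm; rewrite -tri_swap !swapXYM swapXY_X !swapXY_polyC swapXY_map_polyC map_polyX.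
by rewrite ['X%:P * _]mulrC orth_outer_inner.
Qed.

Let orth_inner_inner m : (size m < k)%N ->
  tri ('X * 'X%:P * (J%:P * m%:P)) = 0.
Proof.
move=> sm; rewrite -tri_swap !swapXYM swapXY_X !swapXY_polyC map_polyX.
by rewrite ['X%:P * _]mulrC orth_outer_outer.
Qed.

(** Split [g' = a J + n1] and [f' = b J + n2] with remainders of degree at most [k - 2]. The test
    with [w = n1(s) + n2(t)] is then admissible, the [J] parts drop out by orthogonality, and
    [w = 0] forces [n1] and [- n2] to be the same constant [ga]. *)
Let decomp i : (2 <= k)%N -> exists a b ga al be,
  f i = - (b *: (Q \Po (1 - 'X))) - ga *: 'X + al%:P /\
  g i = - (a *: (Q \Po (1 - 'X))) + ga *: 'X + be%:P.
Proof.
move=> k2; have sd m : (size m <= k.+1)%N -> (size m^`() <= k)%N.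
  have [->|m0] := eqVneq m 0; first by rewrite deriv0 size_poly0.
  by move=> sm; rewrite -ltnS (leq_trans (lt_size_deriv m0)).
have [a [n1 [gE sn1]]] := J_decomp (sd _ (sg i)).
have [b [n2 [fE sn2]]] := J_decomp (sd _ (sf i)).
pose w : bp := n1^:P + n2%:P.
have tw : tdeg k ('X * 'X%:P * w).
  have -> : k = ((1 + 1) + (k - 2))%N by lia.
  apply: tdegM.
    apply: tdegM; last by apply: tdeg_inner; rewrite size_polyX.
    by rewrite -(map_polyX polyC); apply: tdeg_outer; rewrite size_polyX.
  by apply: tdegD; [apply: tdeg_outer | apply: tdeg_inner]; move: sn1 sn2 k2; lia.
have ww0 : tri ('X * 'X%:P * w ^+ 2) = 0.
  have -> : 'X * 'X%:P * w ^+ 2 =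
     'X * 'X%:P * w * ((f i)^`()%:P + (g i)^`()^:P)
     - (a%:P *: ('X * 'X%:P * (J^:P * n1^:P)) + a%:P *: ('X * 'X%:P * (J^:P * n2%:P)))
     - (b%:P *: ('X * 'X%:P * (J%:P * n1^:P)) + b%:P *: ('X * 'X%:P * (J%:P * n2%:P))).
    rewrite fE gE -!mul_polyC !(rmorphD, rmorphM) /= map_polyC /= /w; ring.
  rewrite !triB !triD !triZ orth// orth_outer_outer// orth_outer_inner//.
  by rewrite orth_inner_outer// orth_inner_inner// !mulr0 !addr0 !subr0.
have w0 : w = 0.
  have /eqP : 'X * 'X%:P * w ^+ 2 = 0.
    apply: tri_eq0 ww0 => s t s0 t0 _.
    have -> : ('X * 'X%:P * w ^+ 2).[s, t] = s * t * (w.[s, t]) ^+ 2.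
      by rewrite !hornerM !hornerX !hornerC !hornerX; ring.
    by rewrite mulr_ge0 ?sqr_ge0// mulr_ge0.
  by rewrite !mulf_eq0 polyX_eq0 polyC_eq0 polyX_eq0 /= orbb => /eqP.
have n12 s t : n1.[s] + n2.[t] = 0.
  have := congr1 (fun F : bp => F.[s, t]) w0.
  rewrite /w !hornerD !hornerC => <-; congr (_ + _).
  by have /= -> := horner_map polyC n1 s; rewrite hornerC.
pose ga := n1.[0].
have n1E : n1 = ga%:P.
  apply: poly_ext => s; rewrite hornerC.
  by have := n12 s 0; have := n12 0 0; rewrite /ga; lra.
have n2E : n2 = - ga%:P.
  apply: poly_ext => s; rewrite hornerN hornerC.
  by have := n12 0 s; rewrite /ga; lra.
have dQ : (Q \Po (1 - 'X))^`() = - J.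
  by rewrite deriv_comp derivB derivX -polyC1 derivC sub0r mulrN1.
exists a, b, ga, (f i + b *: (Q \Po (1 - 'X)) + ga *: 'X).[0],
  (g i + a *: (Q \Po (1 - 'X)) - ga *: 'X).[0]; split.
  rewrite -[X in _ + X]deriv_eq0; first by ring.
  rewrite !derivD !derivZ dQ derivX fE n2E scalerN alg_polyC; ring.
rewrite -[X in _ + X]deriv_eq0; first by ring.
rewrite !derivD derivN !derivZ dQ derivX gE n1E scalerN alg_polyC; ring.
Qed.

(** For [k = 1] the bubble [s t] exceeds the degree. Both functions are affine and so is the
    reflection of [Q], hence no multiple of it is needed in [f]. *)
Let decomp1 i : k = 1%N -> exists a ga al be,
  f i = - ga *: 'X + al%:P /\
  g i = - (a *: (Q \Po (1 - 'X))) + ga *: 'X + be%:P.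
Proof.
move=> k_eq1; have [c Qe] : exists c, Q = 'X + c%:P.
  exists Q`_0; apply/polyP => j; rewrite coefD coefX coefC; case: j => [|[|j]] /=; rewrite ?add0r ?addr0//.
    by move/monicP: mQ; rewrite lead_coefE sQ k_eq1.
  by rewrite nth_default// sQ k_eq1.
have lin m : (size m <= 2)%N -> m = m`_1 *: 'X + (m`_0)%:P.
  move=> sm; apply/polyP => j; rewrite coefD coefZ coefX coefC.
  case: j => [|[|j]] /=; rewrite ?mulr0 ?mulr1 ?add0r ?addr0//.
  by rewrite nth_default// (leq_trans sm).
have sf2 : (size (f i) <= 2)%N by rewrite (leq_trans (sf i)) ?k_eq1.
have sg2 : (size (g i) <= 2)%N by rewrite (leq_trans (sg i)) ?k_eq1.
exists ((f i)`_1 + (g i)`_1), (- (f i)`_1), (f i)`_0,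
  ((g i)`_0 + ((f i)`_1 + (g i)`_1) * (1 + c)); split.
  by rewrite opprK -lin.
rewrite [LHS]lin// Qe comp_polyD comp_polyX comp_polyC -!mul_polyC.
by rewrite !(polyCD, polyCM, polyCN) polyC1; ring.
Qed.

Let q := int01 Q.
Let RQ := Q \Po (1 - 'X).

Let dRQ : RQ^`() = - J.
Proof. by rewrite /RQ deriv_comp derivB derivX -polyC1 derivC sub0r mulrN1. Qed.

Let rev_RQ : RQ \Po (1 - 'X) = Q.
Proof.
by rewrite /RQ -comp_polyA comp_polyB comp_polyX -polyC1 comp_polyC subKr comp_polyXr.
Qed.

Let int_XQ : int01 ('X * Q) = 0.
Proof. by rewrite -[_ * Q]mulr1 oQ// size_poly1. Qed.

Let int_XRQ : int01 ('X * RQ) = q.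
Proof.
rewrite -int01_rev comp_polyM rev_RQ comp_polyX mulrBl mul1r int01B int_XQ.
by rewrite subr0.
Qed.

Let int_XJ : int01 ('X * ((1 - 'X) * J)) = - q.
Proof.
have -> : 'X * ((1 - 'X) * J) = - ('X * (1 - 'X) * RQ)^`() + RQ - 2%:P * ('X * RQ).
  rewrite !derivM derivB derivX -polyC1 derivC dRQ polyC_natr; ring.
rewrite int01B int01D int01N int01_deriv int01CM int_XRQ /RQ int01_rev -/q.
have e1 : (1 - 'X : {poly R}).[1] = 0 by rewrite !hornerE subrr.
by rewrite !hornerM !hornerX e1; ring.
Qed.

Let int_XX : int01 ('X * 'X : {poly R}) = 3^-1.
Proof. by rewrite -expr2 int01Xn. Qed.

Let int_RQ : int01 RQ = q. Proof. exact: int01_rev. Qed.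

(** Moment of the residuals of [Phi] and [Psi] for [m = 1]. In [val2], with [m = 1 - 'X], the
    contributions of [J], [Q] and its reflection vanish by orthogonality and only the affine part
    survives. *)
Let val1 a b c d e :
  int01 ('X * 1 * (a%:P * ((1 - 'X) * J - RQ) - b%:P * Q - c%:P * RQ + d%:P * 'X + e%:P))
  = - (2 * a * q) - c * q + d / 3 + e / 2.
Proof.
have -> : 'X * 1 * (a%:P * ((1 - 'X) * J - RQ) - b%:P * Q - c%:P * RQ + d%:P * 'X + e%:P)
  = a%:P * ('X * ((1 - 'X) * J)) - a%:P * ('X * RQ) - b%:P * ('X * Q)
    - c%:P * ('X * RQ) + d%:P * ('X * 'X) + e%:P * 'X by ring.
rewrite !(int01D, int01N) !int01CM int_XJ int_XRQ int_XQ int_XX int01X; ring.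
Qed.

Let val2 a b c d e : (2 <= k)%N ->
  int01 ('X * (1 - 'X) *
   (a%:P * ((1 - 'X) * J - RQ) - b%:P * Q - c%:P * RQ + d%:P * 'X + e%:P))
  = d / 12 + e / 6.
Proof.
move=> k2.
have -> : 'X * (1 - 'X) * (a%:P * ((1 - 'X) * J - RQ) - b%:P * Q - c%:P * RQ + d%:P * 'X + e%:P)
  = a%:P * ('X * (1 - 'X) ^+ 2 * J) - (a + c)%:P * ('X * (1 - 'X) * RQ)
    - b%:P * ('X * Q * (1 - 'X))
    + d%:P * ('X^2 - 'X^3) + e%:P * ('X - 'X^2) by rewrite polyCD; ring.
have s1X : (size (1 - 'X : {poly R})%R <= k)%N by rewrite size_onemX.
have h1 : int01 ('X * (1 - 'X) ^+ 2 * J) = 0.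
  rewrite -int01_rev -(@orthogonal_poly_deriv _ k Q 1 oQ); last by rewrite size_poly1.
  congr int01; rewrite /J !comp_polyM comp_polyX -comp_polyA.
  by rewrite !comp_polyB !comp_polyX -polyC1 !comp_polyC !subKr comp_polyXr polyC1; ring.
have h2 : int01 ('X * (1 - 'X) * RQ) = 0.
  rewrite -int01_rev -(oQ s1X); congr int01; rewrite !comp_polyM rev_RQ.
  by rewrite comp_polyB comp_polyX -polyC1 !comp_polyC subKr polyC1; ring.
rewrite !(int01D, int01N) !int01CM h1 h2 (oQ s1X) !(int01B, int01D, int01N).
rewrite !int01Xn int01X; lra.
Qed.

Lemma kernel_rigid_aux i :
  [/\ dY (u1 i) + (u2 i)^`() = 0, sE (u1 (i + 1)) = tE (u2 i) &
      sE (u2 (i + 1)) + tE (u2 i) + tE (u1 i) = 0].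
Proof.
have [i11 i21 i1m i2m] : [/\ i + 1 + 1 = i - 1, i - 1 + 1 = i, i + 1 - 1 = i &
    i - 1 - 1 = i + 1].
  by split; apply: val_inj; case: i => [[|[|[|//]]] //= ?].
pose A i a b ga al be := f i = - (b *: RQ) - ga *: 'X + al%:P /\
  g i = - (a *: RQ) + ga *: 'X + be%:P.
have [a [b [ga [al [be [fE gE kb]]]]]] : exists (a b ga al be : 'I_3 -> R),
    [/\ forall j, f j = - (b j *: RQ) - ga j *: 'X + (al j)%:P,
        forall j, g j = - (a j *: RQ) + ga j *: 'X + (be j)%:P &
        k = 1%N -> forall j, b j = 0].
  have [k_eq1|k_ne1] := eqVneq k 1%N.
    have := fun j => @decomp1 j k_eq1.
    move=> /choice[a] /choice[ga] /choice[al] /choice[be] h.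
    exists a, (fun=> 0), ga, al, be; split => // j; last by have [] := h j.
    by rewrite scale0r oppr0 sub0r; have [-> _] := h j; rewrite scaleNr.
  have k2 : (2 <= k)%N by rewrite ltn_neqAle eq_sym k_ne1.
  have := fun j => @decomp j k2.
  move=> /choice[a] /choice[b] /choice[ga] /choice[al] /choice[be] h.
  by exists a, b, ga, al, be; split => [j|j|/eqP]; [have [] := h j|have [] := h j|rewrite (negPf k_ne1)].
have df j : (f j)^`() = (b j)%:P * J - (ga j)%:P.
  rewrite fE !derivD !derivN !derivZ dRQ derivX derivC -!mul_polyC; ring.
have dg j : (g j)^`() = (a j)%:P * J + (ga j)%:P.
  rewrite gE !derivD !derivN !derivZ dRQ derivX derivC -!mul_polyC; ring.
have rf j : f j \Po (1 - 'X) = - (b j)%:P * Q - (ga j)%:P * (1 - 'X) + (al j)%:P.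
  by rewrite fE !comp_polyD !raddfN /= !comp_polyZ rev_RQ comp_polyX comp_polyC -!mul_polyC; ring.
have rg j : g j \Po (1 - 'X) = - (a j)%:P * Q + (ga j)%:P * (1 - 'X) + (be j)%:P.
  by rewrite gE !comp_polyD !raddfN /= !comp_polyZ rev_RQ comp_polyX comp_polyC -!mul_polyC; ring.
have PhiE j : (1 - 'X) * (g j)^`() + (f j \Po (1 - 'X)) + g j + f (j - 1) =
    (a j)%:P * ((1 - 'X) * J - RQ) - (b j)%:P * Q - (b (j - 1))%:P * RQ
    + (ga j - ga (j - 1))%:P * 'X + (al j + be j + al (j - 1))%:P.
  by rewrite dg rf gE fE -!mul_polyC !polyCD !polyCN; ring.
have PsiE j : (1 - 'X) * (f j)^`() + (g j \Po (1 - 'X)) + g (j + 1) + f j =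
    (b j)%:P * ((1 - 'X) * J - RQ) - (a j)%:P * Q - (a (j + 1))%:P * RQ
    + (ga (j + 1) - ga j)%:P * 'X + (al j + be j + be (j + 1))%:P.
  by rewrite df rg gE fE -!mul_polyC !polyCD !polyCN; ring.
have Phi1 j : - (2 * a j * q) - b (j - 1) * q + (ga j - ga (j - 1)) / 3
    + (al j + be j + al (j - 1)) / 2 = 0.
  by rewrite -(val1 _ (b j)) -PhiE Phi// size_poly1.
have Psi1 j : - (2 * b j * q) - a (j + 1) * q + (ga (j + 1) - ga j) / 3
    + (al j + be j + be (j + 1)) / 2 = 0.
  by rewrite -(val1 _ (a j)) -PsiE Psi// size_poly1.
have If j : int01 (f j) = - (b j * q) - ga j / 2 + al j.
  by rewrite fE int01D int01B int01N !int01Z int_RQ int01X int01C; ring.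
have Ig j : int01 (g j) = - (a j * q) + ga j / 2 + be j.
  by rewrite gE !int01D int01N !int01Z int_RQ int01X int01C; ring.
have E1 j := Eeq j.
(* A homogeneous linear system for the products [a q], [b q] and the scalars [ga], [al], [be] of the
   three sub-triangles: per index the moments [Phi1], [Psi1] and the equation [E1], and for [k >= 2]
   also [Phi2] and [Psi2]. *)
have [[aq bq aq' bq'] [h1 h2 h3]] :
    [/\ a i * q = 0, b i * q = 0, a (i + 1) * q = 0 & b (i + 1) * q = 0] /\
    [/\ al (i + 1) = be i, ga (i + 1) = ga i & be (i + 1) + be i + al i = 0].
  move: (Phi1 i) (Phi1 (i + 1)) (Phi1 (i - 1)) (Psi1 i) (Psi1 (i + 1)) (Psi1 (i - 1)).
  move: (E1 i) (E1 (i + 1)) (E1 (i - 1)).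
  rewrite !If !Ig !(i11, i21, i1m, i2m).
  have [k_eq1|k_ne1] := eqVneq k 1%N.
    rewrite !(kb k_eq1).
    (* For [k = 1], orthogonality to constants gives [Q = X - 2/3], of mean [- 1/6]. *)
    have -> : q = - 6^-1.
      have [c Qe] : exists c, Q = 'X + c%:P.
        exists Q`_0; apply/polyP => j; rewrite coefD coefX coefC.
        case: j => [|[|j]] /=; rewrite ?add0r ?addr0//.
          by move/monicP: mQ; rewrite lead_coefE sQ k_eq1.
        by rewrite nth_default// sQ k_eq1.
      have := int_XQ; rewrite /q Qe mulrDr [_ * c%:P]mulrC !int01D int01CM int_XX int01X int01C.
      lra.
    by move=> *; split; split; lra.
  have k2 : (2 <= k)%N by rewrite ltn_neqAle eq_sym k_ne1.
  have s1X : (size (1 - 'X : {poly R})%R <= k)%N by rewrite size_onemX.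
  have Phi2 j : (ga j - ga (j - 1)) / 12 + (al j + be j + al (j - 1)) / 6 = 0.
    by rewrite -(val2 (a j) (b j) (b (j - 1)) _ _ k2) -PhiE Phi.
  have Psi2 j : (ga (j + 1) - ga j) / 12 + (al j + be j + be (j + 1)) / 6 = 0.
    by rewrite -(val2 (b j) (a j) (a (j + 1)) _ _ k2) -PsiE Psi.
  move: (Phi2 i) (Phi2 (i + 1)) (Phi2 (i - 1)) (Psi2 i) (Psi2 (i + 1)) (Psi2 (i - 1)).
  rewrite !(i11, i21, i1m, i2m) => *; split; split; lra.
have q0 : q != 0 by exact: orthogonal_poly_int oQ.
have z c : c * q = 0 -> c = 0.
  by move/eqP; rewrite mulf_eq0 (negPf q0) orbF => /eqP.
split; rewrite !u1E !u2E ?dY_inner ?deriv_map ?sE_inner ?sE_outer ?tE_inner ?tE_outer.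
- rewrite df dg (z _ aq) (z _ bq) !mul0r sub0r add0r map_polyC /= !polyCN.
  by rewrite addNr.
- rewrite fE gE (z _ aq) (z _ bq') !scale0r !oppr0 !add0r !hornerD hornerN.
  by rewrite !hornerZ !hornerX !hornerC !mulr0 oppr0 !add0r h1.
- rewrite !gE fE (z _ aq) (z _ bq) (z _ aq') !scale0r !oppr0 !add0r hornerD.
  rewrite hornerZ hornerX hornerC mulr0 add0r h2.
  have -> : be (i + 1) = - be i - al i by lra.
  by rewrite polyCB polyCN; ring.
Qed.
End high_degree.

Theorem kernel_rigid i :
  [/\ (u1 i)^`() = 0, dY (u2 i) = 0 & dY (u1 i) + (u2 i)^`() = 0] /\
  [/\ sE (u1 (i + 1)) = tE (u2 i) & sE (u2 (i + 1)) + tE (u2 i) + tE (u1 i) = 0].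
Proof.
have [Q [mQ sQ oQ]] := @orthogonal_poly_exists R k.
have [h1 h2 h3] := kernel_rigid_aux mQ sQ oQ i.
by split; split => //; [exact: kernel_strain1|exact: kernel_strain2].
Qed.
End kernel.

(** * Finite dimensional duality *)

Section annihilator.
Context {R : realType}.

(* A functional that vanishes wherever a subspace of functionals on a finite
   dimensional space vanishes belongs to that subspace. *)
Lemma subspace_annihilator (X : finType) (Y : Type) (Adm : Y -> Prop)
    (beta : Y -> X -> R) (ell : X -> R) :
  (exists2 y, Adm y & forall e, beta y e = 0) ->
  (forall c y1 y2, Adm y1 -> Adm y2 ->
     exists2 y, Adm y & forall e, beta y e = c * beta y1 e + beta y2 e) ->
  (forall x : X -> R, (forall y, Adm y -> \sum_e x e * beta y e = 0) ->
     \sum_e x e * ell e = 0) ->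
  exists2 y, Adm y & forall e, beta y e = ell e.
Proof.
move=> [y0 Ay0 by0] lin ann.
pose N := #|X|; pose vec (h : X -> R) : 'rV[R]_N := \row_i h (enum_val i).
have vecE h e : vec h 0 (enum_rank e) = h e by rewrite mxE enum_rankK.
pose inB (w : 'rV[R]_N) := exists2 y, Adm y & vec (beta y) = w.
have inB0 : inB 0.
  by exists y0 => //; apply/rowP => i; rewrite !mxE by0.
have inBlin c w1 w2 : inB w1 -> inB w2 -> inB (c *: w1 + w2).
  move=> [y1 A1 <-] [y2 A2 <-]; have [y Ay yE] := lin c y1 y2 A1 A2.
  by exists y => //; apply/rowP => i; rewrite !mxE yE.
(* [Y] carries no vector space structure, so the set of attained rows is presented as the row space
   of a matrix of maximal rank with rows in that set. *)
pose P r := `[< exists m (M : 'M[R]_(m, N)),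
   (forall i, inB (row i M)) /\ \rank M = r >].
have P0 : exists r, P r.
  by exists 0%N; apply/asboolP; exists 0%N, 0; split; [case | rewrite mxrank0].
have Pb r : P r -> (r <= N)%N.
  by move=> /asboolP[m [M [_ <-]]]; exact: rank_leq_col.
case: (ex_maxnP P0 Pb) => r /asboolP[m [M [MB rM]]] rmax.
have subM w : inB w -> (w <= M)%MS.
  move=> wB; have := mxrank_leqif_sup (addsmxSl M w).
  case=> le eqv; rewrite (submx_trans (addsmxSr M w))// -eqv.
  rewrite eqn_leq le/= rM; apply: rmax; apply/asboolP.
  exists (m + 1)%N, (col_mx M w); split; last by rewrite addsmxE.
  move=> i; case: (split_ordP i) => j ->.
    by rewrite rowKu.
  by rewrite rowKd (ord1 j) row_id.
have comb (z : 'rV[R]_m) : inB (z *m M).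
  rewrite mulmx_sum_row; apply: (big_ind inB) => //.
    by move=> x y hx hy; rewrite -[x]scale1r; exact: inBlin.
  by move=> i _; rewrite -[_ *: _]addr0; exact: inBlin.
have : (vec ell <= M)%MS.
  rewrite submxE; apply/eqP/rowP => j; rewrite [RHS]mxE.
  (* A column of the cokernel is a vector orthogonal to all attained rows, to which the annihilator
     hypothesis applies. *)
  pose x e := cokermx M (enum_rank e) j.
  have xE h : (vec h *m cokermx M) 0 j = \sum_e x e * h e.
    rewrite mxE (reindex enum_rank) /=; last first.
      by apply: onW_bij; exact: enum_rank_bij.
    by apply: eq_bigr => e _; rewrite vecE mulrC.
  rewrite xE; apply: ann => y Ay; rewrite -xE.
  have : (vec (beta y) <= M)%MS by apply: subM; exists y.
  by rewrite submxE => /eqP ->; rewrite mxE.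
move=> /submxP[z zE]; have [y Ay yE] := comb z.
exists y => // e; rewrite -vecE yE -zE; exact: vecE.
Qed.
End annihilator.

(** * Norm equivalences for polynomials *)

Section polynomial_bounds.
Context {R : realType}.
Notation bp := {poly {poly R}}.
Implicit Types (F G : bp) (p q : {poly R}).

(** Lagrange's identity: the gap is half the sum of the squares of the two by two minors. *)
Lemma sum_cauchy_schwarz (X : finType) (c g : X -> R) :
  (\sum_e c e * g e) ^+ 2 <= (\sum_e c e ^+ 2) * (\sum_e g e ^+ 2).
Proof.
have h : 0 <= \sum_e \sum_e' (c e * g e' - c e' * g e) ^+ 2.
  by apply: sumr_ge0 => e _; apply: sumr_ge0 => e' _; exact: sqr_ge0.
suff E : \sum_e \sum_e' (c e * g e' - c e' * g e) ^+ 2 =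
   2 * ((\sum_e c e ^+ 2) * (\sum_e g e ^+ 2)) - 2 * (\sum_e c e * g e) ^+ 2.
  by move: h; rewrite E; lra.
have dist (a b : X -> R) : \sum_e \sum_e' a e * b e' = (\sum_e a e) * (\sum_e b e).
  by rewrite mulr_suml; apply: eq_bigr => e _; rewrite mulr_sumr.
transitivity (\sum_e \sum_e' (c e ^+ 2 * g e' ^+ 2)
   + \sum_e \sum_e' (g e ^+ 2 * c e' ^+ 2)
   - 2 * (\sum_e \sum_e' (c e * g e) * (c e' * g e'))).
  rewrite mulr_sumr -big_split -sumrB /=; apply: eq_bigr => e _.
  rewrite mulr_sumr -big_split -sumrB /=; apply: eq_bigr => e' _; ring.
by rewrite !dist; ring.
Qed.

Lemma tri_sqr_ge0 F : 0 <= tri (F ^+ 2).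
Proof. by apply: tri_ge0 => s t _ _ _; rewrite !horner_exp sqr_ge0. Qed.

Lemma int01_sqr_ge0 p : 0 <= int01 (p ^+ 2).
Proof. by apply: int01_ge0 => s _; rewrite horner_exp sqr_ge0. Qed.

Lemma tri_sqr_eq0 F : tri (F ^+ 2) = 0 -> F = 0.
Proof.
move=> h; apply/eqP; rewrite -sqrf_eq0; apply/eqP; apply: tri_eq0 h => s t _ _ _.
by rewrite !horner_exp sqr_ge0.
Qed.

Lemma tri_le F G : (forall s t, F.[s, t] <= G.[s, t]) -> tri F <= tri G.
Proof.
move=> h; rewrite -subr_ge0 -triB; apply: tri_ge0 => s t _ _ _.
by rewrite !(hornerD, hornerN) subr_ge0.
Qed.

Lemma int01_le p q : (forall s, 0 <= s <= 1 -> p.[s] <= q.[s]) ->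
  int01 p <= int01 q.
Proof.
move=> h; rewrite -subr_ge0 -int01B; apply: int01_ge0 => s s01.
by rewrite !(hornerD, hornerN) subr_ge0 h.
Qed.

Lemma tri_cauchy_schwarz F G : tri (F * G) ^+ 2 <= tri (F ^+ 2) * tri (G ^+ 2).
Proof.
have [G0|G0] := eqVneq (tri (G ^+ 2)) 0.
  by rewrite (tri_sqr_eq0 G0) mulr0 tri0 expr0n /= expr0n tri0 mulr0.
have Gp : 0 < tri (G ^+ 2) by rewrite lt_neqAle eq_sym G0 tri_sqr_ge0.
pose l := tri (F * G) / tri (G ^+ 2).
have := tri_sqr_ge0 (F - l%:P *: G).
have -> : (F - l%:P *: G) ^+ 2 =
   F ^+ 2 - (2 * l)%:P *: (F * G) + (l ^+ 2)%:P *: (G ^+ 2).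
  by rewrite -!mul_polyC !(polyCM, rmorphXn) /= polyC_natr; ring.
rewrite triD triB !triZ => h.
have : 0 <= (tri (F ^+ 2) - 2 * l * tri (F * G) + l ^+ 2 * tri (G ^+ 2)) * tri (G ^+ 2).
  by rewrite mulr_ge0// ltW.
rewrite /l => {}h; rewrite -subr_ge0; apply: le_trans h _.
by rewrite le_eqVlt; apply/orP; left; apply/eqP; field.
Qed.

Lemma horner2_sum (X : finType) (E : X -> bp) s t :
  (\sum_e E e).[s, t] = \sum_e (E e).[s, t].
Proof. by rewrite !horner_sum. Qed.

Lemma tri_sqr_sum (X : finType) (c : X -> R) (G : X -> bp) :
  tri ((\sum_e (c e)%:P *: G e) ^+ 2) <= (\sum_e c e ^+ 2) * tri (\sum_e G e ^+ 2).
Proof.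
rewrite -triZ; apply: tri_le => s t.
rewrite !horner_exp hornerZ hornerM hornerC !horner2_sum.
under eq_bigr do rewrite hornerZ hornerM hornerC.
under [X in _ <= _ * X]eq_bigr do rewrite !horner_exp.
exact: sum_cauchy_schwarz.
Qed.

Lemma int01_sqr_sum (X : finType) (c : X -> R) (p : X -> {poly R}) :
  int01 ((\sum_e c e *: p e) ^+ 2) <= (\sum_e c e ^+ 2) * int01 (\sum_e p e ^+ 2).
Proof.
rewrite -int01Z; apply: int01_le => s _.
rewrite horner_exp hornerZ !horner_sum.
under eq_bigr do rewrite hornerZ.
under [X in _ <= _ * X]eq_bigr do rewrite horner_exp.
exact: sum_cauchy_schwarz.
Qed.

(** Exponents range over a full square to form a product [finType]; those beyond total degree [k]
    contribute zero. *)
Definition mono (k : nat) (e : 'I_k.+1 * 'I_k.+1) : bp :=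
  if (e.1 + e.2 <= k)%N then ('X^(e.1))^:P * ('X^(e.2))%:P else 0.

Lemma tdeg_mono k e : tdeg k (mono (k := k) e).
Proof.
rewrite /mono; case: ifP => [le|_]; last exact: tdeg0.
apply: tdegW le _; apply: tdegM.
  by apply: tdeg_outer; rewrite size_polyXn.
by apply: tdeg_inner; rewrite size_polyXn.
Qed.

Lemma mono_sum k F : tdeg k F ->
  F = \sum_(e : 'I_k.+1 * 'I_k.+1) (F`_e.1`_e.2)%:P *: mono e.
Proof.
move=> hF; apply/polyP => a; apply/polyP => b; rewrite coef_sum coef_sum.
have cm (e : 'I_k.+1 * 'I_k.+1) : ((F`_e.1`_e.2)%:P *: mono e)`_a`_b =
    F`_e.1`_e.2 * ((a == e.1 :> nat) && (b == e.2 :> nat))%:R.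
  rewrite coefZ coefCM /mono; case: leqP => [le|lt]; last by rewrite hF// !mul0r.
  rewrite [_^:P * _]mulrC mul_polyC coefZ coef_map /= coefXn.
  case: (a == e.1 :> nat); last by rewrite polyC0 mulr0 coef0.
  by rewrite polyC1 mulr1 coefXn.
under eq_bigr do rewrite cm.
have [/andP[ak bk]|] := boolP ((a < k.+1) && (b < k.+1))%N.
  rewrite (bigD1 (Ordinal ak, Ordinal bk))//= !eqxx mulr1 big1 ?addr0// => e ne.
  case: eqP => [ea|]; last by rewrite mulr0.
  case: eqP => [eb|]; last by rewrite mulr0.
  have ee : e = (Ordinal ak, Ordinal bk).
    rewrite (surjective_pairing e).
    have -> : e.1 = Ordinal ak by exact/ord_inj/esym.
    have -> : e.2 = Ordinal bk by exact/ord_inj/esym.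
    by [].
  by rewrite ee eqxx in ne.
rewrite negb_and -!leqNgt => h; rewrite big1.
  by apply: hF; case/orP: h; lia.
move=> e _; case: eqP => [ea|]; last by rewrite mulr0.
case: eqP => [eb|]; last by rewrite mulr0.
by case/orP: h; [rewrite ea | rewrite eb]; rewrite leqNgt ltn_ord.
Qed.

(* Each coefficient is represented, by Riesz, as an inner product. *)
Lemma coef_tri_bound k : exists2 C : R, 0 < C & forall F, tdeg k F ->
  forall a b, F`_a`_b ^+ 2 <= C * tri (F ^+ 2).
Proof.
have rep (e0 : 'I_k.+1 * 'I_k.+1) : exists2 G : bp, tdeg k G &
    forall e : 'I_k.+1 * 'I_k.+1, tri (mono e * G) = (mono e)`_e0.1`_e0.2.
  apply: (@subspace_annihilator R _ bp (tdeg k) (fun G e => tri (mono e * G))).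
  - by exists 0; [exact: tdeg0 | move=> e; rewrite mulr0 tri0].
  - move=> c G1 G2 h1 h2; exists (c%:P *: G1 + G2).
      by apply: tdegD => //; exact: tdegZ.
    by move=> e; rewrite mulrDr triD -scalerAr triZ.
  move=> x h; pose F : bp := \sum_e (x e)%:P *: mono e.
  have tF : tdeg k F by apply: tdeg_sum => e _; exact/tdegZ/tdeg_mono.
  (* Testing the annihilator condition with [F] itself makes the integral of its square vanish. *)
  have F0 : F = 0.
    apply: tri_sqr_eq0; rewrite expr2 {1}/F mulr_suml tri_sum -[RHS](h _ tF).
    by apply: eq_bigr => e _; rewrite -scalerAl triZ.
  transitivity (F`_e0.1`_e0.2); last by rewrite F0 !coef0.
  by rewrite !coef_sum; apply: eq_bigr => e _; rewrite coefZ coefCM.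
have /choice[G GP] : forall e0 : 'I_k.+1 * 'I_k.+1, exists G : bp, tdeg k G /\
    forall e : 'I_k.+1 * 'I_k.+1, tri (mono e * G) = (mono e)`_e0.1`_e0.2.
  by move=> e0; have [G ? ?] := rep e0; exists G.
have GE e0 := (GP e0).2.
have C0 : 0 <= \sum_e0 tri (G e0 ^+ 2).
  by apply: sumr_ge0 => e _; exact: tri_sqr_ge0.
exists (1 + \sum_e0 tri (G e0 ^+ 2)); first by rewrite ltr_pwDl.
move=> F hF a b; have [ab|ab] := ltnP k (a + b).
  by rewrite hF// expr0n mulr_ge0 ?tri_sqr_ge0// addr_ge0.
have ak : (a < k.+1)%N by lia.
have bk : (b < k.+1)%N by lia.
pose e0 := (Ordinal ak, Ordinal bk).
have -> : F`_a`_b = tri (F * G e0).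
  rewrite [in RHS](mono_sum hF) mulr_suml tri_sum.
  transitivity (\sum_e (F`_(e : 'I_k.+1 * 'I_k.+1).1`_e.2) * (mono e)`_a`_b).
    rewrite [in LHS](mono_sum hF) !coef_sum.
    by apply: eq_bigr => e _; rewrite coefZ coefCM.
  by apply: eq_bigr => e _; rewrite -scalerAl triZ GE.
apply: le_trans (tri_cauchy_schwarz _ _) _.
rewrite mulrC ler_wpM2r ?tri_sqr_ge0// (bigD1 e0)//= addrCA lerDl.
by rewrite addr_ge0// sumr_ge0// => e _; exact: tri_sqr_ge0.
Qed.

(** Seen as a polynomial in [t] on the triangle, [p] is integrated with the weight [1 - t <= 1]. *)
Lemma coef_int01_bound k : exists2 C : R, 0 < C & forall p, (size p <= k.+1)%N ->
  forall a, p`_a ^+ 2 <= C * int01 (p ^+ 2).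
Proof.
have [C C0 hC] := coef_tri_bound k; exists C => // p sp a.
have := hC p%:P (tdeg_inner sp) 0%N a; rewrite coefC /= => h.
apply: le_trans h (ler_wpM2l (ltW C0) _).
have -> : p%:P ^+ 2 = (p ^+ 2)%:P by rewrite rmorphXn.
rewrite tri_inner; apply: int01_le => s /andP[s0 s1]; rewrite hornerM ler_piMr//.
  by rewrite horner_exp sqr_ge0.
by rewrite !hornerE; lra.
Qed.
End polynomial_bounds.

(** * The inf-sup condition on the reference configuration *)

Section reference_infsup.
Context {R : realType}.
Notation bp := {poly {poly R}}.
Implicit Types (F G : bp) (p q : {poly R}).

Lemma swapXYZ (c : R) F : swapXY (c%:P *: F) = c%:P *: swapXY F.
Proof.
by rewrite -!mul_polyC swapXYM swapXY_polyC map_polyC.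
Qed.
Lemma swapXYD F G : swapXY (F + G) = swapXY F + swapXY G.
Proof. exact: raddfD. Qed.
Lemma dYD F G : dY (F + G) = dY F + dY G.
Proof. by rewrite /dY swapXYD derivD swapXYD. Qed.
Lemma dYZ (c : R) F : dY (c%:P *: F) = c%:P *: dY F.
Proof. by rewrite /dY swapXYZ derivZ swapXYZ. Qed.
Lemma dYM F1 F2 : dY (F1 * F2) = dY F1 * F2 + F1 * dY F2 :> bp.
Proof. by rewrite /dY swapXYM derivM swapXYD !swapXYM !swapXYK. Qed.

Lemma dY_varX : dY 'X = 0 :> bp.
Proof. by rewrite -(map_polyX polyC) dY_outer. Qed.

Lemma sEZ (c : R) F : sE (c%:P *: F) = c *: sE F.
Proof. by rewrite /sE swapXYZ hornerZ mul_polyC. Qed.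
Lemma tEZ (c : R) F : tE (c%:P *: F) = c *: tE F.
Proof. by rewrite /tE hornerZ mul_polyC. Qed.

Lemma bhat_linl (c : R) (u1 u2 w1 w2 : 'I_3 -> bp) (tau : @sfield R) :
  bhat (fun i => c%:P *: u1 i + w1 i) (fun i => c%:P *: u2 i + w2 i) tau =
  c * bhat u1 u2 tau + bhat w1 w2 tau.
Proof.
rewrite /bhat mulr_sumr -big_split; apply: eq_bigr => i _ /=.
rewrite !(dYD, dYZ, derivD, derivZ, sED, tED, sEZ, tEZ).
rewrite !(mulrDr, triD, int01D) -!scalerAr !(triZ, int01Z); ring.
Qed.

Definition scomb (c : R) (tau1 tau2 : @sfield R) : @sfield R :=
  SField (fun i => c%:P *: fp tau1 i + fp tau2 i)
         (fun i => c%:P *: fq tau1 i + fq tau2 i)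
         (fun i => c%:P *: fr tau1 i + fr tau2 i).

Definition szero : @sfield R := SField (fun=> 0) (fun=> 0) (fun=> 0).

Lemma bhat_linr (c : R) (u1 u2 : 'I_3 -> bp) (tau1 tau2 : @sfield R) :
  bhat u1 u2 (scomb c tau1 tau2) = c * bhat u1 u2 tau1 + bhat u1 u2 tau2.
Proof.
rewrite /bhat mulr_sumr -big_split; apply: eq_bigr => i _ /=.
rewrite !(sED, tED, sEZ, tEZ).
rewrite !(mulrDl, mulrDr, triD, int01D) -!scalerAl !(triZ, int01Z); ring.
Qed.

Lemma bhat_szero (u1 u2 : 'I_3 -> bp) : bhat u1 u2 szero = 0.
Proof.
rewrite /bhat big1// => i _ /=.
by rewrite sE0 tE0 !mul0r !addr0 tri0 int010 !addr0.
Qed.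

Lemma bhat_u0 (tau : @sfield R) : bhat (fun=> 0) (fun=> 0) tau = 0.
Proof.
rewrite /bhat big1// => i _.
by rewrite /dY raddf0 deriv0 raddf0 sE0 tE0 !(mulr0, addr0) tri0 int010 !addr0.
Qed.

Lemma admissible_szero k : admissible k szero.
Proof.
by split=> i /=; rewrite ?sE0 ?tE0 ?addr0//; split; exact: tdeg0.
Qed.

Lemma admissible_scomb k c (tau1 tau2 : @sfield R) :
  admissible k tau1 -> admissible k tau2 -> admissible k (scomb c tau1 tau2).
Proof.
move=> [d1 q1 r1] [d2 q2 r2]; split=> i /=.
- have [? ? ?] := d1 i; have [? ? ?] := d2 i.
  by split; apply: tdegD => //; apply: tdegZ.
- by rewrite sED tED sEZ tEZ q1 q2.
- by rewrite !sED !tED !sEZ !tEZ r1 r2 !scalerDr; ring.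
Qed.

(* The symmetric gradient and the jumps across the spokes, in the oblique
   components of the reference configuration. *)
Definition strain (u1 u2 : 'I_3 -> bp) (i c : 'I_3) : bp :=
  if c == 0 then (u1 i)^`()
  else if c == 1 then dY (u2 i) else dY (u1 i) + (u2 i)^`().

Definition jmp (u1 u2 : 'I_3 -> bp) (i : 'I_3) (b : bool) : {poly R} :=
  if b then sE (u2 (i + 1)) + tE (u2 i) + tE (u1 i)
  else sE (u1 (i + 1)) - tE (u2 i).

Lemma strain_lin (c : R) (u1 u2 w1 w2 : 'I_3 -> bp) i d :
  strain (fun i => c%:P *: u1 i + w1 i) (fun i => c%:P *: u2 i + w2 i) i d =
  c%:P *: strain u1 u2 i d + strain w1 w2 i d.
Proof.
rewrite /strain; do 2?case: ifP => _; rewrite !(dYD, dYZ, derivD, derivZ)//.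
by rewrite scalerDr; ring.
Qed.

Lemma jmp_lin (c : R) (u1 u2 w1 w2 : 'I_3 -> bp) i b :
  jmp (fun i => c%:P *: u1 i + w1 i) (fun i => c%:P *: u2 i + w2 i) i b =
  c *: jmp u1 u2 i b + jmp w1 w2 i b.
Proof.
by rewrite /jmp; case: b; rewrite !(sED, tED, sEZ, tEZ) !(scalerDr, scalerN); ring.
Qed.

Lemma tdeg_strain k (u1 u2 : 'I_3 -> bp) i d :
  (forall i, tdeg k (u1 i)) -> (forall i, tdeg k (u2 i)) ->
  tdeg k (strain u1 u2 i d).
Proof.
move=> h1 h2; apply: (@tdegW _ k.-1); first exact: leq_pred.
rewrite /strain; do 2?case: ifP => _; try exact: tdeg_deriv.
  exact: tdeg_dY.
by apply: tdegD; [exact: tdeg_dY | exact: tdeg_deriv].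
Qed.

Lemma size_jmp k (u1 u2 : 'I_3 -> bp) i b :
  (forall i, tdeg k (u1 i)) -> (forall i, tdeg k (u2 i)) ->
  (size (jmp u1 u2 i b) <= k.+1)%N.
Proof.
move=> h1 h2; rewrite /jmp; case: b.
  rewrite (leq_trans (size_polyD _ _))// geq_max (size_tE (h1 _)) andbT.
  by rewrite (leq_trans (size_polyD _ _))// geq_max (size_sE (h2 _)) (size_tE (h2 _)).
rewrite (leq_trans (size_polyD _ _))// geq_max size_polyN.
by rewrite (size_sE (h1 _)) (size_tE (h2 _)).
Qed.

Section represent.
Context (k : nat).
Hypothesis k1 : (1 <= k)%N.

Notation idx := ('I_3 * bool * ('I_k.+1 * 'I_k.+1))%type.

Definition basis (b : bool) (e : idx) (i : 'I_3) : bp :=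
  if (i == e.1.1) && (b == e.1.2) then mono e.2 else 0.

Definition expand (x : idx -> R) (b : bool) (i : 'I_3) : bp :=
  \sum_e (x e)%:P *: basis b e i.

Lemma tdeg_basis b e i : tdeg k (basis b e i).
Proof.
by rewrite /basis; case: ifP => _; [exact: tdeg_mono | exact: tdeg0].
Qed.

Lemma tdeg_expand x b i : tdeg k (expand x b i).
Proof. by apply: tdeg_sum => e _; exact/tdegZ/tdeg_basis. Qed.

Lemma expandP (u1 u2 : 'I_3 -> bp) :
  (forall i, tdeg k (u1 i)) -> (forall i, tdeg k (u2 i)) ->
  exists x, u1 = expand x false /\ u2 = expand x true.
Proof.
move=> h1 h2.
exists (fun e : idx => (if e.1.2 then u2 e.1.1 else u1 e.1.1)`_(e.2.1)`_(e.2.2)).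
have E (x : idx -> R) b i : expand x b i = \sum_e (x (i, b, e))%:P *: mono e.
  rewrite /expand (eq_bigr (fun e : idx => (x (e.1, e.2))%:P *: basis b (e.1, e.2) i)); last by case.
  rewrite -(pair_bigA _ (fun f e => (x (f, e))%:P *: basis b (f, e) i)) /=.
  rewrite (bigD1 (i, b))//= [X in _ + X]big1 ?addr0; last first.
    move=> [i' b'] ne; rewrite big1// => e _; rewrite /basis /=.
    by rewrite eq_sym [b == _]eq_sym -xpair_eqE (negPf ne) scaler0.
  by apply: eq_bigr => e _; rewrite /basis /= !eqxx.
split; apply/funext => i; rewrite E /=.
  exact: mono_sum.
exact: mono_sum.
Qed.

Lemma linear_expand (op : ('I_3 -> bp) -> ('I_3 -> bp) -> R) :
  op (fun=> 0) (fun=> 0) = 0 ->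
  (forall c u1 u2 w1 w2, op (fun i => c%:P *: u1 i + w1 i)
      (fun i => c%:P *: u2 i + w2 i) = c * op u1 u2 + op w1 w2) ->
  forall x, op (expand x false) (expand x true) =
    \sum_e x e * op (basis false e) (basis true e).
Proof.
move=> op0 opl x; rewrite /expand; elim: (index_enum _) => [|e s IH].
  rewrite big_nil -[RHS]op0; congr op; apply/funext => i; exact: big_nil.
rewrite big_cons -IH -opl; congr op; apply/funext => i; exact: big_cons.
Qed.

(** By [kernel_rigid], a field killed by every admissible stress has neither strain nor jump, hence
    is killed by [op]; expanded in monomials, this is the hypothesis of [subspace_annihilator]. *)
Lemma represent (op : ('I_3 -> bp) -> ('I_3 -> bp) -> R) :
  (forall c u1 u2 w1 w2, op (fun i => c%:P *: u1 i + w1 i)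
      (fun i => c%:P *: u2 i + w2 i) = c * op u1 u2 + op w1 w2) ->
  (forall u1 u2, (forall i d, strain u1 u2 i d = 0) ->
     (forall i b, jmp u1 u2 i b = 0) -> op u1 u2 = 0) ->
  exists tau, admissible k tau /\ forall u1 u2,
    (forall i, tdeg k (u1 i)) -> (forall i, tdeg k (u2 i)) ->
    bhat u1 u2 tau = op u1 u2.
Proof.
move=> opl opk.
have op0 : op (fun=> 0) (fun=> 0) = 0.
  apply: opk => i.
    by move=> d; rewrite /strain /dY !(raddf0, deriv0) ?addr0 !if_same.
  by case; rewrite /jmp sE0 tE0 ?subr0 ?addr0.
have [tau tauA tauE] : exists2 tau, admissible k tau &
    forall e : idx, bhat (basis false e) (basis true e) tau =
                    op (basis false e) (basis true e).
  apply: (@subspace_annihilator R _ (@sfield R) (admissible k)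
    (fun tau e => bhat (basis false e) (basis true e) tau)
    (fun e => op (basis false e) (basis true e))).
  - by exists szero; [exact: admissible_szero | move=> e; exact: bhat_szero].
  - move=> c t1 t2 h1 h2; exists (scomb c t1 t2); first exact: admissible_scomb.
    by move=> e; exact: bhat_linr.
  move=> x h; rewrite -(linear_expand op0 opl).
  have hx tau : admissible k tau -> bhat (expand x false) (expand x true) tau = 0.
    move=> /h <-; apply: (linear_expand (op := fun u1 u2 => bhat u1 u2 tau)).
      exact: bhat_u0.
    by move=> *; exact: bhat_linl.
  have ker := kernel_rigid k1 (tdeg_expand x false) (tdeg_expand x true) hx.
  apply: opk => i; have [[s1 s2 s3] [j1 j2]] := ker i.
    by move=> d; rewrite /strain; do 2?case: ifP => _.
  by case; rewrite /jmp// j1 subrr.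
exists tau; split => // u1 u2 h1 h2; have [x [-> ->]] := expandP h1 h2.
rewrite (linear_expand op0 opl) (linear_expand (op := fun u1 u2 => bhat u1 u2 tau)).
- by apply: eq_bigr => e _; rewrite tauE.
- exact: bhat_u0.
- by move=> *; exact: bhat_linl.
Qed.
Definition coef_idx : finType :=
  (('I_3 * 'I_3 * ('I_k.+1 * 'I_k.+1)) + ('I_3 * bool * 'I_k.+1))%type.

Definition coef_op (l : coef_idx) (u1 u2 : 'I_3 -> bp) : R :=
  match l with
  | inl (i, d, e) => (strain u1 u2 i d)`_(e.1)`_(e.2)
  | inr (i, b, a) => (jmp u1 u2 i b)`_a
  end.

Definition ssum (s : seq coef_idx) (c : coef_idx -> R)
    (t : coef_idx -> @sfield R) : @sfield R :=
  foldr (fun l acc => scomb (c l) (t l) acc) szero s.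

Lemma ssum_admissible s c t : (forall l, admissible k (t l)) ->
  admissible k (ssum s c t).
Proof.
move=> h; elim: s => [|l s IH] /=; first exact: admissible_szero.
exact: admissible_scomb.
Qed.

Lemma bhat_ssum s c t u1 u2 :
  bhat u1 u2 (ssum s c t) = \sum_(l <- s) c l * bhat u1 u2 (t l).
Proof.
elim: s => [|l s IH] /=; first by rewrite big_nil bhat_szero.
by rewrite bhat_linr big_cons IH.
Qed.

Lemma ssumE s c t i :
  [/\ fp (ssum s c t) i = \sum_(l <- s) (c l)%:P *: fp (t l) i,
      fq (ssum s c t) i = \sum_(l <- s) (c l)%:P *: fq (t l) i &
      fr (ssum s c t) i = \sum_(l <- s) (c l)%:P *: fr (t l) i].
Proof.
elim: s => [|l s [IH1 IH2 IH3]] /=; first by rewrite !big_nil.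
by rewrite !big_cons IH1 IH2 IH3.
Qed.

(** Every coefficient of a strain or jump equals [bhat u1 u2 (t l)] for a fixed admissible [t l].
    Weighting the [t l] by these coefficients makes [bhat] the sum of their squares, which bounds
    strains and jumps and, by Cauchy-Schwarz, the stress itself. *)
Theorem reference_infsup : exists2 C : R, 0 < C & forall u1 u2 : 'I_3 -> bp,
  (forall i, tdeg k (u1 i)) -> (forall i, tdeg k (u2 i)) ->
  exists tau, [/\ admissible k tau,
    \sum_i \sum_d tri (strain u1 u2 i d ^+ 2)
      + \sum_i \sum_b int01 (jmp u1 u2 i b ^+ 2) <= C * bhat u1 u2 tau &
    \sum_i tri (fp tau i ^+ 2 + fq tau i ^+ 2 + fr tau i ^+ 2)
      <= C * bhat u1 u2 tau].
Proof.
have /choice[t tP] : forall l : coef_idx, exists tau, admissible k tau /\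
    forall u1 u2, (forall i, tdeg k (u1 i)) -> (forall i, tdeg k (u2 i)) ->
    bhat u1 u2 tau = coef_op l u1 u2.
  move=> l; apply: represent.
    case: l => [[[i d] e]|[[i b] a]] c u1 u2 w1 w2 /=.
      by rewrite strain_lin !coefD coefZ coefCM.
    by rewrite jmp_lin coefD coefZ.
  move=> u1 u2 hs hj; case: l => [[[i d] e]|[[i b] a]] /=.
    by rewrite hs !coef0.
  by rewrite hj coef0.
pose K1 : R := tri (\sum_e mono (k := k) e ^+ 2).
pose K2 : R := int01 (\sum_(a < k.+1) 'X^a ^+ 2).
pose K3 : R := \sum_i (tri (\sum_l fp (t l) i ^+ 2) + tri (\sum_l fq (t l) i ^+ 2)
  + tri (\sum_l fr (t l) i ^+ 2)).
have sq0 (X : finType) (G : X -> bp) : 0 <= tri (\sum_e G e ^+ 2).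
  by rewrite tri_sum; apply: sumr_ge0 => e _; exact: tri_sqr_ge0.
have K10 : 0 <= K1 by exact: sq0.
have K20 : 0 <= K2.
  by rewrite /K2 int01_sum; apply: sumr_ge0 => e _; exact: int01_sqr_ge0.
have K30 : 0 <= K3 by apply: sumr_ge0 => i _; rewrite !addr_ge0.
exists (1 + K1 + K2 + K3); first lra.
move=> u1 u2 h1 h2; pose c l := coef_op l u1 u2.
pose tau := ssum (index_enum coef_idx) c t.
have SE : bhat u1 u2 tau = \sum_l c l ^+ 2.
  by rewrite bhat_ssum; apply: eq_bigr => l _; rewrite (tP l).2.
have SE2 : bhat u1 u2 tau = \sum_i \sum_d \sum_e (strain u1 u2 i d)`_(e.1 : 'I_k.+1)`_(e.2 : 'I_k.+1) ^+ 2
   + \sum_i \sum_b \sum_(a < k.+1) (jmp u1 u2 i b)`_a ^+ 2.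
  rewrite SE big_sumType /= !pair_bigA /=; congr (_ + _).
    by apply: eq_bigr => -[[i d] e].
  by apply: eq_bigr => -[[i d] e].
have S1 : 0 <= \sum_i \sum_d \sum_e (strain u1 u2 i d)`_(e.1 : 'I_k.+1)`_(e.2 : 'I_k.+1) ^+ 2.
  by do 3!(apply: sumr_ge0 => ? _); exact: sqr_ge0.
have S2 : 0 <= \sum_i \sum_b \sum_(a < k.+1) (jmp u1 u2 i b)`_a ^+ 2.
  by do 3!(apply: sumr_ge0 => ? _); exact: sqr_ge0.
have S0 : 0 <= bhat u1 u2 tau by rewrite SE2 addr_ge0.
exists tau; split.
- by apply: ssum_admissible => l; exact: (tP l).1.
- apply: (@le_trans _ _ ((K1 + K2) * bhat u1 u2 tau)); last first.
    by rewrite ler_wpM2r//; lra.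
  rewrite {1}SE2 mulrDr [X in _ <= X]addrC mulrDl.
  have b1 : \sum_i \sum_d tri (strain u1 u2 i d ^+ 2) <=
      K1 * \sum_i \sum_d \sum_e (strain u1 u2 i d)`_(e.1 : 'I_k.+1)`_(e.2 : 'I_k.+1) ^+ 2.
    rewrite mulr_sumr; apply: ler_sum => i _; rewrite mulr_sumr; apply: ler_sum => d _.
    rewrite [X in tri (X ^+ 2)](mono_sum (tdeg_strain i d h1 h2)) mulrC.
    exact: tri_sqr_sum.
  have b2 : \sum_i \sum_b int01 (jmp u1 u2 i b ^+ 2) <=
      K2 * \sum_i \sum_b \sum_(a < k.+1) (jmp u1 u2 i b)`_a ^+ 2.
    rewrite mulr_sumr; apply: ler_sum => i _; rewrite mulr_sumr; apply: ler_sum => b _.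
    have {1}-> : jmp u1 u2 i b = \sum_(a < k.+1) (jmp u1 u2 i b)`_a *: 'X^a.
      rewrite -poly_def; apply/polyP => a; rewrite coef_poly; case: ltnP => // ak.
      by apply: nth_default; rewrite (leq_trans (size_jmp i b h1 h2)).
    by rewrite mulrC; exact: int01_sqr_sum.
  have p1 := mulr_ge0 K20 S1; have p2 := mulr_ge0 K10 S2; lra.
- apply: (@le_trans _ _ (K3 * bhat u1 u2 tau)); last first.
    by rewrite ler_wpM2r//; lra.
  rewrite mulr_suml; apply: ler_sum => i _.
  have [-> -> ->] := ssumE (index_enum coef_idx) c t i.
  rewrite !triD SE !mulrDl ![tri _ * _]mulrC.
  by rewrite !lerD//; exact: tri_sqr_sum.
Qed.
End represent.
End reference_infsup.

(** * Geometry of the mesh *)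

Section plane_geometry.
Context {R : realType}.
Notation mu := (@lebesgue_measure R).
Notation edist := (@Defs.edist R).
Implicit Types (x y a b c : R * R).

Definition dot x y : R := x.1 * y.1 + x.2 * y.2.

Lemma pair_eq x y : x.1 = y.1 -> x.2 = y.2 -> x = y.
Proof. by case: x y => [x1 x2] [y1 y2] /= -> ->. Qed.

Lemma coordD x y : ((x + y).1 = x.1 + y.1) * ((x + y).2 = x.2 + y.2).
Proof. by []. Qed.
Lemma coordN x : ((- x).1 = - x.1) * ((- x).2 = - x.2).
Proof. by []. Qed.
Lemma coordZ (r : R) x : ((r *: x).1 = r * x.1) * ((r *: x).2 = r * x.2).
Proof. by []. Qed.
Definition coordE := (coordD, coordN, coordZ).

Lemma mdot_vec x y : mdot (vec x) (vec y) = dot x y.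
Proof.
rewrite /mdot big_ord_recl big_ord1 !big_ord1 /vec !mxE /=.
by rewrite /dot.
Qed.

Lemma edistE x y : edist x y = Num.sqrt (dot (x - y) (x - y)).
Proof. by rewrite /Defs.edist mdot_vec. Qed.

Lemma affmapE c a b z : affmap c a b z = c + z.1 *: a + z.2 *: b.
Proof. by []. Qed.

Lemma hull_set3 (W : finType) (p : W -> R * R) (i j l : W) :
  l != i -> l != j -> i != j ->
  hull p [set l; i; j]%SET = affmap (p l) (p i - p l) (p j - p l) @` reftri.
Proof.
rewrite eq_sym => il; rewrite eq_sym => jl ij.
have sumE (Z : nmodType) (w : W -> Z) : \sum_(k in [set l; i; j]%SET) w k = w l + (w i + w j).
  have -> : [set l; i; j]%SET = (l |: (i |: [set j]))%SET.
    by apply/finset.setP => k; rewrite !inE orbA.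
  rewrite big_setU1 ?inE ?negb_or 1?[l == _]eq_sym ?il 1?[l == _]eq_sym ?jl//=.
  by rewrite big_setU1 ?inE//= big_set1.
apply/seteqP; split => x /=.
  move=> [w [w0 w1 ->]]; exists (w i, w j); rewrite /reftri /=.
    move: w1; rewrite sumE => w1; apply/and3P; split => //.
    by have := w0 l; lra.
  move: w1; rewrite !sumE => w1; rewrite affmapE /=.
  have -> : w l = 1 - w i - w j by lra.
  by apply: pair_eq; rewrite !coordE; ring.
move=> [[s t]] /and3P/= [s0 t0 st] <-.
exists (fun k => if k == i then s else if k == j then t else 1 - s - t); split.
- by move=> k; case: ifP => // _; case: ifP => // _; lra.
- by rewrite sumE eqxx [l == i]eq_sym (negPf il) [l == j]eq_sym (negPf jl)
    [j == i]eq_sym (negPf ij) eqxx; lra.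
rewrite sumE eqxx [l == i]eq_sym (negPf il) [l == j]eq_sym (negPf jl)
    [j == i]eq_sym (negPf ij) eqxx affmapE /=.
by apply: pair_eq; rewrite !coordE; ring.
Qed.

Lemma hull_set2 (W : finType) (p : W -> R * R) (i j : W) : i != j ->
  hull p [set i; j]%SET = [set (1 - s) *: p i + s *: p j | s in `[0, 1]%classic].
Proof.
move=> ij.
have sumE (Z : nmodType) (w : W -> Z) : \sum_(k in [set i; j]%SET) w k = w i + w j.
  by rewrite big_setU1 ?inE//= big_set1.
apply/seteqP; split => x /=.
  move=> [w [w0 w1 ->]]; move: w1; rewrite !sumE => w1; exists (w j).
    by rewrite in_itv/= w0/=; have := w0 i; lra.
  by rewrite (_ : 1 - w j = w i)//; lra.
move=> [s]; rewrite in_itv/= => /andP[s0 s1] <-.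
exists (fun k => if k == j then s else 1 - s); split.
- by move=> k; case: ifP => // _; lra.
- by rewrite sumE eqxx (negPf ij); lra.
- by rewrite sumE eqxx (negPf ij).
Qed.

Definition affinv c a b x : R * R :=
  (cross (x - c) b / cross a b, cross a (x - c) / cross a b).

Lemma affmapK c a b : cross a b != 0 -> cancel (affmap c a b) (affinv c a b).
Proof.
move=> D0 [s t]; rewrite /affinv /affmap /cross /=.
by move: D0; rewrite /cross => D0; congr pair; field.
Qed.

Lemma affinvK c a b : cross a b != 0 -> cancel (affinv c a b) (affmap c a b).
Proof.
move=> D0 [s t]; rewrite /affinv /affmap /cross /=.
by move: D0; rewrite /cross => D0; congr pair; field.
Qed.

Lemma affinv_affmap c a b x :
  affinv c a b x = affmap (affinv c a b 0) (b.2 / cross a b, - a.2 / cross a b)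
                          (- b.1 / cross a b, a.1 / cross a b) x.
Proof. by rewrite /affinv /affmap /cross /=; congr pair; ring. Qed.

Lemma measurable_affinv c a b : measurable_fun setT (affinv c a b).
Proof.
by rewrite (funext (affinv_affmap c a b)); exact: measurable_affmap.
Qed.

Lemma Rintegral_triangle c a b (f : R * R -> R) (F : {poly {poly R}}) :
  cross a b != 0 -> (forall z, f (affmap c a b z) = F.[z.1, z.2]) ->
  (\int[(mu \x mu)%E]_(x in affmap c a b @` reftri) f x = `|cross a b| * tri F)%R.
Proof.
move=> D0 fF.
have preE : affmap c a b @` reftri = affinv c a b @^-1` reftri.
  apply/seteqP; split => x /=; first by move=> [z zr <-]; rewrite affmapK.
  by move=> h; exists (affinv c a b x) => //; rewrite affinvK.
apply: (Rintegral_affmap (c := c)) => //.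
- have -> : f = (fun z : R * R => F.[z.1, z.2]) \o affinv c a b.
    by apply/funext => x; have := fF (affinv c a b x); rewrite affinvK.
  apply: measurableT_comp; [exact: measurable_bipoly | exact: measurable_affinv].
- rewrite preE -[X in measurable X]setTI.
  exact: (measurable_affinv c a b measurableT measurable_reftri).
- rewrite preE; apply/seteqP; split => z /=; rewrite affmapK//.
Qed.

(** [enum] lists the two labels in an unspecified order; the reversed one is settled by the
    reflection invariance of [int01]. *)
Lemma int_edgeE (V : finType) (M : mesh R V) (i j : V) (f : R * R -> R)
    (p : {poly R}) : i != j ->
  (forall s, f ((1 - s) *: pos M i + s *: pos M j) = p.[s]) ->
  int_edge M [set i; j]%SET f = edist (pos M i) (pos M j) * int01 p.
Proof.
move=> ij fp; rewrite /int_edge.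
have pe : perm_eq (enum [set i; j]%SET) [:: i; j].
  apply: uniq_perm; rewrite ?enum_uniq//= ?inE ?ij//.
  by move=> k; rewrite mem_enum !inE.
have : enum [set i; j]%SET = [:: i; j] \/ enum [set i; j]%SET = [:: j; i].
  have := perm_size pe; case E : (enum _) => [|x [|y []]]// _.
  have xin : x \in [set i; j]%SET by rewrite -mem_enum E mem_head.
  have yin : y \in [set i; j]%SET by rewrite -mem_enum E !inE eqxx orbT.
  have xy : x != y by have := enum_uniq [set i; j]%SET; rewrite E /= inE andbT.
  move: xin yin xy; rewrite !inE => /orP[]/eqP-> /orP[]/eqP->; rewrite ?eqxx//; by [left|right].
case=> ->.
  by under eq_Rintegral do rewrite fp; rewrite Rintegral_int01.
rewrite !edistE -[in RHS](opprB (pos M j)) /dot !mulrNN; congr (_ * _).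
rewrite -int01_rev -Rintegral_int01; apply: eq_Rintegral => s _.
by rewrite horner_comp !hornerE -fp addrC subKr.
Qed.
End plane_geometry.

(** * Polynomial functions and their derivatives *)

Section polynomial_functions.
Context {R : realType}.
Notation bp := {poly {poly R}}.
Implicit Types (F G : bp) (f : R * R -> R) (z w : R * R).

Definition polyfun (k : nat) f : Prop :=
  exists2 F, tdeg k F & forall z, f z = F.[z.1, z.2].

Lemma horner_mono k (e : 'I_k.+1 * 'I_k.+1) (s t : R) :
  (mono e).[s, t] = if (e.1 + e.2 <= k)%N then s ^+ e.1 * t ^+ e.2 else 0.
Proof.
rewrite /mono; case: ifP => _; last by rewrite !horner0.
rewrite !hornerM hornerC hornerXn; congr (_ * _).
have /= -> := horner_map polyC ('X^(e.1) : {poly R}) s.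
by rewrite hornerC hornerXn.
Qed.

Lemma horner_bipoly k F (s t : R) : tdeg k F ->
  F.[s, t] = \sum_(e : 'I_k.+1 * 'I_k.+1 | (e.1 + e.2 <= k)%N)
    F`_e.1`_e.2 * (s ^+ e.1 * t ^+ e.2).
Proof.
move=> hF; rewrite {1}(mono_sum hF) horner2_sum [RHS]big_mkcond /=.
apply: eq_bigr => e _; rewrite hornerZ hornerM hornerC horner_mono.
by case: ifP => //; rewrite mulr0.
Qed.

Lemma poly_leP k f : poly_le k f <-> polyfun k f.
Proof.
split=> [[c fE]|[F hF fE]].
  exists (\sum_(e : 'I_k.+1 * 'I_k.+1) (c e.1 e.2)%:P *: mono e).
    by apply: tdeg_sum => e _; exact/tdegZ/tdeg_mono.
  move=> z; rewrite fE horner2_sum pair_big_dep big_mkcond /=.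
  apply: eq_bigr => e _; rewrite hornerZ hornerM hornerC horner_mono.
  by case: ifP; rewrite ?mulr0// mulrA.
exists (fun i j => F`_i`_j) => z; rewrite fE (horner_bipoly _ _ hF).
by rewrite pair_big_dep /=; apply: eq_bigr => e _; rewrite mulrA.
Qed.

Lemma tdegX k F n : tdeg k F -> tdeg (k * n) (F ^+ n).
Proof.
move=> hF; elim: n => [|n IH].
  by rewrite muln0 expr0 -polyC1; apply: tdeg_inner; rewrite size_poly1.
by rewrite exprS mulnS; exact: tdegM.
Qed.

Lemma tdeg_const k (r : R) : tdeg k r%:P%:P.
Proof. by apply: tdeg_inner; rewrite (leq_trans (size_polyC_leq1 _)). Qed.

Lemma tdeg_varX : tdeg 1 ('X : bp).
Proof. by rewrite -(map_polyX polyC); apply: tdeg_outer; rewrite size_polyX. Qed.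

Lemma tdeg_varY : tdeg 1 ('X%:P : bp).
Proof. by apply: tdeg_inner; rewrite size_polyX. Qed.

Lemma polyfun_affmap k f (c a b : R * R) : polyfun k f ->
  polyfun k (f \o affmap c a b).
Proof.
move=> [F hF fE].
pose L1 : bp := c.1%:P%:P + a.1%:P *: 'X + b.1%:P *: 'X%:P.
pose L2 : bp := c.2%:P%:P + a.2%:P *: 'X + b.2%:P *: 'X%:P.
have t1 : tdeg 1 L1.
  by do 2!(apply: tdegD; [|apply: tdegZ; by [exact: tdeg_varX|exact: tdeg_varY]]); exact: tdeg_const.
have t2 : tdeg 1 L2.
  by do 2!(apply: tdegD; [|apply: tdegZ; by [exact: tdeg_varX|exact: tdeg_varY]]); exact: tdeg_const.
exists (\sum_(e : 'I_k.+1 * 'I_k.+1 | (e.1 + e.2 <= k)%N)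
    (F`_e.1`_e.2)%:P *: (L1 ^+ e.1 * L2 ^+ e.2)).
  apply: tdeg_sum => e le; apply/tdegZ/(tdegW le)/tdegM.
    by rewrite -[X in tdeg X]mul1n; exact: tdegX.
  by rewrite -[X in tdeg X]mul1n; exact: tdegX.
move=> z; rewrite /= fE (horner_bipoly _ _ hF) !horner_sum; apply: eq_bigr => e _.
rewrite hornerZ !hornerM hornerC !horner_exp; congr (_ * (_ ^+ _ * _ ^+ _)).
  by rewrite /L1 /affmap !hornerD !hornerZ !hornerM !hornerC !hornerX !hornerC /=; ring.
by rewrite /L2 /affmap !hornerD !hornerZ !hornerM !hornerC !hornerX !hornerC /=; ring.
Qed.

(** Values along the line and the derivative at its origin are carried together, since the product
    rule needs both; the property passes to sums and products and holds for constants and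
    variables. *)
Lemma bipoly_line F z w : exists p : {poly R},
  (forall h, p.[h] = F.[z.1 + h * w.1, z.2 + h * w.2]) /\
  p^`().[0] = w.1 * F^`().[z.1, z.2] + w.2 * (dY F).[z.1, z.2].
Proof.
pose P F := exists p : {poly R},
  (forall h, p.[h] = F.[z.1 + h * w.1, z.2 + h * w.2]) /\
  p^`().[0] = w.1 * F^`().[z.1, z.2] + w.2 * (dY F).[z.1, z.2].
have PD F1 F2 : P F1 -> P F2 -> P (F1 + F2).
  move=> [p1 [h1 d1]] [p2 [h2 d2]]; exists (p1 + p2); split.
    by move=> h; rewrite !hornerD h1 h2.
  by rewrite derivD !hornerD d1 d2 derivD dYD !hornerD; ring.
have PM F1 F2 : P F1 -> P F2 -> P (F1 * F2).
  move=> [p1 [h1 d1]] [p2 [h2 d2]]; exists (p1 * p2); split.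
    by move=> h; rewrite !hornerM h1 h2.
  rewrite derivM !hornerD !hornerM d1 d2 h1 h2 derivM dYM !hornerD !hornerM.
  by rewrite !mul0r !addr0; ring.
have PC (r : R) : P r%:P%:P.
  exists r%:P; split; first by move=> h; rewrite !hornerC.
  by rewrite dY_inner !derivC ?polyC0 !horner0; ring.
have PX : P 'X.
  exists (z.1%:P + w.1 *: 'X); split.
    by move=> h; rewrite !hornerD hornerZ !hornerX !hornerC mulrC.
  rewrite derivD derivC derivZ !derivX add0r alg_polyC hornerC.
  by rewrite dY_varX -polyC1 !hornerC ?horner0; ring.
have PY : P 'X%:P.
  exists (z.2%:P + w.2 *: 'X); split.
    by move=> h; rewrite !hornerD hornerZ !hornerX !hornerC !hornerX mulrC.
  rewrite derivD !derivC derivZ !derivX add0r alg_polyC hornerC.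
  by rewrite dY_inner derivX ?polyC0 -?polyC1 !hornerC ?horner0 ?hornerC; ring.
suff : P F by [].
elim/poly_ind: F => [|F c IH].
  by have := PC 0; rewrite !polyC0.
apply: (PD _ _); first exact: PM.
elim/poly_ind: c => [|c r IHc]; first by have := PC 0; rewrite !polyC0.
by rewrite polyCD polyCM; apply: PD => //; exact: PM.
Qed.

Lemma derive_horner_line f x w (p : {poly R}) :
  (forall h, f (x + h *: w) = p.[h]) -> 'D_w f x = p^`().[0].
Proof.
move=> fp; rewrite derivE derive1E /derive.
apply: (congr1 (fun g : R -> R => lim (g @ 0^'))).
apply/funext => h; rewrite /= [h *: w + x]addrC fp addr0 [h *: 1]mulr1.
by have := fp 0; rewrite scale0r addr0 => ->.
Qed.

Lemma derive_affmap f F (c a b : R * R) w z :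
  (forall z, f (affmap c a b z) = F.[z.1, z.2]) ->
  'D_(w.1 *: a + w.2 *: b) f (affmap c a b z) =
  w.1 * F^`().[z.1, z.2] + w.2 * (dY F).[z.1, z.2].
Proof.
move=> fF; have [p [pE <-]] := bipoly_line F z w.
apply: derive_horner_line => h; rewrite pE -(fF (z.1 + h * w.1, z.2 + h * w.2)).
by congr f; apply: pair_eq; rewrite /affmap !coordE /=; ring.
Qed.
End polynomial_functions.

(** * Nondegeneracy and conformity of cells *)

Section mesh_geometry.
Context {R : realType} {V : finType} (M : mesh R V).
Notation p := (pos M).

Hypothesis card3 : forall P, P \in cells M -> #|P| = 3%N.
Hypothesis solid : forall P, P \in cells M -> (geom M P)° !=set0.
Hypothesis conforming : forall P Q, P \in cells M -> Q \in cells M -> P != Q ->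
  geom M P `&` geom M Q = geom M (P :&: Q)%SET.

Lemma fst_sum I (r : seq I) (P : pred I) (E : I -> R * R) :
  (\sum_(i <- r | P i) E i).1 = \sum_(i <- r | P i) (E i).1.
Proof. exact: (big_morph fst (fun _ _ => erefl) erefl). Qed.
Lemma snd_sum I (r : seq I) (P : pred I) (E : I -> R * R) :
  (\sum_(i <- r | P i) E i).2 = \sum_(i <- r | P i) (E i).2.
Proof. exact: (big_morph snd (fun _ _ => erefl) erefl). Qed.

Lemma cross_swap (x y : R * R) : cross x y = - cross y x.
Proof. by rewrite /cross; ring. Qed.

(** Otherwise some [n != 0] is orthogonal to both sides and the cell lies on a line; moving along
    the axes within a ball inside the cell forces [n = 0]. *)
Lemma cell_nondegenerate a b c : [set a; b; c]%SET \in cells M ->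
  a != b -> a != c -> b != c -> cross (p b - p a) (p c - p a) != 0.
Proof.
move=> PM ab ac bc; apply/negP => /eqP D0.
have [x /nbhs_ballP[e /= e0 be]] := solid PM.
have [n n0 nE] : exists2 n : R * R, n != 0 &
    dot n (p b - p a) = 0 /\ dot n (p c - p a) = 0.
  have perp (w : R * R) : dot (- w.2, w.1) w = 0 by rewrite /dot /=; ring.
  have [b0|b0] := eqVneq (p b - p a) 0; last first.
    exists (- (p b - p a).2, (p b - p a).1).
      apply: contra b0 => /eqP[/eqP]; rewrite oppr_eq0 => /eqP h2 h1.
      by apply/eqP/pair_eq.
    by split; [exact: perp | rewrite -D0 /dot /cross /=; ring].
  have [c0|c0] := eqVneq (p c - p a) 0.
    exists (1, 0); first by apply/eqP => -[/eqP]; rewrite oner_eq0.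
    by rewrite b0 c0 /dot /= !mulr0 addr0.
  exists (- (p c - p a).2, (p c - p a).1).
    apply: contra c0 => /eqP[/eqP]; rewrite oppr_eq0 => /eqP h2 h1.
    by apply/eqP/pair_eq.
  by rewrite b0; split; [rewrite /dot /= !mulr0 addr0 | exact: perp].
have on y : ball x e y -> dot n (y - p a) = 0.
  move=> /be; rewrite /geom hull_set3// => -[z _ <-].
  have -> : dot n (affmap (p a) (p b - p a) (p c - p a) z - p a) =
    z.1 * dot n (p b - p a) + z.2 * dot n (p c - p a).
    by rewrite /dot affmapE !coordE; ring.
  by rewrite nE.1 nE.2 !mulr0 addr0.
have e2 : 0 < e / 2 by rewrite divr_gt0.
have bx : ball x e x by exact: ballxx.
have bx1 : ball x e (x.1 + e / 2, x.2).
  by split => /=; [rewrite /ball/= opprD addrA subrr sub0r normrN gtr0_norm//; lra | exact: ballxx].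
have bx2 : ball x e (x.1, x.2 + e / 2).
  by split => /=; [exact: ballxx | rewrite /ball/= opprD addrA subrr sub0r normrN gtr0_norm//; lra].
move: (on _ bx) (on _ bx1) (on _ bx2); rewrite /dot !coordE /= => h0 h1 h2.
have z r : r * (e / 2) = 0 -> r = 0.
  by move/eqP; rewrite mulf_eq0 (gt_eqF e2) orbF => /eqP.
case/eqP: n0; apply: pair_eq => /=; apply: z.
  by rewrite -[RHS]h1 -[LHS]addr0 -[X in _ + X]h0; ring.
by rewrite -[RHS]h2 -[LHS]addr0 -[X in _ + X]h0; ring.
Qed.

(* The open cones spanned at a common vertex by two cells do not overlap. *)
Lemma cones_disjoint P Q a b c b' c' (al be al' be' : R) :
  P \in cells M -> Q \in cells M -> P != Q ->
  P = [set a; b; c]%SET -> a != b -> a != c -> b != c ->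
  Q = [set a; b'; c']%SET -> a != b' -> a != c' -> b' != c' ->
  0 <= al -> 0 <= be -> 0 < al' -> 0 < be' ->
  al *: (p b - p a) + be *: (p c - p a) =
    al' *: (p b' - p a) + be' *: (p c' - p a) -> False.
Proof.
move=> PM QM PQ PE ab ac bc QE ab' ac' bc' al0 be0 al'0 be'0 E.
(* The factor [r] shrinks the common vector until its endpoint lies in both triangles. *)
pose r := (1 + al + be + al' + be')^-1.
have s0 : 0 < 1 + al + be + al' + be' by lra.
have r0 : 0 < r by rewrite invr_gt0.
have r1 (x y : R) : 0 <= x -> 0 <= y -> x + y <= al + be + (al' + be') ->
    [&& 0 <= r * x, 0 <= r * y & r * x + r * y <= 1].
  move=> x0 y0 xy; apply/and3P; split; try by apply: mulr_ge0 => //; exact: ltW.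
  by rewrite -mulrDr mulrC /r ler_pdivrMr// mul1r; lra.
pose y := affmap (p a) (p b' - p a) (p c' - p a) (r * al', r * be').
have yQ : geom M Q y.
  by rewrite /geom QE hull_set3//; exists (r * al', r * be') => //; apply: r1; lra.
have yP : geom M P y.
  rewrite /geom PE hull_set3//; exists (r * al, r * be); first by apply: r1; lra.
  rewrite /y !affmapE /= -!addrA -!scalerA -!scalerDr; congr (_ + _ *: _).
  exact: E.
(* By conformity the point is a combination of common vertices. If [b'] or [c'] is not common,
   [y - p a] is parallel to the other side of [Q], although it has positive components along
   both. *)
have : geom M (P :&: Q)%SET y by rewrite -conforming.
move=> [w [w0 w1 yE]].
have lin (n : R * R) : cross n (y - p a) =
    \sum_(k in (P :&: Q)%SET) w k * cross n (p k - p a).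
  have -> : y - p a = \sum_(k in (P :&: Q)%SET) w k *: (p k - p a).
    rewrite yE -[X in _ - X]scale1r -w1 scaler_suml -sumrB.
    by apply: eq_bigr => k _; rewrite scalerBr.
  rewrite /cross fst_sum snd_sum !mulr_sumr -sumrB.
  by apply: eq_bigr => k _; rewrite !coordE; ring.
have D' : cross (p b' - p a) (p c' - p a) != 0.
  by apply: cell_nondegenerate => //; rewrite -QE.
have yb : cross (p b' - p a) (y - p a) != 0.
  have -> : cross (p b' - p a) (y - p a) = r * be' * cross (p b' - p a) (p c' - p a).
    by rewrite /y affmapE /cross !coordE /=; ring.
  by rewrite !mulf_neq0// gt_eqF.
have yc : cross (p c' - p a) (y - p a) != 0.
  have -> : cross (p c' - p a) (y - p a) = - (r * al') * cross (p b' - p a) (p c' - p a).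
    by rewrite /y affmapE /cross !coordE /=; ring.
  by rewrite !mulf_neq0// oppr_eq0 mulf_neq0// gt_eqF.
have : ~~ ((b' \in P) && (c' \in P)).
  apply: contra PQ => /andP[b'P c'P]; rewrite eq_sym eqEcard !card3// leqnn andbT.
  apply/fintype.subsetP => k; rewrite QE !inE => /orP[/orP[]|] /eqP-> //.
  by rewrite PE !inE eqxx.
rewrite negb_and => /orP[bP|cP].
  case/eqP: yc; rewrite lin big1// => k; rewrite finset.in_setI QE !inE.
  case/andP=> kP /orP[/orP[]|] /eqP kE.
  - by rewrite kE subrr /cross /= !mulr0 subr0 mulr0.
  - by move: bP; rewrite -kE kP.
  - by rewrite kE /cross [X in _ - X]mulrC subrr mulr0.
case/eqP: yb; rewrite lin big1// => k; rewrite finset.in_setI QE !inE.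
case/andP=> kP /orP[/orP[]|] /eqP kE.
- by rewrite kE subrr /cross /= !mulr0 subr0 mulr0.
- by rewrite kE /cross [X in _ - X]mulrC subrr mulr0.
- by move: cP; rewrite -kE kP.
Qed.
End mesh_geometry.

(** * Shape regularity and the number of cells at a vertex *)

Section shape_and_packing.
Context {R : realType} {V : finType} (M : mesh R V).
Notation p := (pos M).
Implicit Types x y : R * R.

Hypothesis card3 : forall P, P \in cells M -> #|P| = 3%N.
Hypothesis solid : forall P, P \in cells M -> (geom M P)° !=set0.
Hypothesis conforming : forall P Q, P \in cells M -> Q \in cells M -> P != Q ->
  geom M P `&` geom M Q = geom M (P :&: Q)%SET.

Definition len x : R := Num.sqrt (dot x x).

Lemma dot_ge0 x : 0 <= dot x x.
Proof. by rewrite /dot -!expr2 addr_ge0 ?sqr_ge0. Qed.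

Lemma len_sqr x : len x ^+ 2 = dot x x.
Proof. by rewrite sqr_sqrtr ?dot_ge0. Qed.

Lemma len_ge0 x : 0 <= len x. Proof. exact: sqrtr_ge0. Qed.

Lemma len_gt0 x : x != 0 -> 0 < len x.
Proof.
move=> x0; rewrite sqrtr_gt0 lt_neqAle dot_ge0 andbT eq_sym /dot -!expr2.
rewrite paddr_eq0 ?sqr_ge0// !sqrf_eq0; apply: contra x0 => /andP[/eqP h1 /eqP h2].
by apply/eqP/pair_eq.
Qed.

Lemma coord_le_len x : `|x.1| <= len x /\ `|x.2| <= len x.
Proof.
by split; rewrite -sqrtr_sqr ler_sqrt ?dot_ge0// /dot -!expr2 ?lerDl ?lerDr sqr_ge0.
Qed.

Lemma lenZ (r : R) x : len (r *: x) = `|r| * len x.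
Proof.
rewrite /len (_ : dot _ _ = r ^+ 2 * dot x x); last by rewrite /dot !coordE; ring.
by rewrite sqrtrM ?sqr_ge0// sqrtr_sqr.
Qed.

Lemma lenN x : len (- x) = len x.
Proof. by rewrite /len (_ : dot _ _ = dot x x)// /dot !coordE; ring. Qed.

Lemma normr_cross_le x y : `|cross x y| <= (`|x.1| + `|x.2|) * len y.
Proof.
have [h1 h2] := coord_le_len y.
rewrite (le_trans (ler_normB _ _))// !normrM mulrDl lerD// ler_wpM2l//.
Qed.

(** With both apexes on the same side of the edge, the direction [(b - a) + e (d - a)] would, for
    small [e > 0], belong to both cones at [a]. *)
Lemma cells_opposite a b c d : [set a; b; c]%SET \in cells M ->
  [set a; b; d]%SET \in cells M -> [set a; b; c]%SET != [set a; b; d]%SET ->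
  a != b -> a != c -> b != c -> a != d -> b != d ->
  cross (p b - p a) (p c - p a) * cross (p b - p a) (p d - p a) < 0.
Proof.
move=> PM QM PQ ab ac bc ad bd.
have DP := cell_nondegenerate solid PM ab ac bc.
have DQ := cell_nondegenerate solid QM ab ad bd.
rewrite ltNge; apply/negP => pos.
set D := cross (p b - p a) (p c - p a) in DP pos.
pose be := cross (p b - p a) (p d - p a) / D.
pose al := cross (p d - p a) (p c - p a) / D.
have be0 : 0 < be.
  rewrite lt_neqAle eq_sym mulf_neq0 ?invr_eq0//=.
  have -> : be = D * cross (p b - p a) (p d - p a) / D ^+ 2 by rewrite /be; field.
  by rewrite divr_ge0// sqr_ge0.
have dE : p d - p a = al *: (p b - p a) + be *: (p c - p a).
  by apply: pair_eq; rewrite !coordE /al /be /D /cross !coordE;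
    move: DP; rewrite /D /cross !coordE => DP; field.
pose e := (1 + `|al|)^-1.
have s0 : 0 < 1 + `|al| by rewrite ltr_pwDl.
have e0 : 0 < e by rewrite invr_gt0.
have eal : 0 <= 1 + e * al.
  have : - (e * `|al|) <= e * al.
    by rewrite -mulrN (ler_wpM2l (ltW e0))//; have := ler_norm (- al); rewrite normrN; lra.
  have : e * `|al| <= 1 by rewrite /e mulrC ler_pdivrMr// mul1r lerDr.
  by lra.
apply: (cones_disjoint card3 solid conforming PM QM PQ (erefl _) ab ac bc (erefl _) ab ad bd
   eal (mulr_ge0 (ltW e0) (ltW be0)) ltr01 e0).
by rewrite dE; apply: pair_eq; rewrite !coordE; ring.
Qed.

Section shape.
Context (gamma : R).
Hypothesis reg : shape_regular gamma M.

(** The diameter is at least the side [b - a], while a disk in the triangle fits into the strip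
    between a side and the opposite vertex, of width [|D|] over that side. Shape regularity compares
    the two, with the strips of both sides at [a]. *)
Lemma edge_product_bound a b c : [set a; b; c]%SET \in cells M ->
  a != b -> a != c -> b != c ->
  let D := cross (p b - p a) (p c - p a) in
  len (p b - p a) * len (p b - p a) <= gamma * `|D| /\
  len (p b - p a) * len (p c - p a) <= gamma * `|D|.
Proof.
move=> PM ab ac bc D.
have D0 : D != 0 by exact: cell_nondegenerate.
have Dp : 0 < `|D| by rewrite normr_gt0.
set P := [set a; b; c]%SET in PM.
have hullE : geom M P = affmap (p a) (p b - p a) (p c - p a) @` reftri.
  by rewrite /geom hull_set3.
have vin (z : R * R) : reftri z -> geom M P (affmap (p a) (p b - p a) (p c - p a) z).
  by move=> zr; rewrite hullE; exists z.
have ain : geom M P (p a).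
  have := vin (0, 0); rewrite affmapE /= !scale0r !addr0; apply.
  by rewrite /reftri /= lexx addr0 ler01.
have bin : geom M P (p b).
  have := vin (1, 0); rewrite affmapE /= scale0r scale1r addr0 addrC subrK; apply.
  by rewrite /reftri /= ler01 lexx addr0 lexx.
have cin : geom M P (p c).
  have := vin (0, 1); rewrite affmapE /= scale0r scale1r addr0 addrC subrK; apply.
  by rewrite /reftri /= ler01 lexx add0r lexx.
have diam_ge x y : geom M P x -> geom M P y -> len (x - y) <= Defs.diam (geom M P).
  move=> xP yP; apply: ub_le_sup; last by exists x, y; split => //; rewrite edistE.
  (* The supremum in [diam] bounds its elements only once its set is known to be bounded. *)
  exists (Num.sqrt (2 * (dot (p b - p a) (p b - p a) + dot (p c - p a) (p c - p a)))).
  move=> d [x' [y' [+ + ->]]]; rewrite hullE => -[z zr <-] [z' zr' <-].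
  rewrite edistE ler_sqrt; last by rewrite mulr_ge0// addr_ge0// dot_ge0.
  set B := p b - p a; set C := p c - p a.
  pose s := z.1 - z'.1; pose t := z.2 - z'.2.
  have -> : affmap (p a) B C z - affmap (p a) B C z' = s *: B + t *: C.
    by apply: pair_eq; rewrite !affmapE !coordE /s /t; ring.
  have s1 : s ^+ 2 <= 1.
    by move: zr zr' => /and3P[? ? ?] /and3P[? ? ?]; rewrite /s; nra.
  have t1 : t ^+ 2 <= 1.
    by move: zr zr' => /and3P[? ? ?] /and3P[? ? ?]; rewrite /t; nra.
  have h : 2 * (s ^+ 2 * dot B B + t ^+ 2 * dot C C) - dot (s *: B + t *: C) (s *: B + t *: C)
     = dot (s *: B - t *: C) (s *: B - t *: C) by rewrite /dot !coordE; ring.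
  have := dot_ge0 (s *: B - t *: C); rewrite -h.
  have := ler_wpM2r (dot_ge0 B) s1; have := ler_wpM2r (dot_ge0 C) t1; lra.
have indiam_le (n : R * R) : (forall z, geom M P z -> 0 <= cross n (z - p a) / D <= 1) \/
     (forall z, geom M P z -> 0 <= - cross n (z - p a) / D <= 1) -> n != 0 ->
     indiam (geom M P) <= `|D| / len n.
  move=> hn n0; have ln := len_gt0 n0.
  apply: ge_sup.
    exists 0, (p a), 0; split => //; first by rewrite mulr0.
    move=> z /=; rewrite edistE => h; suff -> : z = p a by [].
    apply/eqP; rewrite -subr_eq0; apply/negPn/negP => /len_gt0.
    by rewrite ltNge h.
  move=> d [ct [r [r0 -> inP]]].
  (* For [s = r] and [s = - r] these are the ends of the diameter of the disk perpendicular to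
     [n]. *)
  have onb (s : R) : `|s| = r -> geom M P (ct + (s / len n) *: (- n.2, n.1)).
    move=> sr; apply: inP => /=; rewrite edistE [ct + _]addrC addrK.
    rewrite -/(len _) lenZ; have -> : len (- n.2, n.1) = len n.
      by rewrite /len /dot /= mulrNN addrC.
    by rewrite normrM normfV (ger0_norm (ltW ln)) divfK ?gt_eqF// sr.
  have P1 := onb r (ger0_norm r0).
  have P2 : geom M P (ct + (- r / len n) *: (- n.2, n.1)).
    by apply: onb; rewrite normrN ger0_norm.
  have key : cross n (ct + (r / len n) *: (- n.2, n.1) - p a) -
     cross n (ct + (- r / len n) *: (- n.2, n.1) - p a) = 2 * r * len n.
    transitivity (2 * r * dot n n / len n); last by rewrite -len_sqr; field; rewrite gt_eqF.
    by rewrite /cross /dot !coordE /=; ring.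
  rewrite ler_pdivlMr// -key.
  set u := cross _ _; set w := cross n (ct + (- r / len n) *: _ - p a).
  have bnd : `|u - w| / `|D| <= 1.
    rewrite -normfV -normrM mulrBl ler_norml.
    by case: hn => hn; move: (hn _ P1) (hn _ P2); rewrite -/u -/w => /andP[? ?] /andP[? ?];
      apply/andP; split; lra.
  by rewrite (le_trans (ler_norm _))//; move: bnd; rewrite ler_pdivrMr// mul1r.
have B0 : p b - p a != 0.
  by apply: contra D0 => /eqP E; rewrite /D E /cross /= !mul0r subrr.
have C0 : p c - p a != 0.
  by apply: contra D0 => /eqP E; rewrite /D E /cross /= !mulr0 subrr.
have iB : indiam (geom M P) <= `|D| / len (p b - p a).
  apply: indiam_le => //; left => z; rewrite hullE => -[[s t] /and3P[/= s0 t0 st] <-].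
  have -> : cross (p b - p a) (affmap (p a) (p b - p a) (p c - p a) (s, t) - p a) / D = t.
    transitivity (t * D / D); last by rewrite mulfK.
    by congr (_ / _); rewrite affmapE /D /cross !coordE /=; ring.
  by rewrite t0/=; lra.
have iC : indiam (geom M P) <= `|D| / len (p c - p a).
  apply: indiam_le => //; right => z; rewrite hullE => -[[s t] /and3P[/= s0 t0 st] <-].
  have -> : - cross (p c - p a) (affmap (p a) (p b - p a) (p c - p a) (s, t) - p a) / D = s.
    transitivity (s * D / D); last by rewrite mulfK.
    by congr (_ / _); rewrite affmapE /D /cross !coordE /=; ring.
  by rewrite s0/=; lra.
have dB := diam_ge _ _ bin ain.
have lB := len_gt0 B0; have lC := len_gt0 C0.
have regP := reg PM.
have indiam0 : 0 <= indiam (geom M P).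
  have [[_ ub]|nsup] := pselect (has_sup [set d | exists c r, [/\ 0 <= r, d = 2 * r &
      [set x | Defs.edist x c <= r] `<=` geom M P]]); last by rewrite /indiam sup_out.
  apply: ub_le_sup => //.
  exists (p a), 0; split => //; first by rewrite mulr0.
  move=> z /=; rewrite edistE => h; suff -> : z = p a by [].
  apply/eqP; rewrite -subr_eq0; apply/negPn/negP => /len_gt0.
  by rewrite ltNge h.
have g0 : 0 <= gamma.
  rewrite leNgt; apply/negP => g0.
  have : gamma * indiam (geom M P) <= 0 by rewrite nmulr_rle0.
  by move: (le_trans dB regP) lB; lra.
by split; rewrite -ler_pdivlMr// -mulrA (le_trans dB)// (le_trans regP)// ler_wpM2l.
Qed.
(** The vectors attached to the cells have coordinates in [[-2, 2]], and a grid of step [1 / (2 g)]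
    cuts that interval into about [8 g] pieces. *)
Definition packing_bound (g : R) : nat :=
  ((Num.truncn (8 * g)).+1 * (Num.truncn (8 * g)).+1)%N.

(* To a cell at [a] attach the sum of the unit vectors of its two sides at
   [a]; shape regularity keeps these vectors apart, as a vector close to that of
   [P] lies in the cone of [P]. *)
Lemma packing a :
  (#|[set P in cells M | a \in P]%SET| <= packing_bound gamma)%N.
Proof.
pose good (P : {set V}) (q : V * V) := [/\ P = [set a; q.1; q.2]%SET,
  a != q.1, a != q.2 & q.1 != q.2].
have /choice[f fP] (P : {set V}) : exists q, P \in cells M -> a \in P -> good P q.
  have [PM|] := boolP (P \in cells M); last by exists (a, a).
  have [aP|] := boolP (a \in P); last by exists (a, a).
  have : #|(P :\ a)%SET| = 2%N.
    by have := cardsD1 a P; rewrite aP card3// => -[].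
  move/eqP/cards2P => [b [c [bc E]]]; exists (b, c) => _ _.
  have : b \in (P :\ a)%SET by rewrite E !inE eqxx.
  have : c \in (P :\ a)%SET by rewrite E !inE eqxx orbT.
  rewrite !inE => /andP[ca _] /andP[ba _].
  split => //=; rewrite 1?eq_sym//.
  by rewrite -(finset.setD1K aP) E finset.setUA.
pose B P := p (f P).1 - p a; pose C P := p (f P).2 - p a.
pose m P := (len (B P))^-1 *: B P + (len (C P))^-1 *: C P.
have facts P : P \in cells M -> a \in P ->
    [/\ 0 < len (B P), 0 < len (C P), cross (B P) (C P) != 0 &
        len (B P) * len (C P) <= gamma * `|cross (B P) (C P)|].
  move=> PM aP; have [PE ab ac bc] := fP P PM aP.
  have PM' : [set a; (f P).1; (f P).2]%SET \in cells M by rewrite -PE.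
  have D0 := cell_nondegenerate solid PM' ab ac bc.
  have [_ h] := edge_product_bound PM' ab ac bc.
  split => //; apply: len_gt0.
    by apply: contra D0 => /eqP E; rewrite -/(B P) E /cross /= !mul0r subrr.
  by apply: contra D0 => /eqP E; rewrite -/(C P) E /cross /= !mulr0 subrr.
have unit_len x : 0 < len x -> len ((len x)^-1 *: x) = 1.
  by move=> x0; rewrite lenZ gtr0_norm ?invr_gt0// mulVf ?gt_eqF.
have m_bound P : P \in cells M -> a \in P ->
    0 <= (m P).1 + 2 <= 4 /\ 0 <= (m P).2 + 2 <= 4.
  move=> PM aP; have [B0 C0 _ _] := facts P PM aP.
  have [b1 b2] := coord_le_len ((len (B P))^-1 *: B P).
  have [c1 c2] := coord_le_len ((len (C P))^-1 *: C P).
  move: b1 b2 c1 c2; rewrite !unit_len// !ler_norml /m !coordD.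
  move=> /andP[? ?] /andP[? ?] /andP[? ?] /andP[? ?].
  by split; apply/andP; split; lra.
have apart P Q : P \in cells M -> a \in P -> Q \in cells M -> a \in Q ->
    `|(m Q - m P).1| * (2 * gamma) < 1 -> `|(m Q - m P).2| * (2 * gamma) < 1 -> P = Q.
  move=> PM aP QM aQ h1 h2; apply/eqP/negPn/negP => PQ.
  have [B0 C0 D0 DP] := facts P PM aP; have [B0' C0' _ _] := facts Q QM aQ.
  have Dn : 0 < `|cross (B P) (C P)| by rewrite normr_gt0.
  have g0 : 0 < gamma.
    by rewrite -(pmulr_lgt0 _ Dn) (lt_le_trans _ DP)// mulr_gt0.
  set b := (len (B P))^-1 *: B P; set c := (len (C P))^-1 *: C P.
  have bcE : cross b c = cross (B P) (C P) / (len (B P) * len (C P)).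
    by rewrite /cross !coordZ; field; rewrite !gt_eqF.
  have bc0 : cross b c != 0.
    by rewrite bcE mulf_neq0// invr_eq0 mulf_neq0// gt_eqF.
  (* The sine of the angle of [P] at [a] is at least [1 / gamma]. *)
  have bcg : 1 <= gamma * `|cross b c|.
    rewrite bcE normrM normfV (gtr0_norm (mulr_gt0 B0 C0)) mulrA.
    by rewrite ler_pdivlMr ?mulr_gt0// mul1r.
  have small w : len w = 1 -> `|cross (m Q - m P) w / cross b c| < 1.
    move=> w1; rewrite normrM normfV ltr_pdivrMr ?normr_gt0// mul1r.
    have := normr_cross_le (m Q - m P) w; rewrite w1 mulr1 => h.
    rewrite -(ltr_pM2l g0) (lt_le_trans _ bcg)//.
    by rewrite (le_lt_trans (ler_wpM2l (ltW g0) h))//; lra.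
  (* Coefficients of [m Q] in the basis [b], [c] by Cramer's rule; those of [m P = b + c] are both
     [1], so a perturbation below [1] keeps them positive. *)
  pose al := 1 + cross (m Q - m P) c / cross b c.
  pose be := 1 - cross (m Q - m P) b / cross b c.
  have al0 : 0 < al.
    by have := small c (unit_len _ C0); rewrite ltr_norml => /andP[? _]; rewrite /al; lra.
  have be0 : 0 < be.
    by have := small b (unit_len _ B0); rewrite ltr_norml => /andP[_ ?]; rewrite /be; lra.
  have mQ : m Q = al *: b + be *: c.
    have : m P = b + c by [].
    clear bcE small al0 be0.
    rewrite /al /be; clearbody b c; move: (m P) (m Q) bc0 => mP mQ + ->.
    rewrite /cross => n0.
    by apply: pair_eq; rewrite !coordE; field.
  have [PE ab ac bc] := fP P PM aP; have [QE ab' ac' bc'] := fP Q QM aQ.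
  apply: (@cones_disjoint _ _ _ card3 solid conforming P Q a _ _ _ _
    (al / len (B P)) (be / len (C P)) (len (B Q))^-1 (len (C Q))^-1
    PM QM PQ PE ab ac bc QE ab' ac' bc').
  - by rewrite divr_ge0// ltW.
  - by rewrite divr_ge0// ltW.
  - by rewrite invr_gt0.
  - by rewrite invr_gt0.
  - by rewrite -!scalerA -/(B P) -/(C P) -/b -/c -mQ.
pose tr (x : R) := Num.truncn ((x + 2) * (2 * gamma)).
set N := (Num.truncn (8 * gamma)).+1.
pose code P : 'I_N * 'I_N := (inord (tr (m P).1), inord (tr (m P).2)).
suff inj : {in [set P in cells M | a \in P]%SET &, injective code}.
  rewrite (leq_trans (leq_card_in _ _ inj))// card_prod card_ord//.
move=> P Q; rewrite !inE => /andP[PM aP] /andP[QM aQ] [/(congr1 val)+ /(congr1 val)].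
have g0 : 0 < gamma.
  have [B0 C0 D0 DP] := facts P PM aP.
  have Dn : 0 < `|cross (B P) (C P)| by rewrite normr_gt0.
  by rewrite -(pmulr_lgt0 _ Dn) (lt_le_trans _ DP)// mulr_gt0.
have trN (x : R) : 0 <= x + 2 <= 4 -> (tr x < N)%N.
  move=> /andP[x0 x4]; rewrite ltnS le_truncn//.
  by rewrite (_ : 8 * gamma = 4 * (2 * gamma)); [rewrite ler_wpM2r// mulr_ge0// ltW | ring].
have [m1 m2] := m_bound P PM aP; have [m1' m2'] := m_bound Q QM aQ.
rewrite /= !inordK ?trN// => e1 e2.
have near_eq (x y : R) : 0 <= x + 2 <= 4 -> 0 <= y + 2 <= 4 -> tr x = tr y ->
    `|y - x| * (2 * gamma) < 1.
  move=> /andP[x0 _] /andP[y0 _] xy.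
  have g2 : 0 <= 2 * gamma by lra.
  have /andP[] := truncn_itv (mulr_ge0 x0 g2); have /andP[] := truncn_itv (mulr_ge0 y0 g2).
  rewrite -/(tr x) -/(tr y) xy => ya yb xa xb.
  rewrite -(ger0_norm g2) -normrM ltr_norml; apply/andP; split.
    by rewrite -natr1 in xb yb; lra.
  by rewrite -natr1 in xb yb; lra.
by apply: apart => //; rewrite coordD coordN; exact: near_eq.
Qed.
End shape.
End shape_and_packing.

(** * Sums along cycles and chains *)

Section cyclic_sums.
Context {R : realType}.

(** Telescoping along the orbit, whose points are distinct and keep the label of [t], so each
    increment is counted at most once. *)
Lemma orbit_variation (T : finType) (f : T -> T) (L : eqType) (lab : T -> L)
    (Y : T -> R) (t u : T) : injective f -> (forall t, lab (f t) = lab t) ->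
  fconnect f t u ->
  `|Y u - Y t| <= \sum_(w | lab w == lab t) `|Y (f w) - Y w|.
Proof.
move=> finj flab tu; rewrite -(iter_findex tu).
have := findex_max tu; move: (findex f t u) => n nt.
have labn m : lab (iter m f t) = lab t by elim: m => //= m <-.
have : `|Y (iter n f t) - Y t| <= \sum_(w <- traject f t n) `|Y (f w) - Y w|.
  elim: n {nt} => [|n IH]; first by rewrite subrr normr0 big_nil.
  rewrite trajectSr -cats1 big_cat big_seq1/=.
  have -> : Y (f (iter n f t)) - Y t =
    (Y (f (iter n f t)) - Y (iter n f t)) + (Y (iter n f t) - Y t) by ring.
  by rewrite (le_trans (ler_normD _ _))// addrC lerD.
move/le_trans; apply.
have un : uniq (traject f t n).
  have := orbit_uniq f t; rewrite /orbit.
  by rewrite -(subnKC (ltnW nt)) trajectD cat_uniq => /andP[].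
rewrite big_uniq//= [leLHS]big_mkcond [leRHS]big_mkcond/=.
apply: ler_sum => w _; case: ifP => [/trajectP[m _ ->]|_]; first by rewrite labn eqxx.
by case: ifP.
Qed.

(** The value [ka] of [Y] at the root of the orbit may be subtracted, since the increments of [Z]
    add up to zero over each cycle. The rest of [Y] is bounded by its increments in a label class of
    at most [n] points, and Young's inequality separates the products. *)
Lemma cyclic_sum_perm (T : finType) (f : T -> T) (L : eqType) (lab : T -> L)
    (Y Z : T -> R) (n : nat) : injective f -> (forall t, lab (f t) = lab t) ->
  (forall t, (#|[pred u | lab u == lab t]| <= n)%N) ->
  `|\sum_t Y t * (Z (f t) - Z t)| <=
    n%:R * \sum_t ((Y (f t) - Y t) ^+ 2 + (Z (f t) - Z t) ^+ 2).
Proof.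
move=> finj flab labn.
pose ka t := Y (froot f t).
have kaf t : ka (f t) = ka t.
  by congr Y; apply/eqP; rewrite (root_connect (fconnect_sym finj)) fconnect_sym// fconnect1.
have -> : \sum_t Y t * (Z (f t) - Z t) = \sum_t (Y t - ka t) * (Z (f t) - Z t).
  apply/eqP; rewrite -subr_eq0 -sumrB; apply/eqP.
  transitivity (\sum_t (ka (f t) * Z (f t) - ka t * Z t)).
    by apply: eq_bigr => t _; rewrite kaf; ring.
  by rewrite sumrB [X in _ - X](reindex_inj finj) subrr.
pose D (W : T -> R) t := W (f t) - W t.
have step t : `|(Y t - ka t) * D Z t| <=
    \sum_(w | lab w == lab t) (D Y w ^+ 2 + D Z t ^+ 2) / 2.
  rewrite normrM distrC.
  have := orbit_variation Y finj flab (connect_root (frel f) t).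
  move/(ler_wpM2r (normr_ge0 (D Z t)))/le_trans; apply.
  rewrite mulr_suml; apply: ler_sum => w _.
  rewrite -[D Y w ^+ 2]real_normK ?num_real// -[D Z t ^+ 2]real_normK ?num_real//.
  by have := sqr_ge0 (`|D Y w| - `|D Z t|); rewrite sqrrB /D; lra.
rewrite (le_trans (ler_norm_sum _ _ _))// (le_trans (ler_sum _ (fun t _ => step t)))//.
under eq_bigr do rewrite -mulr_suml big_split /=.
rewrite -mulr_suml big_split /= ler_pdivrMr// mulrC mulrA.
have symm (a : T -> R) : \sum_t \sum_(w | lab w == lab t) a w ^+ 2 <= n%:R * \sum_t a t ^+ 2.
  rewrite (exchange_big_dep predT)//= mulr_sumr; apply: ler_sum => w _.
  rewrite sumr_const -[leLHS]mulr_natl ler_wpM2r ?sqr_ge0// ler_nat.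
  rewrite (leq_trans _ (labn w))// subset_leq_card//.
  by apply/fintype.subsetP => u; rewrite !inE eq_sym.
have same (a : T -> R) : \sum_t \sum_(w | lab w == lab t) a t ^+ 2 <= n%:R * \sum_t a t ^+ 2.
  rewrite mulr_sumr; apply: ler_sum => w _.
  by rewrite sumr_const -[leLHS]mulr_natl ler_wpM2r ?sqr_ge0// ler_nat; exact: labn.
rewrite big_split /=; have := symm (D Y); have := same (D Z).
have h (a : T -> R) : 0 <= n%:R * \sum_t a t ^+ 2 :> R by rewrite mulr_ge0 ?ler0n// sumr_ge0// => i _; exact: sqr_ge0.
have := h (D Y); have := h (D Z); rewrite /D; lra.
Qed.

(* A chain whose ends carry the value 0 is closed into a cycle by running back
   through it with the value 0. *)
Lemma cyclic_sum (T : finType) (next prev : T -> option T) (L : eqType)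
    (lab : T -> L) (y0 y1 x0 x1 : T -> R) (n : nat) :
  (forall t u, next t = Some u <-> prev u = Some t) ->
  (forall t u, next t = Some u -> [/\ lab u = lab t, y0 u = x0 t & y1 u = x1 t]) ->
  (forall t, next t = None -> x0 t = 0 /\ x1 t = 0) ->
  (forall t, prev t = None -> y0 t = 0 /\ y1 t = 0) ->
  (forall t, (#|[pred u | lab u == lab t]| <= n)%N) ->
  `|\sum_t y0 t * (x1 t - y1 t)| <=
    (2 * n)%:R * \sum_t ((x0 t - y0 t) ^+ 2 + (x1 t - y1 t) ^+ 2).
Proof.
move=> np nextP next0 prev0 labn.
(* The flag [true] marks the forward passage and [false] the way back; it flips at the ends of a
   chain. Labels are kept, so the classes double in size, whence [2 * n]. *)
pose f (w : T * bool) : T * bool := if w.2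
  then (if next w.1 is Some u then (u, true) else (w.1, false))
  else (if prev w.1 is Some u then (u, false) else (w.1, true)).
have finj : injective f.
  have np' t u : prev u = Some t -> next t = Some u by move/np.
  move=> [t b] [u c]; rewrite /f /=.
  case: b; case: c.
  - case E : (next t) => [t'|]; case E' : (next u) => [u'|]// -[] h.
      by move: E E'; rewrite h => /np + /np; move=> -> [->].
    by rewrite h.
  - case E : (next t) => [t'|]; case E' : (prev u) => [u'|]// -[] h.
      by move: E; rewrite h => /np; rewrite E'.
    by move/np' : E'; rewrite -h E.
  - case E : (prev t) => [t'|]; case E' : (next u) => [u'|]// -[] h.
      by move/np' : E; rewrite h E'.
    by move: E'; rewrite -h => /np; rewrite E.
  - case E : (prev t) => [t'|]; case E' : (prev u) => [u'|]// -[] h.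
      by move: E E'; rewrite h => /np' + /np'; move=> -> [->].
    by rewrite h.
pose ext (y : T -> R) (w : T * bool) := if w.2 then y w.1 else 0.
have extE (y x : T -> R) : (forall t u, next t = Some u -> y u = x t) ->
    (forall t, next t = None -> x t = 0) -> (forall t, prev t = None -> y t = 0) ->
    forall w, ext y (f w) - ext y w = if w.2 then x w.1 - y w.1 else 0.
  move=> h1 h2 h3 [t []]; rewrite /f /ext /=.
    by case E : (next t) => [u|] /=; [rewrite (h1 _ _ E) | rewrite h2].
  by case E : (prev t) => [u|] /=; rewrite ?subr0// h3.
have E0 := extE y0 x0 (fun t u h => (let: And3 _ h0 _ := nextP t u h in h0))
  (fun t h => (next0 t h).1) (fun t h => (prev0 t h).1).
have E1 := extE y1 x1 (fun t u h => (let: And3 _ _ h1 := nextP t u h in h1))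
  (fun t h => (next0 t h).2) (fun t h => (prev0 t h).2).
have split_sum (F : T * bool -> R) : \sum_w F w = \sum_t (F (t, true) + F (t, false)).
  rewrite (eq_bigr (fun w => F (w.1, w.2))); last by move=> [].
  rewrite -(pair_bigA _ (fun t b => F (t, b))) /=; apply: eq_bigr => t _.
  by rewrite big_bool.
have S0 : \sum_w ext y0 w * (ext y1 (f w) - ext y1 w) = \sum_t y0 t * (x1 t - y1 t).
  by rewrite split_sum; apply: eq_bigr => t _; rewrite !E1 /ext /= mul0r addr0.
have S1 : \sum_w ((ext y0 (f w) - ext y0 w) ^+ 2 + (ext y1 (f w) - ext y1 w) ^+ 2)
    = \sum_t ((x0 t - y0 t) ^+ 2 + (x1 t - y1 t) ^+ 2).
  by rewrite split_sum; apply: eq_bigr => t _; rewrite !E0 !E1 /= !expr0n /= !addr0.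
have := @cyclic_sum_perm _ f _ (lab \o fst) (ext y0) (ext y1) (2 * n)%N finj.
rewrite S0 S1; apply.
- move=> [t []]; rewrite /f /=; first by case E : (next t) => [u|]//=; have [->] := nextP _ _ E.
  by case E : (prev t) => [u|]//=; move/np: E => /nextP[->].
- move=> [t b] /=; rewrite (@eq_card _ _ [predX [pred u | lab u == lab t] & predT]).
    by rewrite cardX mulnC card_bool leq_mul2l labn.
  by move=> [u c]; rewrite !inE /= andbT.
Qed.
End cyclic_sums.

(** * The barycentric refinement with labelled vertices *)

Lemma ord3_ind (Q : 'I_3 -> Prop) : Q 0 -> Q 1 -> Q (- 1) -> forall i, Q i.
Proof.
move=> q0 q1 q2 [[|[|[|//]]] h]; [move: q0 | move: q1 | move: q2];
  by congr (Q _); apply: val_inj.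
Qed.

Lemma ord3_sum (Z : nmodType) (f : 'I_3 -> Z) i :
  \sum_j f j = f i + (f (i + 1) + f (i - 1)).
Proof.
rewrite (reindex_inj (addrI i)) !big_ord_recl big_ord0 addr0 /=.
congr (_ + (_ + _)); first by apply: (congr1 f); congr (_ + _); apply: val_inj.
by rewrite addr0; apply: (congr1 f); congr (_ + _); apply: val_inj.
Qed.

Lemma ord3_neq (i : 'I_3) :
  [/\ i + 1 != i, i - 1 != i, i - 1 != i + 1 & i + 1 + 1 = i - 1].
Proof. by elim/ord3_ind: i; split; rewrite -?val_eqE//; apply: val_inj. Qed.

Lemma ord3_case (i j : 'I_3) : [\/ j = i, j = i + 1 | j = i - 1].
Proof.
have := ord3_sum (fun l => nat_of_bool (l == j)) i.
rewrite (bigD1 j)//= eqxx big1 => [|l /negPf->//].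
case: (eqVneq i j) => [->|_]; first by constructor 1.
case: (eqVneq (i + 1) j) => [->|_]; first by constructor 2.
by case: (eqVneq (i - 1) j) => [->|_]//; constructor 3.
Qed.

Lemma sides_set3 (W : finType) (a b c : W) (e : {set W}) :
  a != b -> a != c -> b != c ->
  (e \in sides [set a; b; c]%SET) =
  [|| e == [set a; b]%SET, e == [set a; c]%SET | e == [set b; c]%SET].
Proof.
move=> ab ac bc; rewrite !inE; apply/andP/or3P.
  move=> [/fintype.subsetP sub /cards2P[x [y [xy E]]]].
  have := sub x; have := sub y; rewrite E !inE !eqxx !orbT => /(_ erefl) yK /(_ erefl) xK.
  move: xy; case/orP: xK => [/orP[]|] /eqP->; case/orP: yK => [/orP[]|] /eqP->;
    rewrite ?eqxx// => _; rewrite 1?[[set b; a]%SET]finset.setUC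
      1?[[set c; a]%SET]finset.setUC 1?[[set c; b]%SET]finset.setUC;
    by [constructor 1 | constructor 2 | constructor 3].
by case=> /eqP->; rewrite cards2 ?ab ?ac ?bc; split => //;
  apply/fintype.subsetP => x; rewrite !inE => /orP[]/eqP->; rewrite eqxx ?orbT.
Qed.

(* [vert P] lists the vertices of the cell [P] counterclockwise; indices are
   taken modulo 3. *)
Record labelled_mesh (R : realType) (V : finType) (M : mesh R V)
    (vert : {set V} -> 'I_3 -> V) : Prop := LabelledMesh {
  labelled_solid : forall P, P \in cells M -> (geom M P)° !=set0;
  labelled_conforming : forall P Q, P \in cells M -> Q \in cells M -> P != Q ->
    geom M P `&` geom M Q = geom M (P :&: Q)%SET;
  labelled_card3 : forall P, P \in cells M -> #|P| = 3%N;
  vert_inj : forall P, P \in cells M -> injective (vert P);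
  vert_set : forall P, P \in cells M ->
    P = [set vert P 0; vert P 1; vert P (- 1)]%SET;
  vert_pos : forall P, P \in cells M ->
    0 < cross (pos M (vert P 1) - pos M (vert P 0))
              (pos M (vert P (- 1)) - pos M (vert P 0)) }.

Section refined_mesh.
Context {R : realType} {V : finType} (M : mesh R V) (vert : {set V} -> 'I_3 -> V).
Notation p := (pos M).
Notation W := (V + {set V})%type.
Implicit Types (P Q : {set V}) (i j : 'I_3) (e K : {set W}).

Hypothesis G : labelled_mesh M vert.
Let card3 := labelled_card3 G.
Let solid := labelled_solid G.
Let conforming := labelled_conforming G.
Let vert_inj := vert_inj G.
Let vert_set := vert_set G.
Let vert_pos := vert_pos G.

Definition cen P : R * R := centroid p P.
Definition arm P i : R * R := p (vert P i) - cen P.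
Definition jac P : R := cross (arm P 0) (arm P 1).
(** Spoke [i] is shared by the sub-cells [i] and [i - 1] of [P], with indices modulo 3, while rim
    [i] is the primal side of sub-cell [i]. *)
Definition subcell P i : {set W} :=
  [set inr P; inl (vert P i); inl (vert P (i + 1))]%SET.
Definition spoke P i : {set W} := [set inr P; inl (vert P i)]%SET.
Definition rim P i : {set W} := [set inl (vert P i); inl (vert P (i + 1))]%SET.

Lemma vert_neq P i : P \in cells M -> [/\ vert P i != vert P (i + 1),
  vert P i != vert P (i - 1) & vert P (i + 1) != vert P (i - 1)].
Proof.
move=> PM; have [h1 h2 h3 _] := ord3_neq i.
by split; rewrite (inj_eq (vert_inj PM)) 1?eq_sym.
Qed.

Lemma vert_set_cyc P i : P \in cells M ->
  P = [set vert P i; vert P (i + 1); vert P (i - 1)]%SET.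
Proof.
move=> PM; rewrite {1}(vert_set PM); apply/finset.setP => a; rewrite !inE.
elim/ord3_ind: i; rewrite ?add0r ?addrN ?addNr//.
  rewrite (_ : 1 + 1 = -1 :> 'I_3); last exact: val_inj.
  by case: (a == vert P 0); case: (a == vert P 1); case: (a == vert P (- 1)).
rewrite (_ : -1 - 1 = 1 :> 'I_3); last exact: val_inj.
by case: (a == vert P 0); case: (a == vert P 1); case: (a == vert P (- 1)).
Qed.

Lemma mem_vert P i : P \in cells M -> vert P i \in P.
Proof. by move=> PM; rewrite {2}(vert_set_cyc i PM) !inE eqxx. Qed.

Lemma arm_sum P i : P \in cells M -> arm P i + (arm P (i + 1) + arm P (i - 1)) = 0.
Proof.
move=> PM; rewrite /arm /cen /centroid card3//.
have -> : \sum_(a in P) p a = p (vert P i) + (p (vert P (i + 1)) + p (vert P (i - 1))).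
  have [h1 h2 h3] := vert_neq i PM.
  rewrite {1}(vert_set_cyc i PM) -finset.setUA big_setU1; last by rewrite !inE negb_or h1.
  by rewrite big_setU1 ?inE// big_set1.
by apply: pair_eq; rewrite !coordE /=; field.
Qed.

Lemma armB P i : P \in cells M -> arm P (i - 1) = - arm P i - arm P (i + 1).
Proof. by move=> /(arm_sum i) h; rewrite -opprD; apply/eqP; rewrite -addr_eq0 addrC -addrA h. Qed.

Lemma cross_arm P i : P \in cells M -> cross (arm P i) (arm P (i + 1)) = jac P.
Proof.
move=> PM; have h := armB 0 PM; rewrite /jac; move: h; rewrite !add0r => h.
elim/ord3_ind: i; first by rewrite add0r.
  rewrite (_ : 1 + 1 = -1 :> 'I_3); last exact: val_inj.
  by rewrite h /cross !coordE; ring.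
by rewrite addNr h /cross !coordE; ring.
Qed.

Lemma cross_verts P i : P \in cells M ->
  cross (p (vert P (i + 1)) - p (vert P i)) (p (vert P (i - 1)) - p (vert P i)) = 3 * jac P.
Proof.
move=> PM; rewrite -(cross_arm i PM).
have e j : p (vert P j) = cen P + arm P j by rewrite /arm addrC subrK.
by rewrite !e armB// /cross !coordE; ring.
Qed.

Lemma jac_gt0 P : P \in cells M -> 0 < jac P.
Proof.
by move=> PM; have := vert_pos PM; have := cross_verts 0 PM; rewrite !add0r => ->; rewrite pmulr_rgt0.
Qed.

(** Both cells are counterclockwise, so two distinct ones would lie on the same side of the common
    directed edge, against [cells_opposite]. *)
Lemma directed_unique P Q i j : P \in cells M -> Q \in cells M ->
  vert P i = vert Q j -> vert P (i + 1) = vert Q (j + 1) -> P = Q /\ i = j.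
Proof.
move=> PM QM h1 h2; have [E|PQ] := eqVneq P Q.
  by move: h1 QM; rewrite -E => /(vert_inj PM).
have [p1 p2 p3] := vert_neq i PM; have [q1 q2 q3] := vert_neq j QM.
have PE := vert_set_cyc i PM; have QE := vert_set_cyc j QM.
rewrite -h1 -h2 in q2 q3 QE.
have PM' := PM; rewrite PE in PM'; have QM' := QM; rewrite QE in QM'.
have PQ' := PQ; rewrite PE QE in PQ'.
have := cells_opposite card3 solid conforming PM' QM' PQ' p1 p2 p3 q2 q3.
rewrite cross_verts// h1 h2 cross_verts//.
by rewrite ltNge !mulr_ge0// ltW// jac_gt0.
Qed.

Lemma subcell_distinct P i : P \in cells M -> [/\ inr P != inl (vert P i) :> W,
  inr P != inl (vert P (i + 1)) :> W & inl (vert P i) != inl (vert P (i + 1)) :> W].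
Proof. by move=> PM; split => //; rewrite (inj_eq (@inl_inj _ _)); have [] := vert_neq i PM. Qed.

Lemma mem_subcell P i j : P \in cells M ->
  (inl (vert P j) \in subcell P i) = (j != i - 1).
Proof.
move=> PM; rewrite !inE !(inj_eq (@inl_inj _ _)) !(inj_eq (vert_inj PM)) /=.
have [h1 h2 h3 _] := ord3_neq i.
case: (ord3_case i j) => ->.
- by rewrite eqxx/= eq_sym h2.
- by rewrite (negPf h1) eqxx/= eq_sym h3.
- by rewrite (negPf h2) (negPf h3) eqxx.
Qed.
Lemma inr_subcell P Q i : (inr Q \in subcell P i) = (Q == P).
Proof. by rewrite !inE orbF orbF. Qed.

Lemma subcell_inj P Q i j : P \in cells M -> Q \in cells M ->
  subcell P i = subcell Q j -> P = Q /\ i = j.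
Proof.
move=> PM QM E; have : inr P \in subcell Q j by rewrite -E inr_subcell.
rewrite inr_subcell => /eqP PQ; subst Q; split => //.
have := mem_subcell j (i - 1) PM; rewrite -E (mem_subcell _ _ PM) eqxx.
by move/esym/negbFE/eqP/addIr.
Qed.

Lemma spoke_inj P Q i j : P \in cells M -> spoke P i = spoke Q j -> P = Q /\ i = j.
Proof.
move=> PM E; have : inr P \in spoke Q j by rewrite -E !inE eqxx.
rewrite !inE orbF => /eqP[PQ]; subst Q; split => //.
have : inl (vert P i) \in spoke P j by rewrite -E !inE eqxx orbT.
by rewrite !inE /= => /eqP[/(vert_inj PM)].
Qed.

Lemma sides_subcell P i e : P \in cells M -> (e \in sides (subcell P i)) =
  [|| e == spoke P i, e == spoke P (i + 1) | e == rim P i].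
Proof. by move=> PM; have [h1 h2 h3] := subcell_distinct i PM; rewrite sides_set3. Qed.

Lemma mem_refine K : reflect (exists2 P, P \in cells M & exists i, K = subcell P i)
  (K \in cells (refine M)).
Proof.
apply: (iffP bigcupP) => [[P PM /imsetP[e eP ->]]|[P PM [i ->]]].
  exists P => //; move: eP; have [h1 h2 h3] := vert_neq 0 PM.
  rewrite {1}(vert_set_cyc 0 PM) sides_set3// => /or3P[]/eqP->;
    rewrite imsetU1 imset_set1.
  - by exists 0; rewrite /subcell finset.setUA.
  - exists (0 - 1); rewrite /subcell subrK -finset.setUA; congr (_ |: _)%SET.
    exact: finset.setUC.
  - by exists (0 + 1); rewrite /subcell finset.setUA; have [_ _ _ ->] := ord3_neq 0.
exists P => //; apply/imsetP; exists [set vert P i; vert P (i + 1)]%SET.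
  by have [h1 h2 h3] := vert_neq i PM; rewrite [X in sides X](vert_set_cyc i PM) sides_set3// eqxx.
by rewrite imsetU1 imset_set1 finset.setUA.
Qed.

Lemma sum_pairs (Z : nmodType) (h : {set V} -> 'I_3 -> {set W}) (F : {set W} -> Z) :
  (forall P Q i j, P \in cells M -> Q \in cells M -> h P i = h Q j -> P = Q /\ i = j) ->
  \sum_(K in [set h x.1 x.2 | x in [set x : {set V} * 'I_3 | x.1 \in cells M]]%SET) F K =
  \sum_(P in cells M) \sum_i F (h P i).
Proof.
move=> hinj; rewrite big_imset /=.
  rewrite pair_big /=; apply: eq_bigl => x; rewrite !inE andbT//.
move=> [P i] [Q j]; rewrite !inE /= => PM QM E.
by have [-> ->] := hinj _ _ _ _ PM QM E.
Qed.

Lemma sum_refine (Z : nmodType) (F : {set W} -> Z) :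
  \sum_(K in cells (refine M)) F K = \sum_(P in cells M) \sum_i F (subcell P i).
Proof.
rewrite -sum_pairs; last by move=> *; exact: subcell_inj.
apply: eq_bigl => K; apply/mem_refine/imsetP => [[P PM [i ->]]|[[P i]]].
  by exists (P, i) => //; rewrite !inE PM.
by rewrite !inE /= => PM ->; exists P => //; exists i.
Qed.

Lemma mem_primal e : reflect (exists2 P, P \in cells M & exists i, e = rim P i)
  (e \in primal_edges M).
Proof.
apply: (iffP imsetP) => [[f /bigcupP[P PM fP] ->]|[P PM [i ->]]].
  exists P => //; move: fP; have [h1 h2 h3] := vert_neq 0 PM.
  rewrite {1}(vert_set_cyc 0 PM) sides_set3// => /or3P[]/eqP->;
    rewrite imsetU1 imset_set1.
  - by exists 0.
  - by exists (0 - 1); rewrite /rim subrK finset.setUC.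
  - by exists (0 + 1); rewrite /rim; have [_ _ _ ->] := ord3_neq 0.
exists [set vert P i; vert P (i + 1)]%SET; last by rewrite imsetU1 imset_set1.
apply/bigcupP; exists P => //.
by have [h1 h2 h3] := vert_neq i PM; rewrite [X in sides X](vert_set_cyc i PM) sides_set3// eqxx.
Qed.

Lemma rim_primal P i : P \in cells M -> rim P i \in primal_edges M.
Proof. by move=> PM; apply/mem_primal; exists P => //; exists i. Qed.

Lemma spoke_not_primal P i : spoke P i \notin primal_edges M.
Proof.
apply/mem_primal => -[Q _ [j E]]; have : inr P \in rim Q j by rewrite -E !inE eqxx.
by rewrite !inE.
Qed.

Lemma rim_neq_spoke P Q i j : (rim P i == spoke Q j) = false.
Proof.
apply/eqP => E; have : inr Q \in rim P i by rewrite E !inE eqxx.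
by rewrite !inE.
Qed.

Lemma sum_dual (Z : nmodType) (F : {set W} -> Z) :
  \sum_(e in dual_edges M) F e = \sum_(P in cells M) \sum_i F (spoke P i).
Proof.
rewrite -sum_pairs; last by move=> P Q i j PM _; exact: spoke_inj.
apply: eq_bigl => e; rewrite finset.in_setD.
apply/andP/imsetP => [[ne /bigcupP[K /mem_refine[P PM [i ->]]]]|[[P i]]].
  rewrite sides_subcell// => /or3P[]/eqP eE.
  - by exists (P, i) => //; rewrite !inE PM.
  - by exists (P, i + 1) => //; rewrite !inE PM.
  - by move: ne; rewrite eE rim_primal.
rewrite !inE /= => PM ->; split; first exact: spoke_not_primal.
apply/bigcupP; exists (subcell P i); first by apply/mem_refine; exists P => //; exists i.
by rewrite sides_subcell// eqxx.
Qed.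

Lemma dualP e : e \in dual_edges M -> exists2 P, P \in cells M & exists i, e = spoke P i.
Proof.
rewrite finset.in_setD => /andP[ne /bigcupP[K /mem_refine[P PM [i ->]]]].
rewrite sides_subcell// => /or3P[]/eqP eE; exists P => //.
- by exists i.
- by exists (i + 1).
- by move: ne; rewrite eE rim_primal.
Qed.

Lemma sum_spoke (Z : nmodType) (F : {set W} -> Z) P i : P \in cells M ->
  \sum_(K in cells (refine M) | spoke P i \in sides K) F K =
  F (subcell P i) + F (subcell P (i - 1)).
Proof.
move=> PM; rewrite big_mkcondr sum_refine (bigD1 P)//= [X in _ + X]big1 ?addr0.
  have [h1 h2 h3 _] := ord3_neq i.
  have same j l : (spoke P j == spoke P l) = (j == l).
    by apply/eqP/eqP => [/(spoke_inj PM)[]//|->].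
  rewrite (ord3_sum _ i) !sides_subcell// eqxx /= subrK eqxx orbT /= !same.
  rewrite [_ == rim _ _]eq_sym rim_neq_spoke orbF ![i == _]eq_sym (negPf h1).
  have [_ _ h4 ->] := ord3_neq i; by rewrite (negPf h2) add0r.
move=> Q /andP[QM QP]; apply: big1 => j _; rewrite sides_subcell//.
rewrite [_ == rim _ _]eq_sym rim_neq_spoke orbF; case: ifP => // /orP[]/eqP/(spoke_inj PM)[E _];
  by rewrite E eqxx in QP.
Qed.

(** Each sub-cell has exactly one primal side, its rim. *)
Lemma sum_primal_sides (Z : nmodType) (F : {set W} -> {set W} -> Z) :
  \sum_(e in primal_edges M) \sum_(K in cells (refine M) | e \in sides K) F e K =
  \sum_(P in cells M) \sum_i F (rim P i) (subcell P i).
Proof.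
rewrite (exchange_big_dep (mem (cells (refine M))))/=; last by move=> ? ? _ /andP[].
rewrite sum_refine; apply: eq_bigr => P PM; apply: eq_bigr => i _.
have PiM : subcell P i \in cells (refine M) by apply/mem_refine; exists P => //; exists i.
rewrite (bigD1 (rim P i))/=; last by rewrite rim_primal// PiM sides_subcell// eqxx !orbT.
rewrite big1 ?addr0// => e /andP[/andP[ep /andP[_]]].
rewrite sides_subcell// => /or3P[]/eqP eE; last by rewrite eE eqxx.
  by move: ep; rewrite eE (negPf (spoke_not_primal _ _)).
by move: ep; rewrite eE (negPf (spoke_not_primal _ _)).
Qed.

(** Counterclockwise neighbours run through their common edge in opposite directions. *)
Definition opposite (t u : {set V} * 'I_3) : bool :=
  [&& t.1 \in cells M, u.1 \in cells M, vert u.1 u.2 == vert t.1 (t.2 + 1) &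
      vert u.1 (u.2 + 1) == vert t.1 t.2].

Lemma opposite_sym t u : opposite t u = opposite u t.
Proof.
rewrite /opposite; apply/and4P/and4P => -[h1 h2 /eqP h3 /eqP h4]; split => //; by rewrite ?h3 ?h4 eqxx.
Qed.

Lemma opposite_unique t u w : opposite t u -> opposite t w -> u = w.
Proof.
move=> /and4P[_ u1 /eqP u2 /eqP u3] /and4P[_ w1 /eqP w2 /eqP w3].
case: u w u1 u2 u3 w1 w2 w3 => [P i] [Q j] /= PM h1 h2 QM h3 h4.
by have [-> ->] := directed_unique PM QM (etrans h1 (esym h3)) (etrans h2 (esym h4)).
Qed.

Lemma sides_rim P i K : P \in cells M -> K \in cells (refine M) ->
  rim P i \in sides K -> K = subcell P i \/
  exists2 u, opposite (P, i) u & K = subcell u.1 u.2.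
Proof.
move=> PM /mem_refine[Q QM [j ->]]; rewrite sides_subcell// !rim_neq_spoke /= => /eqP E.
have : inl (vert P i) \in rim Q j by rewrite -E !inE eqxx.
have : inl (vert P (i + 1)) \in rim Q j by rewrite -E !inE eqxx orbT.
have [h1 _ _] := vert_neq i PM.
rewrite !inE !(inj_eq (@inl_inj _ _)) => /orP[]/eqP e1 /orP[]/eqP e2.
- by rewrite e1 e2 eqxx in h1.
- by right; exists (Q, j) => //; rewrite /opposite /= PM QM e1 e2 !eqxx.
- by left; have [-> ->] := directed_unique PM QM e2 e1.
- by rewrite e1 e2 eqxx in h1.
Qed.

Lemma opposite_side P i u : opposite (P, i) u ->
  [/\ subcell u.1 u.2 \in cells (refine M), rim P i = rim u.1 u.2 &
      subcell u.1 u.2 != subcell P i].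
Proof.
move=> /and4P[/= PM QM /eqP h1 /eqP h2]; split.
- by apply/mem_refine; exists u.1 => //; exists u.2.
- by rewrite /rim h1 h2 finset.setUC.
- apply/eqP => /(subcell_inj QM PM)[E F]; move: h2; rewrite E F => /(vert_inj PM)/eqP.
  by have [/negPf->] := ord3_neq i.
Qed.

Definition opp t : option ({set V} * 'I_3) := [pick u | opposite t u].

Lemma oppP t u : opp t = Some u <-> opposite t u.
Proof.
rewrite /opp; split; first by case: pickP => // w h [<-].
by case: pickP => [w h1 h2|h]; [rewrite (opposite_unique h1 h2) | rewrite h].
Qed.

(** The partial map [opp], completed by the identity, is an involution under which the sum changes
    sign. *)
Lemma sum_antisymmetric (T : {set V} * 'I_3 -> R) :
  (forall t u, opposite t u -> T u = - T t) ->
  (forall t, opp t = None -> T t = 0) -> \sum_t T t = 0.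
Proof.
move=> anti T0; pose f t := odflt t (opp t).
have fK : involutive f.
  move=> t; rewrite /f; case E : (opp t) => [u|] /=; last by rewrite E.
  by move/oppP : E; rewrite opposite_sym => /oppP->.
have : \sum_t T t = - \sum_t T t.
  rewrite {1}(reindex_inj (inv_inj fK)) -sumrN; apply: eq_bigr => t _.
  rewrite /f; case E : (opp t) => [u|] /=; first by apply: anti; exact/oppP.
  by rewrite T0// oppr0.
lra.
Qed.

(** The pair [(P, i)] stands for the corner of [P] at [vert P i]. Crossing rim [i] leads to the next
    corner at the same vertex, and the index is shifted because the neighbour runs through the edge
    backwards. *)
Definition next_at (t : {set V} * 'I_3) := omap (fun u => (u.1, u.2 + 1)) (opp t).
Definition prev_at (t : {set V} * 'I_3) := opp (t.1, t.2 - 1).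

Lemma next_prev_at t u : next_at t = Some u <-> prev_at u = Some t.
Proof.
rewrite /next_at /prev_at; split.
  case E : (opp t) => [w|]//= -[<-] /=; rewrite addrK -surjective_pairing.
  by apply/oppP; rewrite opposite_sym; apply/oppP.
by move/oppP; rewrite opposite_sym => /oppP -> /=; rewrite subrK -surjective_pairing.
Qed.
End refined_mesh.

(** * Normals, orientations and traces *)

Section normals_and_traces.
Context {R : realType}.
Implicit Types (x y w : R * R).

(* [w] turned clockwise, i.e. an outward normal to the side [w] of a
   counterclockwise triangle. *)
Definition perp w : R * R := (w.2, - w.1).

Lemma mdot0l (m n : nat) (A : 'M[R]_(m, n)) : mdot 0 A = 0.
Proof. by rewrite /mdot big1// => i _; rewrite big1// => j _; rewrite mxE mul0r. Qed.

Lemma vecZ (r : R) x : vec (r *: x) = r *: vec x.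
Proof. by apply/matrixP => i j; rewrite !mxE; case: ifP. Qed.

Lemma vec_surj (n : 'cV[R]_2) : n = vec (n 0 0, n 1 0).
Proof.
by apply/matrixP => i j; rewrite !mxE !ord1; case: i => [[|[|//]] h] /=; congr (n _ _); apply: val_inj.
Qed.

Lemma dot_perp (c : R) w x : dot (c *: perp w) x = - (c * cross w x).
Proof. by rewrite /dot !coordZ /cross /perp /=; ring. Qed.

Lemma perp_unique (n w : R * R) : dot n w = 0 -> dot w w != 0 ->
  n = (cross n w / dot w w) *: perp w.
Proof.
case: n w => [n1 n2] [w1 w2]; rewrite /dot /cross /= => nw l2.
have h1 : (n1 * w1 + n2 * w2) * w1 = 0 by rewrite nw mul0r.
have h2 : (n1 * w1 + n2 * w2) * w2 = 0 by rewrite nw mul0r.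
apply: pair_eq; rewrite coordE /=; apply: (mulIf l2); rewrite [RHS]mulrAC divfK//.
  by apply/eqP; rewrite -subr_eq0 -h1; apply/eqP; ring.
by apply/eqP; rewrite -subr_eq0 -h2; apply/eqP; ring.
Qed.

(** A unit vector orthogonal to [w] is [perp w / len w] up to a sign, which the orientation
    compensates. In the difference of the centroids the part along [w] is orthogonal to the normal,
    so the third vertex alone decides. *)
Lemma oriented_normal (U : finType) (N : mesh R U) (nu : {set U} -> 'cV[R]_2) (x y z : U) :
  x != y -> x != z -> y != z ->
  let e := [set x; y]%SET in let w := pos N y - pos N x in
  let D := cross w (pos N z - pos N x) in
  mdot (nu e) (nu e) = 1 ->
  (forall a b, geom N e a -> geom N e b -> mdot (nu e) (vec (a - b)) = 0) ->
  D != 0 ->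
  len w *: (orientation N nu [set x; y; z]%SET e *: nu e) = Num.sg D *: vec (perp w).
Proof.
move=> xy xz yz e w D nn nw D0.
have cenE : centroid (pos N) e - centroid (pos N) [set x; y; z]%SET =
   6^-1 *: w - 3^-1 *: (pos N z - pos N x).
  rewrite /centroid big_setU1 ?inE//= big_set1 cards2 xy.
  have -> : [set x; y; z]%SET = (x |: (y |: [set z]))%SET by rewrite finset.setUA.
  rewrite !cardsU1 !inE negb_or xy xz yz cards1 /=.
  rewrite big_setU1 ?inE ?negb_or ?xy ?xz//= big_setU1 ?inE//= big_set1.
  by apply: pair_eq; rewrite /w !coordE /=; field.
rewrite /orientation cenE.
have xe : geom N e (pos N x).
  by rewrite /geom hull_set2//; exists 0; [rewrite /= in_itv/= lexx ler01 | rewrite subr0 scale1r scale0r addr0].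
have ye : geom N e (pos N y).
  by rewrite /geom hull_set2//; exists 1; [rewrite /= in_itv/= lexx ler01 | rewrite subrr scale1r scale0r add0r].
have {nw} := nw _ _ ye xe; move: nn; rewrite -/w.
rewrite [nu e]vec_surj !mdot_vec; set n := (_, _) => nn nw.
have w0 : 0 < len w by apply: len_gt0; apply: contra D0 => /eqP E; rewrite /D E /cross /= !mul0r subrr.
have cr2 : cross n w ^+ 2 = len w ^+ 2.
  transitivity (dot n n * dot w w - dot n w ^+ 2); first by rewrite /cross /dot; ring.
  by rewrite nn nw expr0n subr0 mul1r len_sqr.
have nE : n = (cross n w / len w ^+ 2) *: perp w.
  by rewrite len_sqr; apply: perp_unique => //; rewrite -len_sqr expf_neq0// gt_eqF.
have -> : dot n (6^-1 *: w - 3^-1 *: (pos N z - pos N x)) =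
    cross n w * (D / (3 * len w ^+ 2)).
  transitivity (6^-1 * dot n w - 3^-1 * dot n (pos N z - pos N x)).
    by rewrite /dot !coordE; ring.
  have -> : dot n (pos N z - pos N x) = - (cross n w / len w ^+ 2 * D).
    by rewrite {1}nE /D dot_perp.
  by rewrite nw; field; rewrite gt_eqF.
rewrite sgrM sgrM (gtr0_sg (x := (3 * _)^-1)) ?invr_gt0 ?mulr_gt0 ?exprn_gt0// mulr1.
rewrite {2}nE vecZ !scalerA; congr (_ *: _).
have ac : `|cross n w| = len w.
  by apply/eqP; rewrite -(eqrXn2 (n:=2))// ?real_normK ?num_real ?cr2// ltW.
rewrite (_ : len w * _ * _ = len w * Num.sg D * (Num.sg (cross n w) * cross n w) / len w ^+ 2); last by ring.
by rewrite -normrEsg ac; field; rewrite gt_eqF.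
Qed.
End normals_and_traces.

Section normals_refined.
Context {R : realType} {V : finType} (M : mesh R V) (vert : {set V} -> 'I_3 -> V).
Notation p := (pos M).
Notation W := (V + {set V})%type.
Implicit Types (P Q : {set V}) (i j : 'I_3) (e K : {set W}).
Hypothesis G : labelled_mesh M vert.
Notation arm := (arm M vert).
Notation cen := (cen M).
Notation subcell := (subcell vert).
Notation spoke := (spoke vert).
Notation rim := (rim vert).
Context (Omega : set (R * R)) (nu : {set W} -> 'cV[R]_2).
Hypothesis Hnu : unit_normals Omega (refine M) nu.

Lemma subcell_refine P i : P \in cells M -> subcell P i \in cells (refine M).
Proof. by move=> PM; apply/(mem_refine G); exists P => //; exists i. Qed.

Lemma side_edge P i e : P \in cells M -> e \in sides (subcell P i) ->
  e \in edges (refine M).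
Proof. by move=> PM eP; apply/bigcupP; exists (subcell P i) => //; exact: subcell_refine. Qed.

Lemma vec_neq0 (w : R * R) : w != 0 -> vec (perp w) != 0.
Proof.
apply: contra => /eqP /matrixP h; apply/eqP; apply: pair_eq.
  by have := h 1 0; rewrite !mxE /= => /eqP; rewrite oppr_eq0 => /eqP.
by have := h 0 0; rewrite !mxE.
Qed.

Lemma arm_neq0 P i : P \in cells M -> arm P i != 0.
Proof.
move=> PM; have := jac_gt0 G PM; rewrite -(cross_arm G i PM).
by apply: contraTneq => ->; rewrite /cross /= !mul0r subrr ltxx.
Qed.

Lemma orientation_sqr K e (r : R) x : x != 0 ->
  r *: (orientation (refine M) nu K e *: nu e) = x -> orientation (refine M) nu K e ^+ 2 = 1.
Proof.
move=> x0; rewrite /orientation; set t := mdot _ _.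
have [->|t0] := eqVneq t 0; first by rewrite sgr0 scale0r scaler0 => /esym/eqP; rewrite (negPf x0).
by rewrite sqr_sg t0.
Qed.

Lemma orient_spoke P i : P \in cells M -> exists s l : R,
  [/\ s ^+ 2 = 1, orientation (refine M) nu (subcell P i) (spoke P i) = s,
      orientation (refine M) nu (subcell P (i - 1)) (spoke P i) = - s &
      nu (spoke P i) = l *: vec (perp (arm P i))].
Proof.
move=> PM.
have eE : spoke P i \in edges (refine M).
  by apply: (side_edge (i := i) PM); rewrite (sides_subcell G)// eqxx.
have [n1 nw _] := Hnu eE.
have [d1 d2 d3] := subcell_distinct G i PM; have [v1 v2 v3] := vert_neq G i PM.
have a0 := arm_neq0 i PM; have la := len_gt0 a0; have J0 := jac_gt0 G PM.
have h1 := oriented_normal (N := refine M) d1 d2 d3 n1 nw; move: h1; rewrite /= -/(subcell P i).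
rewrite -/(arm P i) -/(arm P (i + 1)) (cross_arm G)// => /(_ (lt0r_neq0 J0)).
rewrite gtr0_sg// scale1r => h1.
have h2 := oriented_normal (N := refine M) (z := inl (vert P (i - 1))) d1 isT _ n1 nw.
have v2' : inl (vert P i) != inl (vert P (i - 1)) :> W by rewrite (inj_eq (@inl_inj _ _)).
move: {h2} (h2 v2') => /=; rewrite -/(arm P i) -/(arm P (i - 1)).
have -> : [set inr P; inl (vert P i); inl (vert P (i - 1))]%SET = subcell P (i - 1).
  by rewrite /subcell subrK -!finset.setUA [X in (_ |: X)%SET]finset.setUC.
have -> : cross (arm P i) (arm P (i - 1)) = - jac M vert P.
  by rewrite (armB G)// -(cross_arm G i PM) /cross !coordE; ring.
rewrite oppr_eq0 => /(_ (lt0r_neq0 J0)); rewrite sgrN gtr0_sg// scaleN1r => h2.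
exists (orientation (refine M) nu (subcell P i) (spoke P i)),
  (orientation (refine M) nu (subcell P i) (spoke P i) / len (arm P i)).
have sq := orientation_sqr (vec_neq0 a0) h1.
split => //.
  have : len (arm P i) *: ((orientation (refine M) nu (subcell P i) (spoke P i) +
     orientation (refine M) nu (subcell P (i - 1)) (spoke P i)) *: nu (spoke P i)) = 0.
    by rewrite scalerDl scalerDr h1 h2 subrr.
  move/eqP; rewrite !scaler_eq0 (gt_eqF la) /= => /orP[/eqP E|/eqP E].
    by apply/eqP; rewrite -addr_eq0 addrC E.
  by move: n1; rewrite E mdot0l => /eqP; rewrite eq_sym oner_eq0.
rewrite -h1 !scalerA divfK ?gt_eqF// -expr2 sq scale1r//.
Qed.

Lemma orient_rim P i : P \in cells M ->
  let w := p (vert P (i + 1)) - p (vert P i) in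
  [/\ len w *: (orientation (refine M) nu (subcell P i) (rim P i) *: nu (rim P i)) = vec (perp w),
      orientation (refine M) nu (subcell P i) (rim P i) ^+ 2 = 1 &
      forall u, opposite M vert (P, i) u ->
      orientation (refine M) nu (subcell u.1 u.2) (rim P i) =
      - orientation (refine M) nu (subcell P i) (rim P i)].
Proof.
move=> PM w.
have main Q j : Q \in cells M -> let w := p (vert Q (j + 1)) - p (vert Q j) in w != 0 /\
    len w *: (orientation (refine M) nu (subcell Q j) (rim Q j) *: nu (rim Q j)) = vec (perp w).
  move=> QM {}w; have J0 := jac_gt0 G QM.
  have eE : rim Q j \in edges (refine M).
    by apply: (side_edge (i := j) QM); rewrite (sides_subcell G)// eqxx !orbT.
  have [n1 nw _] := Hnu eE; have [d1 d2 d3] := subcell_distinct G j QM.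
  have crE : cross w (cen Q - p (vert Q j)) = jac M vert Q.
    have aE l : arm Q l = p (vert Q l) - cen Q by [].
    by rewrite -(cross_arm G j QM) /w !aE /cross !coordE; ring.
  have h := oriented_normal (N := refine M) (z := inr Q) d3 isT isT n1 nw.
  move: h => /=; rewrite -/w -/(cen Q) crE => /(_ (lt0r_neq0 J0)).
  rewrite gtr0_sg// scale1r.
  have -> : [set inl (vert Q j); inl (vert Q (j + 1)); inr Q]%SET = subcell Q j.
    by rewrite finset.setUC finset.setUA.
  split => //; move: J0; rewrite -crE.
  by apply: contraTneq => ->; rewrite /cross /= !mul0r subrr ltxx.
have [w0 h] := main P i PM; have sq := orientation_sqr (vec_neq0 w0) h.
split => // -[Q j] opp; have [_ rE _] := opposite_side G opp.
have /and4P[/= _ QM /eqP e1 /eqP e2] := opp.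
have [_] := main Q j QM; rewrite -rE /= e1 e2.
have -> : p (vert P i) - p (vert P (i + 1)) = - w by rewrite opprB.
have -> : vec (perp (- w)) = - vec (perp w).
  by rewrite -[in RHS]scaleN1r -vecZ; congr vec; apply: pair_eq; rewrite /perp ?coordE/=; ring.
rewrite lenN -h => /eqP; rewrite -subr_eq0 opprK -scalerDr -scalerDl !scaler_eq0.
rewrite (gt_eqF (len_gt0 w0)) /= => /orP[/eqP E|/eqP E]; first by apply/eqP; rewrite -addr_eq0 E.
by move: h; rewrite E !scaler0 => /esym/eqP; rewrite (negPf (vec_neq0 w0)).
Qed.

Lemma sum_rim (Z : nmodType) (F : {set W} -> Z) P i : P \in cells M ->
  \sum_(K in cells (refine M) | rim P i \in sides K) F K =
  F (subcell P i) + (if opp M vert (P, i) is Some u then F (subcell u.1 u.2) else 0).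
Proof.
move=> PM; rewrite (bigD1 (subcell P i))/=; last first.
  by rewrite subcell_refine// (sides_subcell G)// eqxx !orbT.
congr (_ + _); case E : (opp _ _ _) => [u|].
  move/(oppP G) : E => oPu; have [uM uE une] := opposite_side G oPu.
  rewrite (bigD1 (subcell u.1 u.2))/=; last first.
    rewrite uM une uE (sides_subcell G) ?eqxx ?orbT//.
    by have /and4P[] := oPu.
  rewrite big1 ?addr0// => K /andP[/andP[/andP[KM Ke] K1] K2].
  have [KE|[v oPv KE]] := sides_rim G PM KM Ke; first by rewrite KE eqxx in K1.
  by rewrite KE (opposite_unique G oPv oPu) eqxx in K2.
apply: big1 => K /andP[/andP[KM Ke] K1].
have [KE|[v oPv KE]] := sides_rim G PM KM Ke; first by rewrite KE eqxx in K1.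
by move/(oppP G): oPv; rewrite E.
Qed.

Section continuous_trace.
Context (k : nat) (v : dgfield R W 2 1).
Hypothesis Hv : Uh0 Omega k M nu v.

(** Without a neighbour the jump is the trace up to sign, so the trace vanishes whether or not the
    edge counts as a boundary edge. With a neighbour it cannot be a boundary edge, as both
    orientations would be [1] although they are opposite. *)
Lemma rim_trace P i x : P \in cells M -> geom (refine M) (rim P i) x ->
  trace_on (refine M) v (rim P i) x = v (subcell P i) x /\
  if opp M vert (P, i) is Some u then v (subcell u.1 u.2) x = v (subcell P i) x
  else v (subcell P i) x = 0.
Proof.
move=> PM xP; have [[_ Hjump] Hbd] := Hv.
have eM := rim_primal G i PM; have [_ sq oop] := orient_rim i PM.
have eE : rim P i \in edges (refine M).
  by apply: (side_edge (i := i) PM); rewrite (sides_subcell G)// eqxx !orbT.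
have := fun eb => Hjump _ eM eb x xP; have := fun eb => Hbd _ eM eb x xP; have [_ _] := Hnu eE.
rewrite /trace_on /jump.
have -> : #|[set K in cells (refine M) | rim P i \in sides K]%SET| =
    (1 + (if opp M vert (P, i) is Some u then 1 else 0))%N.
  rewrite -sum1_card; apply: etrans (sum_rim (fun=> 1%N) i PM).
  by apply: eq_bigl => K; rewrite !inE.
rewrite !(sum_rim _ _ PM).
have o0 : orientation (refine M) nu (subcell P i) (rim P i) != 0.
  by apply/eqP => o0; move: sq; rewrite o0 expr0n => /esym/eqP; rewrite oner_eq0.
case E : (opp _ _ _) => [u|] bnd tr ju; last first.
  have : v (subcell P i) x = 0.
    have [eb|eb] := pselect (boundary_edge Omega (refine M) (rim P i)).
      by have := tr eb; rewrite addn0 invr1 scale1r addr0.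
    by have /eqP := ju eb; rewrite addr0 scaler_eq0 (negPf o0) => /eqP.
  by move=> ->; rewrite addn0 addr0 scaler0.
move/(oppP G) : E => oPu; have [uM uE une] := opposite_side G oPu.
have ou := oop _ oPu; have QM : u.1 \in cells M by have /and4P[] := oPu.
have vE : v (subcell u.1 u.2) x = v (subcell P i) x.
  have [eb|eb] := pselect (boundary_edge Omega (refine M) (rim P i)).
    have r1 : rim P i \in sides (subcell P i) by rewrite (sides_subcell G)// eqxx !orbT.
    have r2 : rim P i \in sides (subcell u.1 u.2).
      by rewrite uE (sides_subcell G)// eqxx !orbT.
    have := bnd eb _ uM r2; rewrite ou (bnd eb _ (subcell_refine i PM) r1) => /eqP.
    by rewrite eq_sym -subr_eq0 opprK (_ : 1 + 1 = 2 :> R)// pnatr_eq0.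
  have /eqP := ju eb; rewrite ou scaleNr -scalerBr scaler_eq0 (negPf o0) subr_eq0.
  by move/eqP.
split=> //; rewrite vE -mulr2n -(scaler_nat 2 (v (subcell P i) x)) scalerA mulVf ?scale1r//.
Qed.
End continuous_trace.
End normals_refined.

(** * The discrete Korn inequality *)

Section reference_coordinates.
Context {R : realType}.
Implicit Types (a b c z : R * R) (F : {poly {poly R}}).

Lemma horner2Z (r : R) F s t : (r%:P *: F).[s, t] = r * F.[s, t].
Proof. by rewrite hornerZ hornerM hornerC. Qed.

Lemma derive_unitv (f : R * R -> R) F c a b z :
  (forall z, f (affmap c a b z) = F.[z.1, z.2]) -> cross a b != 0 ->
  'D_(unitv R 0) f (affmap c a b z) =
    (b.2 * F^`().[z.1, z.2] - a.2 * (dY F).[z.1, z.2]) / cross a b /\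
  'D_(unitv R 1) f (affmap c a b z) =
    (a.1 * (dY F).[z.1, z.2] - b.1 * F^`().[z.1, z.2]) / cross a b.
Proof.
move=> fF D0.
have e0 : unitv R 0 = (b.2 / cross a b) *: a + (- a.2 / cross a b) *: b.
  move: D0; rewrite /unitv /cross => D0.
  by apply: pair_eq; rewrite !coordE /=; field.
have e1 : unitv R 1 = (- b.1 / cross a b) *: a + (a.1 / cross a b) *: b.
  move: D0; rewrite /unitv /cross => D0.
  by apply: pair_eq; rewrite !coordE /=; field.
split.
  rewrite e0 (derive_affmap (b.2 / cross a b, - a.2 / cross a b) z fF) /=.
  by ring.
rewrite e1 (derive_affmap (- b.1 / cross a b, a.1 / cross a b) z fF) /=.
by ring.
Qed.

Definition grad_sqr a b (X Y : {poly {poly R}}) : {poly {poly R}} :=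
  let J := cross a b in
  (J^-1 ^+ 2)%:P *: ((b.2%:P *: X^`() - a.2%:P *: dY X) ^+ 2 + (a.1%:P *: dY X - b.1%:P *: X^`()) ^+ 2
   + ((b.2%:P *: Y^`() - a.2%:P *: dY Y) ^+ 2 + (a.1%:P *: dY Y - b.1%:P *: Y^`()) ^+ 2)).

Lemma mdot_mx2 (A B : 'M[R]_2) : mdot A B =
  A 0 0 * B 0 0 + A 0 1 * B 0 1 + (A 1 0 * B 1 0 + A 1 1 * B 1 1).
Proof.
rewrite /mdot !big_ord_recl !big_ord0 !addr0 /=.
by congr (_ + _ + (_ + _)); congr (_ * _); congr (_ _ _); apply: val_inj.
Qed.

Lemma mdot_col2 (x y : 'cV[R]_2) : mdot x y = x 0 0 * y 0 0 + x 1 0 * y 1 0.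
Proof.
rewrite /mdot !big_ord_recl !big_ord0 !addr0 /=.
by congr (_ + _); congr (_ * _); congr (_ _ _); apply: val_inj.
Qed.

Lemma mdot_grad (v : R * R -> 'cV[R]_2) (X Y : {poly {poly R}}) c a b z :
  (forall z, v (affmap c a b z) 0 0 = X.[z.1, z.2]) ->
  (forall z, v (affmap c a b z) 1 0 = Y.[z.1, z.2]) -> cross a b != 0 ->
  mdot (grad v (affmap c a b z)) (grad v (affmap c a b z)) = (grad_sqr a b X Y).[z.1, z.2].
Proof.
move=> vX vY D0.
have [x0 x1] := derive_unitv (f := fun y => v y 0 0) z vX D0; have [y0 y1] := derive_unitv (f := fun y => v y 1 0) z vY D0.
rewrite mdot_mx2 !mxE x0 x1 y0 y1 /grad_sqr !expr2 horner2Z.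
rewrite !hornerD !hornerM !hornerD !hornerN !horner2Z; field; exact: D0.
Qed.

Lemma sqr_comb_bound (x y z r c1 c2 c3 : R) : `|c1| <= r -> `|c2| <= r -> `|c3| <= r ->
  (x * c1 + y * c2 + z * c3) ^+ 2 <= 3 * r ^+ 2 * (x ^+ 2 + y ^+ 2 + z ^+ 2).
Proof.
move=> h1 h2 h3; have r0 := le_trans (normr_ge0 c1) h1.
have c2r (c : R) : `|c| <= r -> c ^+ 2 <= r ^+ 2.
  by move=> h; rewrite -[leLHS]real_normK ?num_real// lerXn2r ?nnegrE.
have /(ler_wpM2l (sqr_ge0 x)) k1 := c2r _ h1.
have /(ler_wpM2l (sqr_ge0 y)) k2 := c2r _ h2.
have /(ler_wpM2l (sqr_ge0 z)) k3 := c2r _ h3.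
have := sqr_ge0 (x * c1 - y * c2); have := sqr_ge0 (x * c1 - z * c3).
have := sqr_ge0 (y * c2 - z * c3); lra.
Qed.

(** With strains [e11], [e22], [e12], the first part rests on [|grad v|^2 = 2 e11^2 + 2 e22^2 + (2
    e12)^2 - (div v)^2 + 2 det], written in oblique components; the second bounds the reference
    gradient by the physical one. *)
Lemma korn_pointwise a b (g xs xt ys yt : R) : 0 < cross a b ->
  dot a a <= g * cross a b -> dot b b <= g * cross a b ->
  let J := cross a b in
  let S := (b.2 * xs - a.2 * xt) ^+ 2 + (a.1 * xt - b.1 * xs) ^+ 2
   + ((b.2 * ys - a.2 * yt) ^+ 2 + (a.1 * yt - b.1 * ys) ^+ 2) in
  S / J ^+ 2 <= 60 * g ^+ 2 / J ^+ 2 * ((a.1 * xs + a.2 * ys) ^+ 2 + (b.1 * xt + b.2 * yt) ^+ 2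
      + ((a.1 * xt + a.2 * yt) + (b.1 * xs + b.2 * ys)) ^+ 2)
    + 2 * ((xs * yt - xt * ys) / J) /\
  xs ^+ 2 + xt ^+ 2 + (ys ^+ 2 + yt ^+ 2) <= 2 * g / J * S.
Proof.
case: a b => [a1 a2] [b1 b2]; rewrite /dot /= => J0 ha hb.
set J := cross _ _ in J0 ha hb *.
have JE : J = a1 * b2 - a2 * b1 by [].
clearbody J.
set S := (b2 * xs - a2 * xt) ^+ 2 + (a1 * xt - b1 * xs) ^+ 2
   + ((b2 * ys - a2 * yt) ^+ 2 + (a1 * yt - b1 * ys) ^+ 2).
set e1 := a1 * xs + a2 * ys; set e2 := b1 * xt + b2 * yt.
set e3 := (a1 * xt + a2 * yt) + (b1 * xs + b2 * ys).
have J2 : 0 < J ^+ 2 by rewrite exprn_gt0.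
split.
  pose S00 := J * (b2 * xs - a2 * xt); pose S11 := J * (a1 * yt - b1 * ys).
  pose S01 := J * ((a1 * xt - b1 * xs) + (b2 * ys - a2 * yt)).
  have h00 : S00 = e1 * b2 ^+ 2 + e2 * a2 ^+ 2 - e3 * (a2 * b2).
    by rewrite /S00 /e1 /e2 /e3 JE; ring.
  have h11 : S11 = e1 * b1 ^+ 2 + e2 * a1 ^+ 2 - e3 * (a1 * b1).
    by rewrite /S11 /e1 /e2 /e3 JE; ring.
  have h01 : S01 = e3 * (a1 * b2 + a2 * b1) - 2 * e1 * (b1 * b2) - 2 * e2 * (a1 * a2).
    by rewrite /S01 /e1 /e2 /e3 JE; ring.
  have gJ : 0 <= g * J by apply: le_trans ha; rewrite -!expr2 addr_ge0 ?sqr_ge0.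
  have E0 : 0 <= e1 ^+ 2 + e2 ^+ 2 + e3 ^+ 2 by rewrite !addr_ge0 ?sqr_ge0.
  have sa := sqr_ge0 (a1 - a2); have sa' := sqr_ge0 (a1 + a2).
  have sb := sqr_ge0 (b1 - b2); have sb' := sqr_ge0 (b1 + b2).
  have sab1 := sqr_ge0 (a1 - b1); have sab1' := sqr_ge0 (a1 + b1).
  have sab2 := sqr_ge0 (a2 - b2); have sab2' := sqr_ge0 (a2 + b2).
  have sab3 := sqr_ge0 (a1 - b2); have sab3' := sqr_ge0 (a1 + b2).
  have sab4 := sqr_ge0 (a2 - b1); have sab4' := sqr_ge0 (a2 + b1).
  have q1 := sqr_ge0 a1; have q2 := sqr_ge0 a2; have q3 := sqr_ge0 b1; have q4 := sqr_ge0 b2.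
  have b00 : S00 ^+ 2 <= 3 * (2 * (g * J)) ^+ 2 * (e1 ^+ 2 + e2 ^+ 2 + e3 ^+ 2).
    rewrite h00 -mulrN; apply: sqr_comb_bound; rewrite ?normrN ler_norml; apply/andP; split; lra.
  have b11 : S11 ^+ 2 <= 3 * (2 * (g * J)) ^+ 2 * (e1 ^+ 2 + e2 ^+ 2 + e3 ^+ 2).
    rewrite h11 -mulrN; apply: sqr_comb_bound; rewrite ?normrN ler_norml; apply/andP; split; lra.
  have b01 : S01 ^+ 2 <= 3 * (2 * (g * J)) ^+ 2 * (e1 ^+ 2 + e2 ^+ 2 + e3 ^+ 2).
    rewrite h01 (_ : _ - _ - _ = e1 * (- 2 * (b1 * b2)) + e2 * (- 2 * (a1 * a2)) + e3 * (a1 * b2 + a2 * b1)); last by ring.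
    apply: sqr_comb_bound; rewrite ler_norml; apply/andP; split; lra.
  rewrite -(ler_pM2r (exprn_gt0 4 J0)).
  set T := e1 ^+ 2 + _ + _ in E0 b00 b11 b01 *.
  have -> : (60 * g ^+ 2 / J ^+ 2 * T + 2 * ((xs * yt - xt * ys) / J)) * J ^+ 4 =
     5 * (3 * (2 * (g * J)) ^+ 2 * T) + 2 * (xs * yt - xt * ys) * J ^+ 3.
    by field; rewrite gt_eqF.
  have -> : S / J ^+ 2 * J ^+ 4 = J ^+ 2 * S by field; rewrite gt_eqF.
  (* The squared divergence is dropped; the weights [2 + 2 + 1] times [3 * 2^2] give the constant
     [60]. *)
  have -> : J ^+ 2 * S = 2 * S00 ^+ 2 + 2 * S11 ^+ 2 + S01 ^+ 2
     - (S00 + S11) ^+ 2 + 2 * (xs * yt - xt * ys) * J ^+ 3.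
    have J3 : J ^+ 3 = J ^+ 2 * (a1 * b2 - a2 * b1) by rewrite -JE; ring.
    by rewrite J3 /S /S00 /S11 /S01; ring.
  have := sqr_ge0 (S00 + S11); lra.
rewrite -(ler_pM2r J2).
have -> : 2 * g / J * S * J ^+ 2 = 2 * (g * J) * S by field; rewrite gt_eqF.
have cs (m n x y : R) : (m * x + n * y) ^+ 2 <= (m * m + n * n) * (x ^+ 2 + y ^+ 2).
  by have := sqr_ge0 (m * y - n * x); lra.
pose G00 := b2 * xs - a2 * xt; pose G01 := a1 * xt - b1 * xs.
pose G10 := b2 * ys - a2 * yt; pose G11 := a1 * yt - b1 * ys.
have S0 (x y : R) : 0 <= x ^+ 2 + y ^+ 2 by rewrite addr_ge0 ?sqr_ge0.
have k1 := le_trans (cs a1 a2 G00 G01) (ler_wpM2r (S0 G00 G01) ha).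
have k2 := le_trans (cs b1 b2 G00 G01) (ler_wpM2r (S0 G00 G01) hb).
have k3 := le_trans (cs a1 a2 G10 G11) (ler_wpM2r (S0 G10 G11) ha).
have k4 := le_trans (cs b1 b2 G10 G11) (ler_wpM2r (S0 G10 G11) hb).
have -> : (xs ^+ 2 + xt ^+ 2 + (ys ^+ 2 + yt ^+ 2)) * J ^+ 2 =
  (a1 * G00 + a2 * G01) ^+ 2 + (b1 * G00 + b2 * G01) ^+ 2 +
  ((a1 * G10 + a2 * G11) ^+ 2 + (b1 * G10 + b2 * G11) ^+ 2).
  by rewrite /G00 /G01 /G10 /G11 JE; ring.
have -> : S = G00 ^+ 2 + G01 ^+ 2 + (G10 ^+ 2 + G11 ^+ 2) by [].
lra.
Qed.
End reference_coordinates.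

(** * Integrals and norms in reference coordinates *)

Section refined_integrals.
Context {R : realType} {V : finType} (M : mesh R V) (vert : {set V} -> 'I_3 -> V).
Notation p := (pos M).
Notation W := (V + {set V})%type.
Notation bp := {poly {poly R}}.
Implicit Types (P Q : {set V}) (i j : 'I_3) (e K : {set W}).
Hypothesis G : labelled_mesh M vert.
Notation arm := (arm M vert).
Notation cen := (cen M).
Notation jac := (jac M vert).
Notation subcell := (subcell vert).
Notation spoke := (spoke vert).
Notation rim := (rim vert).

Definition pt P i (z : R * R) : R * R := affmap (cen P) (arm P i) (arm P (i + 1)) z.

Lemma pos_arm P i : p (vert P i) = cen P + arm P i.
Proof. by rewrite addrC subrK. Qed.

(** The two sides of [P] at the vertex add up to [-3] times the arm, and their squared lengths are
    at most [3 * gamma * jac P]; the parallelogram law concludes. *)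
Lemma arm_bound gamma P i : shape_regular gamma M -> P \in cells M ->
  dot (arm P i) (arm P i) <= 2 * gamma * jac P.
Proof.
move=> reg PM; have [h1 h2 h3] := vert_neq G i PM.
have PE := vert_set_cyc G i PM; have PM1 := PM; rewrite PE in PM1.
have PE' : P = [set vert P i; vert P (i - 1); vert P (i + 1)]%SET.
  by rewrite [LHS]PE -!finset.setUA; congr (_ |: _)%SET; exact: finset.setUC.
have PM2 := PM; rewrite PE' in PM2.
have h3' : vert P (i - 1) != vert P (i + 1) by rewrite eq_sym.
have [k1 _] := edge_product_bound (labelled_solid G) reg PM1 h1 h2 h3.
have [k2 _] := edge_product_bound (labelled_solid G) reg PM2 h2 h1 h3'.
move: k1 k2; rewrite -!expr2 !len_sqr [cross (_ (vert P (i - 1)) - _) _]cross_swap normrN.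
rewrite (cross_verts G)// normrM (gtr0_norm (jac_gt0 G PM)) ger0_norm//.
have e1 : p (vert P (i + 1)) - p (vert P i) = arm P (i + 1) - arm P i.
  by rewrite !pos_arm; apply: pair_eq; rewrite !coordE; ring.
have e2 : p (vert P (i - 1)) - p (vert P i) = - 2 *: arm P i - arm P (i + 1).
  by rewrite !pos_arm (armB G)//; apply: pair_eq; rewrite !coordE; ring.
rewrite e1 e2 mulrCA; set x := arm P i; set y := arm P (i + 1); set gj := gamma * _.
rewrite -mulrA -/gj.
have i1 : 9 * dot x x + dot (x + 2 *: y) (x + 2 *: y) =
    2 * (dot (y - x) (y - x) + dot (- 2 *: x - y) (- 2 *: x - y)).
  by rewrite /dot !coordE; ring.
have := dot_ge0 (x + 2 *: y); have := dot_ge0 x; lra.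
Qed.

Lemma int_subcell P i f (F : bp) : P \in cells M ->
  (forall z, f (pt P i z) = F.[z.1, z.2]) ->
  int_cell (refine M) (subcell P i) f = jac P * tri F.
Proof.
move=> PM fF; have [d1 d2 d3] := subcell_distinct G i PM.
rewrite /int_cell /geom hull_set3//= -/(cen P) -/(arm P i) -/(arm P (i + 1)).
rewrite (Rintegral_triangle (F := F))// cross_arm//.
  by rewrite gtr0_norm// jac_gt0.
by rewrite lt0r_neq0// jac_gt0.
Qed.

Lemma int_spoke P i f (q : {poly R}) :
  (forall s, f (pt P i (s, 0)) = q.[s]) ->
  int_edge (refine M) (spoke P i) f = len (arm P i) * int01 q.
Proof.
move=> fq; rewrite (int_edgeE (p := q))//.
  by congr (_ * _); rewrite edistE -/(len _) /= -[X in len X]opprB lenN.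
move=> s /=; rewrite -fq; congr f; rewrite /pt affmapE /= pos_arm -/(cen P).
by apply: pair_eq; rewrite !coordE; ring.
Qed.

Lemma int_rim P i f (q : {poly R}) : P \in cells M ->
  (forall s, f (pt P i (1 - s, s)) = q.[s]) ->
  int_edge (refine M) (rim P i) f = len (p (vert P (i + 1)) - p (vert P i)) * int01 q.
Proof.
move=> PM fq; have [_ _ d3] := subcell_distinct G i PM.
rewrite (int_edgeE (p := q))//.
  by congr (_ * _); rewrite edistE -/(len _) /= -[X in len X]opprB lenN.
move=> s /=; rewrite -fq; congr f; rewrite /pt affmapE /= !pos_arm.
by apply: pair_eq; rewrite !coordE; ring.
Qed.

Lemma spoke_pt P i x : geom (refine M) (spoke P i) x <->
  exists2 s, 0 <= s <= 1 & x = pt P i (s, 0).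
Proof.
rewrite /geom hull_set2//; split=> [[s]|[s]]; rewrite /= ?in_itv/= => s01.
  move=> <-; exists s => //; rewrite /pt affmapE /= pos_arm -/(cen P).
  by apply: pair_eq; rewrite !coordE; ring.
move=> ->; exists s; rewrite /= ?in_itv//= /pt affmapE /= pos_arm -/(cen P).
by apply: pair_eq; rewrite !coordE; ring.
Qed.

Lemma rim_pt P i s : P \in cells M -> 0 <= s <= 1 ->
  geom (refine M) (rim P i) (pt P i (1 - s, s)).
Proof.
move=> PM s01; have [_ _ d3] := subcell_distinct G i PM.
rewrite /geom hull_set2//; exists s; rewrite /= ?in_itv//= /pt affmapE /= !pos_arm.
by apply: pair_eq; rewrite !coordE; ring.
Qed.

Lemma pt_prev P i s : P \in cells M -> pt P (i - 1) (0, s) = pt P i (s, 0).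
Proof.
by move=> PM; rewrite /pt !affmapE /= subrK; apply: pair_eq; rewrite !coordE; ring.
Qed.

Lemma diam_spoke P i : P \in cells M ->
  Defs.diam (geom (refine M) (spoke P i)) = len (arm P i).
Proof.
move=> PM; have l0 := len_ge0 (arm P i).
have distE s t : Defs.edist (pt P i (s, 0)) (pt P i (t, 0)) = `|s - t| * len (arm P i).
  rewrite edistE -/(len _) -lenZ; congr len; rewrite /pt !affmapE.
  by apply: pair_eq; rewrite !coordE /=; ring.
apply/eqP; rewrite eq_le; apply/andP; split.
  apply: ge_sup; first by exists 0, (pt P i (0, 0)), (pt P i (0, 0)); split;
    rewrite ?distE ?subrr ?normr0 ?mul0r//; apply/spoke_pt; exists 0; rewrite ?lexx ?ler01.
  move=> d [x [y [/spoke_pt[s /andP[s0 s1] ->] /spoke_pt[t /andP[t0 t1] ->] ->]]].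
  by rewrite distE -[leRHS]mul1r ler_wpM2r// ler_norml; apply/andP; split; lra.
apply: ub_le_sup.
  exists (len (arm P i)) => d [x [y [/spoke_pt[s /andP[s0 s1] ->] /spoke_pt[t /andP[t0 t1] ->] ->]]].
  by rewrite distE -[leRHS]mul1r ler_wpM2r// ler_norml; apply/andP; split; lra.
exists (pt P i (1, 0)), (pt P i (0, 0)); split.
- by apply/spoke_pt; exists 1; rewrite ?lexx ?ler01.
- by apply/spoke_pt; exists 0; rewrite ?lexx ?ler01.
- by rewrite distE subr0 normr1 mul1r.
Qed.

Section norm_formula.
Context (Omega : set (R * R)) (nu : {set W} -> 'cV[R]_2).
Hypothesis Hnu : unit_normals Omega (refine M) nu.
Context (v : dgfield R W 2 1) (X Y : {set V} -> 'I_3 -> bp).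
Hypothesis HX : forall P i z, P \in cells M -> v (subcell P i) (pt P i z) 0 0 = (X P i).[z.1, z.2].
Hypothesis HY : forall P i z, P \in cells M -> v (subcell P i) (pt P i z) 1 0 = (Y P i).[z.1, z.2].

Definition spoke_jump (Z : {set V} -> 'I_3 -> bp) P i : {poly R} :=
  sE (Z P i) - tE (Z P (i - 1)).

Lemma horner_sE (F : bp) s : (sE F).[s] = F.[s, 0].
Proof. by rewrite /sE -polyC0 horner2_swapXY. Qed.

Lemma jump_spoke P i s : P \in cells M ->
  mdot (jump (refine M) nu v (spoke P i) (pt P i (s, 0)))
       (jump (refine M) nu v (spoke P i) (pt P i (s, 0))) =
  (spoke_jump X P i ^+ 2 + spoke_jump Y P i ^+ 2).[s].
Proof.
move=> PM; have [r [l [r2 o1 o2 _]]] := orient_spoke G Hnu i PM.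
rewrite /jump (sum_spoke G)// o1 o2 scaleNr -scalerBr mdot_col2 !mxE.
have -> : v (subcell P (i - 1)) (pt P i (s, 0)) 0 0 = (tE (X P (i - 1))).[s].
  by rewrite -pt_prev// HX.
have -> : v (subcell P (i - 1)) (pt P i (s, 0)) 1 0 = (tE (Y P (i - 1))).[s].
  by rewrite -pt_prev// HY.
rewrite HX// HY//= -!horner_sE /spoke_jump hornerD !horner_exp !hornerD !hornerN.
set x := _ - _; set y := _ - (tE (Y _ _)).[s].
by rewrite -[RHS]mul1r -r2; ring.
Qed.

(** The weight [1 / h_e] cancels the length factor of the arc length integral, so the jump terms
    carry no geometric factor. *)
Lemma H1norm_formula : H1norm M nu v = Num.sqrt (\sum_(P in cells M) \sum_i
   (jac P * tri (grad_sqr (arm P i) (arm P (i + 1)) (X P i) (Y P i))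
    + int01 (spoke_jump X P i ^+ 2 + spoke_jump Y P i ^+ 2))).
Proof.
rewrite /H1norm (sum_refine G) (sum_dual G) -big_split /=; congr Num.sqrt.
apply: eq_bigr => P PM; rewrite -big_split /=; apply: eq_bigr => i _; congr (_ + _).
  apply: int_subcell => // z; apply: mdot_grad => [w|w|]; rewrite ?HX ?HY//.
  by rewrite (cross_arm G)// lt0r_neq0// (jac_gt0 G).
rewrite diam_spoke// (int_spoke (q := spoke_jump X P i ^+ 2 + spoke_jump Y P i ^+ 2)).
  by rewrite mulKf// gt_eqF// len_gt0// (arm_neq0 G).
by move=> s; rewrite jump_spoke.
Qed.
End norm_formula.
End refined_integrals.

(** * The Jacobian determinant and trace estimates on the reference triangle *)

Section reference_korn.
Context {R : realType}.
Notation bp := {poly {poly R}}.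
Implicit Types (F X Y : bp) (p q : {poly R}).

Lemma dY0 : dY 0 = 0 :> bp.
Proof. by have := dY_inner (0 : {poly R}); rewrite deriv0 polyC0. Qed.

Lemma dY_derivC F : dY F^`() = (dY F)^`().
Proof.
elim/poly_ind: F => [|F c IH]; first by rewrite deriv0 dY0 deriv0.
rewrite derivD derivM derivX derivC addr0 mulr1 !dYD !dYM !dY_varX dY_inner !mulr0 !addr0.
by rewrite derivD derivM derivX derivC addr0 mulr1 IH.
Qed.

Lemma deriv_horner F q : (F.[q])^`() = F^`().[q] * q^`() + (dY F).[q].
Proof.
elim/poly_ind: F => [|F c IH]; first by rewrite dY0 horner0 !deriv0 !horner0 mul0r addr0.
rewrite hornerD hornerM hornerX hornerC !derivD !derivM IH derivX derivC addr0 mulr1.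
rewrite dYD dYM dY_varX dY_inner mulr0 addr0 !hornerD !hornerM !hornerX hornerC.
by ring.
Qed.

Lemma deriv_tE F : (tE F)^`() = tE (dY F).
Proof. by rewrite /tE deriv_horner deriv0 mulr0 add0r. Qed.

Lemma deriv_sE F : (sE F)^`() = sE F^`().
Proof. by rewrite /sE deriv_horner deriv0 mulr0 add0r /dY swapXYK. Qed.

(* The Jacobian determinant is a divergence, so its integral is carried by the
   boundary. *)
Lemma tri_jacobian X Y : tri (X^`() * dY Y - dY X * Y^`()) =
  int01 (X.[1 - 'X] * (Y.[1 - 'X])^`()) + int01 (sE X * (sE Y)^`())
  - int01 (tE X * (tE Y)^`()).
Proof.
have -> : X^`() * dY Y - dY X * Y^`() = (X * dY Y)^`() - dY (X * Y^`()).
  by rewrite derivM dYM dY_derivC; ring.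
rewrite triB tri_derivX tri_derivY deriv_sE deriv_tE deriv_horner.
rewrite derivB derivX -polyC1 derivC sub0r mulrN1 -/(tE _) -/(sE _) tEM sEM.
rewrite !hornerM mulrDr int01D mulrN int01N; ring.
Qed.

Lemma horner_sqr_bound k p s : (size p <= k.+1)%N -> 0 <= s <= 1 ->
  p.[s] ^+ 2 <= k.+1%:R * \sum_(i < k.+1) p`_i ^+ 2.
Proof.
move=> sp /andP[s0 s1]; rewrite (horner_coef_wide _ sp).
apply: (le_trans (sum_cauchy_schwarz _ _)); rewrite mulrC ler_wpM2r//.
  by apply: sumr_ge0 => i _; exact: sqr_ge0.
apply: (@le_trans _ _ (\sum_(i < k.+1) 1)); last by rewrite sumr_const card_ord.
by apply: ler_sum => i _; rewrite -exprM exprn_ile1.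
Qed.

(** Values on the unit interval are bounded by the coefficients, and these by the norm on the
    triangle; [tri_swap] carries one side to the other. *)
Lemma trace_bound k : exists2 C : R, 0 < C & forall F, tdeg k F ->
  int01 (sE F ^+ 2) <= C * tri (F ^+ 2) /\ int01 (tE F ^+ 2) <= C * tri (F ^+ 2).
Proof.
have [C C0 hC] := @coef_tri_bound R k.
exists (k.+1%:R * (k.+1%:R * C)); first by rewrite !mulr_gt0 ?ltr0n.
suff tb F : tdeg k F -> int01 (tE F ^+ 2) <= k.+1%:R * (k.+1%:R * C) * tri (F ^+ 2).
  move=> F hF; split; last exact: tb.
  have e : swapXY F ^+ 2 = swapXY (F ^+ 2) by rewrite !expr2 swapXYM.
  by have := tb _ (tdeg_swap hF); rewrite e tri_swap.
move=> hF; rewrite -[leRHS]int01C; apply: int01_le => s s01.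
rewrite hornerC horner_exp.
apply: (le_trans (horner_sqr_bound (size_tE hF) s01)); rewrite -!mulrA ler_wpM2l ?ler0n//.
apply: (@le_trans _ _ (\sum_(i < k.+1) C * tri (F ^+ 2))).
  by apply: ler_sum => i _; rewrite /tE horner_coef0 hC.
by rewrite sumr_const card_ord mulr_natl.
Qed.

Lemma endpoint_bound k : exists2 C : R, 0 < C & forall p, (size p <= k.+1)%N ->
  p.[0] ^+ 2 <= C * int01 (p ^+ 2) /\ p.[1] ^+ 2 <= C * int01 (p ^+ 2).
Proof.
have [C C0 hC] := @coef_int01_bound R k.
exists (k.+1%:R * (k.+1%:R * C)); first by rewrite !mulr_gt0 ?ltr0n.
move=> p sp.
suff eb s : 0 <= s <= 1 -> p.[s] ^+ 2 <= k.+1%:R * (k.+1%:R * C) * int01 (p ^+ 2).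
  by split; apply: eb; rewrite lexx ler01.
move=> s01; apply: (le_trans (horner_sqr_bound sp s01)); rewrite -!mulrA ler_wpM2l ?ler0n//.
apply: (@le_trans _ _ (\sum_(i < k.+1) C * int01 (p ^+ 2))).
  by apply: ler_sum => i _; exact: hC.
by rewrite sumr_const card_ord mulr_natl.
Qed.

(** Integration by parts arranged so that each integral on the right contains a jump, at the price
    of point values at the ends of the spoke. *)
Lemma int01_spoke (m n m' n' : {poly R}) :
  int01 (m * n^`()) - int01 (m' * n'^`()) =
  int01 ((m - m') * n^`()) - int01 (m'^`() * (n - n'))
  + (m'.[1] * (n - n').[1] - m'.[0] * (n - n').[0]).
Proof.
have := int01_deriv (m' * (n - n')); rewrite derivM int01D !hornerM derivB => E.
have -> : (m - m') * n^`() = m * n^`() - m' * n'^`() - m' * (n^`() - n'^`()) by ring.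
by rewrite !int01B; move: E; lra.
Qed.

Lemma young (eta x y : R) : 0 < eta -> `|x * y| <= eta * y ^+ 2 + eta^-1 * x ^+ 2.
Proof.
move=> e0.
have h (z : R) : z * y <= eta * y ^+ 2 + eta^-1 * z ^+ 2.
  rewrite -(ler_pM2l e0).
  have -> : eta * (eta * y ^+ 2 + eta^-1 * z ^+ 2) = (eta * y) ^+ 2 + z ^+ 2.
    by field; rewrite gt_eqF.
  by have := sqr_ge0 (eta * y - z); have := sqr_ge0 (eta * y); have := sqr_ge0 z; lra.
by rewrite ler_norml lerNl -mulNr h andbT -[x ^+ 2]sqrrN h.
Qed.

Lemma int01_young (eta : R) p q : 0 < eta ->
  `|int01 (p * q)| <= eta * int01 (q ^+ 2) + eta^-1 * int01 (p ^+ 2).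
Proof.
move=> e0; rewrite -!int01Z -int01D ler_norml lerNl -int01N.
apply/andP; split; apply: int01_le => s _; have := young p.[s] q.[s] e0;
  rewrite hornerD !hornerZ !horner_exp ?hornerN hornerM ler_norml => /andP[]; lra.
Qed.
End reference_korn.

(** * Summation of the determinant over the mesh *)

Section korn.
Context {R : realType}.
Notation bp := {poly {poly R}}.

Lemma horner_at (F : bp) (q : {poly R}) s : F.[q].[s] = F.[q.[s], s].
Proof.
elim/poly_ind: F => [|F c IH]; first by rewrite !horner0.
by rewrite !hornerD !hornerM !hornerX !hornerC IH.
Qed.

Lemma horner_hyp1 (s : R) : (1 - 'X : {poly R}).[s] = 1 - s.
Proof. by rewrite hornerD hornerN hornerX -polyC1 hornerC. Qed.

Lemma horner_hyp (F : bp) s : F.[1 - 'X].[s] = F.[1 - s, s].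
Proof. by rewrite horner_at horner_hyp1. Qed.

Lemma ord3_shift (h : 'I_3 -> R) : \sum_i h (i - 1) = \sum_i h i.
Proof. by rewrite [RHS](reindex_inj (addIr (- 1 : 'I_3))). Qed.

Definition along (a : R * R) (X Y : bp) : bp := a.1%:P *: X + a.2%:P *: Y.

Lemma horner2D (F F' : bp) s t : (F + F').[s, t] = F.[s, t] + F'.[s, t].
Proof. by rewrite !hornerD. Qed.

Lemma grad_sqrE a b (X Y : bp) s t :
  let xs := X^`().[s, t] in let xt := (dY X).[s, t] in
  let ys := Y^`().[s, t] in let yt := (dY Y).[s, t] in
  (grad_sqr a b X Y).[s, t] =
  ((b.2 * xs - a.2 * xt) ^+ 2 + (a.1 * xt - b.1 * xs) ^+ 2
   + ((b.2 * ys - a.2 * yt) ^+ 2 + (a.1 * yt - b.1 * ys) ^+ 2)) / cross a b ^+ 2.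
Proof.
rewrite /grad_sqr horner2Z mulrC exprVn; congr (_ / _).
by rewrite !(hornerD, hornerN, horner_exp, hornerD, hornerN) !horner2Z.
Qed.

Section fixed_mesh.
Context {V : finType} (M : mesh R V) (vert : {set V} -> 'I_3 -> V).
Notation p := (pos M).
Notation W := (V + {set V})%type.
Implicit Types (P Q : {set V}) (i j : 'I_3) (e K : {set W}).
Hypothesis G : labelled_mesh M vert.
Notation arm := (arm M vert).
Notation jac := (jac M vert).
Notation subcell := (subcell vert).
Context (Omega : set (R * R)) (nu : {set W} -> 'cV[R]_2) (k : nat) (gamma : R).
Hypothesis reg : shape_regular gamma M.
Hypothesis Hnu : unit_normals Omega (refine M) nu.
Context (v : dgfield R W 2 1) (X Y : {set V} -> 'I_3 -> bp).
Hypothesis Hv : Uh0 Omega k M nu v.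
Hypothesis HX : forall P i z, P \in cells M ->
  v (subcell P i) (pt M vert P i z) 0 0 = (X P i).[z.1, z.2].
Hypothesis HY : forall P i z, P \in cells M ->
  v (subcell P i) (pt M vert P i z) 1 0 = (Y P i).[z.1, z.2].
Hypothesis tX : forall P i, P \in cells M -> tdeg k (X P i).
Hypothesis tY : forall P i, P \in cells M -> tdeg k (Y P i).

Definition strains P i (d : 'I_3) : bp :=
  strain (fun i => along (arm P i) (X P i) (Y P i))
         (fun i => along (arm P (i + 1)) (X P i) (Y P i)) i d.

Definition grad_energy P i : R :=
  jac P * tri (grad_sqr (arm P i) (arm P (i + 1)) (X P i) (Y P i)).

Definition jump_energy P i : R :=
  int01 (spoke_jump X P i ^+ 2 + spoke_jump Y P i ^+ 2).

(** Oblique strains are physical strains times a squared length, comparable to [jac P]; with the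
    area factor [jac P] the physical energy scales as their square over [jac P]. *)
Definition strain_energy P i : R := (\sum_d tri (strains P i d ^+ 2)) / jac P.

Definition jacobian P i : bp :=
  (X P i)^`() * dY (Y P i) - dY (X P i) * (Y P i)^`().

Let g := `|2 * gamma|.

Lemma arm_bound_norm P i : P \in cells M -> dot (arm P i) (arm P i) <= g * jac P.
Proof.
move=> PM; apply: (le_trans (arm_bound G i reg PM)).
by rewrite ler_wpM2r ?ler_norm// ltW// (jac_gt0 G).
Qed.

Lemma korn_cell P i : P \in cells M ->
  grad_energy P i <= 60 * g ^+ 2 * strain_energy P i + 2 * tri (jacobian P i) /\
  tri ((X P i)^`() ^+ 2 + dY (X P i) ^+ 2 + ((Y P i)^`() ^+ 2 + dY (Y P i) ^+ 2))
    <= 2 * g * grad_energy P i.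
Proof.
move=> PM; have J0 := jac_gt0 G PM.
have ha := arm_bound_norm i PM; have hb := arm_bound_norm (i + 1) PM.
rewrite -(cross_arm G i PM) in J0 ha hb.
rewrite /grad_energy /strain_energy /jacobian -(cross_arm G i PM).
set a := arm P i in ha hb J0 *; set b := arm P (i + 1) in ha hb J0 *; set J := cross a b in ha hb J0 *.
have pw s t := korn_pointwise (X P i)^`().[s, t] (dY (X P i)).[s, t]
    (Y P i)^`().[s, t] (dY (Y P i)).[s, t] J0 ha hb.
rewrite -!triZ; split.
  rewrite (_ : 60 * g ^+ 2 * _ = tri ((60 * g ^+ 2 / J)%:P *: \sum_d strains P i d ^+ 2)); last first.
    by rewrite triZ tri_sum; ring.
  rewrite -triD; apply: tri_le => s t; have [h _] := pw s t.
  rewrite horner2Z grad_sqrE [leRHS]horner2D !horner2Z.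
  have -> : (\sum_d strains P i d ^+ 2).[s, t] =
     (a.1 * (X P i)^`().[s, t] + a.2 * (Y P i)^`().[s, t]) ^+ 2
     + (b.1 * (dY (X P i)).[s, t] + b.2 * (dY (Y P i)).[s, t]) ^+ 2
     + ((a.1 * (dY (X P i)).[s, t] + a.2 * (dY (Y P i)).[s, t])
       + (b.1 * (X P i)^`().[s, t] + b.2 * (Y P i)^`().[s, t])) ^+ 2.
    rewrite !horner_sum (ord3_sum _ 0) addrA add0r sub0r /strains /strain /along /=.
    by rewrite !horner_exp !dYD !dYZ !derivD !derivZ !hornerD !horner2Z.
  have -> : ((X P i)^`() * dY (Y P i) - dY (X P i) * (Y P i)^`()).[s, t] =
      (X P i)^`().[s, t] * (dY (Y P i)).[s, t] - (dY (X P i)).[s, t] * (Y P i)^`().[s, t].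
    by rewrite !(hornerD, hornerN, hornerM).
  have := ler_wpM2l (ltW J0) h; rewrite -/a -/b -/J.
  move: J J0 {ha hb pw h} => J J0; set T := (_ + _ : R) in |- * => h.
  apply: (le_trans h); rewrite le_eqVlt; apply/orP; left; apply/eqP.
  by field; rewrite gt_eqF.
apply: tri_le => s t; have [_ h] := pw s t.
rewrite [leRHS]horner2Z horner2Z grad_sqrE !horner2D !horner_exp; apply: (le_trans h).
by rewrite -/J le_eqVlt; apply/orP; left; apply/eqP; field; rewrite gt_eqF.
Qed.

Lemma opposite_pt P i u s : opposite M vert (P, i) u ->
  pt M vert u.1 u.2 (s, 1 - s) = pt M vert P i (1 - s, s).
Proof.
move=> /and4P[/= PM QM /eqP h1 /eqP h2]; rewrite /pt !affmapE /=.
have aE Q j : arm Q j = p (vert Q j) - cen M Q by [].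
by rewrite !aE h1 h2; apply: pair_eq; rewrite !coordE; ring.
Qed.

Lemma rim_match P i s : P \in cells M -> 0 <= s <= 1 ->
  if opp M vert (P, i) is Some u
  then (X u.1 u.2).[s, 1 - s] = (X P i).[1 - s, s] /\
       (Y u.1 u.2).[s, 1 - s] = (Y P i).[1 - s, s]
  else (X P i).[1 - s, s] = 0 /\ (Y P i).[1 - s, s] = 0.
Proof.
move=> PM s01; have [_] := rim_trace G Hnu Hv PM (rim_pt G i PM s01).
rewrite -(HX i (1 - s, s) PM) -(HY i (1 - s, s) PM).
case E : (opp _ _ _) => [u|]; last by move=> ->; rewrite !mxE.
move/(oppP G) : E => oPu; have /and4P[_ QM _ _] := oPu.
rewrite -(opposite_pt s oPu) => vE.
by rewrite -(HX u.2 (s, 1 - s) QM) -(HY u.2 (s, 1 - s) QM) vE.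
Qed.

Lemma sum_cells_pairs (f : {set V} -> 'I_3 -> R) : \sum_(P in cells M) \sum_i f P i =
  \sum_t (if t.1 \in cells M then f t.1 t.2 else 0).
Proof. by rewrite pair_big /= -big_mkcond; apply: eq_bigl => t; rewrite andbT. Qed.

(** Neighbours have the same trace on a primal edge but run through it in opposite directions, which
    changes the sign of the tangential derivative; without a neighbour the trace is zero. *)
Lemma sum_rims : \sum_(P in cells M) \sum_i
  int01 ((X P i).[1 - 'X] * ((Y P i).[1 - 'X])^`()) = 0.
Proof.
rewrite sum_cells_pairs; apply: (sum_antisymmetric G) => [[P i] u oPu|[P i] o0] /=.
  have := oPu; rewrite /opposite => /and4P[/= PM QM _ _]; rewrite PM QM.
  have Z (F F' : bp) : (forall s, 0 <= s <= 1 -> F'.[s, 1 - s] = F.[1 - s, s]) ->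
      F'.[1 - 'X] = F.[1 - 'X] \Po (1 - 'X).
    move=> h; apply/eqP; rewrite -subr_eq0; apply/eqP.
    apply: (poly_itv_eq0 (ltr01 : 0 < (1 : R))) => s /andP[s0 s1].
    rewrite hornerD hornerN horner_comp !horner_hyp horner_hyp1.
    have := h (1 - s); rewrite subKr => ->; last by apply/andP; split; lra.
    by rewrite subrr.
  have m s (s01 : 0 <= s <= 1) := rim_match i PM s01.
  move/(oppP G) : oPu => E; rewrite E in m.
  rewrite (Z (X P i) _ (fun s h => (m s h).1)) (Z (Y P i) _ (fun s h => (m s h).2)).
  rewrite deriv_comp derivB derivX -polyC1 derivC sub0r mulrN1 mulrN polyC1.
  by rewrite int01N -comp_polyM int01_rev.
case: ifP => // PM; have m s (s01 : 0 <= s <= 1) := rim_match i PM s01.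
rewrite o0 in m.
rewrite (_ : (X P i).[1 - 'X] = 0) ?mul0r ?int010//.
apply: (poly_itv_eq0 (ltr01 : 0 < (1 : R))) => s /m[h _].
by rewrite horner_hyp.
Qed.

(** Shifting the index pairs the two traces on each spoke, to which [int01_spoke] applies; the
    parameter [1] is the vertex and [0] the barycenter. *)
Lemma sum_jacobian P : P \in cells M ->
  \sum_i tri (jacobian P i) =
  \sum_i int01 ((X P i).[1 - 'X] * ((Y P i).[1 - 'X])^`())
  + \sum_i (int01 (spoke_jump X P i * (sE (Y P i))^`())
            - int01 ((tE (X P (i - 1)))^`() * spoke_jump Y P i))
  + (\sum_i (tE (X P (i - 1))).[1] * (spoke_jump Y P i).[1]
     - \sum_i (tE (X P (i - 1))).[0] * (spoke_jump Y P i).[0]).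
Proof.
move=> PM; rewrite -addrA -sumrB -!big_split /= /jacobian.
under eq_bigr do rewrite tri_jacobian.
rewrite sumrB [X in _ - X](reindex_inj (addIr (- 1 : 'I_3))) /=.
rewrite -sumrB; apply: eq_bigr => i _.
rewrite -addrA int01_spoke /spoke_jump; ring.
Qed.

Lemma size_spoke_jump (Z : {set V} -> 'I_3 -> bp) P i :
  (forall j, tdeg k (Z P j)) -> (size (spoke_jump Z P i) <= k.+1)%N.
Proof.
move=> tZ; rewrite (leq_trans (size_polyD _ _))// size_polyN geq_max.
by rewrite size_sE ?size_tE.
Qed.

Lemma jump_energyE P i : jump_energy P i =
  int01 (spoke_jump X P i ^+ 2) + int01 (spoke_jump Y P i ^+ 2).
Proof. exact: int01D. Qed.

(** Young's inequality puts the small factor [eta] on the tangential derivatives, bounded by the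
    gradient through the trace inequality, and the large one on the jumps. *)
Lemma spoke_bound (C eta : R) P : P \in cells M -> 0 < C -> 0 < eta ->
  (forall F : bp, tdeg k F -> int01 (sE F ^+ 2) <= C * tri (F ^+ 2) /\
                              int01 (tE F ^+ 2) <= C * tri (F ^+ 2)) ->
  \sum_i (int01 (spoke_jump X P i * (sE (Y P i))^`())
          - int01 ((tE (X P (i - 1)))^`() * spoke_jump Y P i)) <=
  eta * C * \sum_i (2 * g * grad_energy P i) + eta^-1 * \sum_i jump_energy P i.
Proof.
move=> PM C0 e0 hC.
have step i : int01 (spoke_jump X P i * (sE (Y P i))^`())
          - int01 ((tE (X P (i - 1)))^`() * spoke_jump Y P i) <=
    eta * C * (tri ((Y P i)^`() ^+ 2) + tri (dY (X P (i - 1)) ^+ 2)) + eta^-1 * jump_energy P i.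
  have := int01_young (spoke_jump X P i) (sE (Y P i))^`() e0.
  have := int01_young (spoke_jump Y P i) (tE (X P (i - 1)))^`() e0.
  rewrite !ler_norml [spoke_jump Y P i * _]mulrC => /andP[h1 _] /andP[_ h2].
  have [h3 _] := hC _ (tdegW (leq_pred k) (tdeg_deriv (tY i PM))).
  have [_ h4] := hC _ (tdegW (leq_pred k) (tdeg_dY (tX (i - 1) PM))).
  have := ler_wpM2l (ltW e0) h3; have := ler_wpM2l (ltW e0) h4.
  rewrite jump_energyE -deriv_sE -deriv_tE.
  move: (int01 _) (int01 _) (int01 _) (int01 _) (int01 _) (int01 _) (tri _) (tri _) h1 h2.
  by move=> *; lra.
apply: (le_trans (ler_sum _ (fun i _ => step i))).
rewrite big_split /= -!mulr_sumr lerD2r big_split /=.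
rewrite (ler_wpM2l (mulr_ge0 (ltW e0) (ltW C0)))//.
rewrite (ord3_shift (fun i => tri (dY (X P i) ^+ 2))).
rewrite -big_split ?mulr_sumr /=; apply: ler_sum => i _; have [_] := korn_cell i PM; apply: le_trans.
rewrite !triD; have := tri_sqr_ge0 (X P i)^`(); have := tri_sqr_ge0 (dY (Y P i)); lra.
Qed.

(** The three sub-cells form a cycle around the barycenter, so a constant may be subtracted from
    [X]; what remains is a quadratic form in the jumps, dominated by their squares. *)
Lemma center_bound (C : R) P : P \in cells M ->
  (forall q : {poly R}, (size q <= k.+1)%N ->
     q.[0] ^+ 2 <= C * int01 (q ^+ 2) /\ q.[1] ^+ 2 <= C * int01 (q ^+ 2)) ->
  - \sum_i (tE (X P (i - 1))).[0] * (spoke_jump Y P i).[0] <=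
  C * \sum_i jump_energy P i.
Proof.
move=> PM hC.
have e (Z : {set V} -> 'I_3 -> bp) i :
    (spoke_jump Z P i).[0] = (Z P i).[0, 0] - (Z P (i - 1)).[0, 0].
  by rewrite /spoke_jump hornerD hornerN horner_sE /tE polyC0.
apply: (@le_trans _ _ (\sum_i ((spoke_jump X P i).[0] ^+ 2 + (spoke_jump Y P i).[0] ^+ 2))).
  have e' i : (tE (X P (i - 1))).[0] = (X P (i - 1)).[0, 0] by rewrite /tE polyC0.
  rewrite !(ord3_sum _ 0) !e !e' !add0r subrr.
  rewrite (_ : -1 - 1 = 1 :> 'I_3); last exact: val_inj.
  set x0 := (X P 0).[_, _]; set x1 := (X P 1).[_, _]; set x2 := (X P (-1)).[_, _].
  set y0 := (Y P 0).[_, _]; set y1 := (Y P 1).[_, _]; set y2 := (Y P (-1)).[_, _].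
  have := sqr_ge0 ((x2 - x0) + (y0 - y2)); have := sqr_ge0 ((x1 - x0) + (y2 - y1)).
  have := sqr_ge0 (x2 - x1); have := sqr_ge0 (y1 - y0).
  have := sqr_ge0 (x2 - x0); have := sqr_ge0 (y0 - y2).
  have := sqr_ge0 (x1 - x0); have := sqr_ge0 (y2 - y1).
  lra.
rewrite mulr_sumr; apply: ler_sum => i _; rewrite jump_energyE mulrDr.
have [hx _] := hC _ (size_spoke_jump i (fun j => tX j PM)).
have [hy _] := hC _ (size_spoke_jump i (fun j => tY j PM)).
exact: lerD.
Qed.

Lemma vertex_bound (C : R) :
  (forall q : {poly R}, (size q <= k.+1)%N ->
     q.[0] ^+ 2 <= C * int01 (q ^+ 2) /\ q.[1] ^+ 2 <= C * int01 (q ^+ 2)) ->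
  \sum_(P in cells M) \sum_i (tE (X P (i - 1))).[1] * (spoke_jump Y P i).[1] <=
  (2 * packing_bound gamma)%:R * C * \sum_(P in cells M) \sum_i jump_energy P i.
Proof.
move=> hC.
(* [y] and [x] are the values at vertex [i] seen from the sub-cells [i - 1] and [i]; continuity
   across the rim makes [x] the value of [y] at the next corner. *)
pose y (Z : {set V} -> 'I_3 -> bp) (t : {set V} * 'I_3) : R :=
  if t.1 \in cells M then (Z t.1 (t.2 - 1)).[0, 1] else 0.
pose x (Z : {set V} -> 'I_3 -> bp) (t : {set V} * 'I_3) : R :=
  if t.1 \in cells M then (Z t.1 t.2).[1, 0] else 0.
(* Corners are labelled by their vertex, so that [packing] bounds the classes; pairs outside the
   mesh form classes of their own. *)
pose lab (t : {set V} * 'I_3) : V + {set V} * 'I_3 :=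
  if t.1 \in cells M then inl (vert t.1 t.2) else inr t.
have se (Z : {set V} -> 'I_3 -> bp) P i :
    (spoke_jump Z P i).[1] = (Z P i).[1, 0] - (Z P (i - 1)).[0, 1].
  by rewrite /spoke_jump hornerD hornerN horner_sE /tE polyC0.
have te i P : (tE (X P (i - 1))).[1] = (X P (i - 1)).[0, 1] by rewrite /tE polyC0.
have z01 : 0 <= (0 : R) <= 1 by rewrite lexx ler01.
have o01 : 0 <= (1 : R) <= 1 by rewrite lexx ler01.
have cyc : `|\sum_t y X t * (x Y t - y Y t)| <= (2 * packing_bound gamma)%:R *
    \sum_t ((x X t - y X t) ^+ 2 + (x Y t - y Y t) ^+ 2).
  apply: (cyclic_sum (lab := lab) (next_prev_at G)).
  - move=> [P i] u; rewrite /next_at; case E : (opp _ _ _) => [w|]//= -[<-].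
    have /(oppP G) oPw := E; have /and4P[/= PM QM /eqP h1 /eqP h2] := oPw.
    have := rim_match i PM z01; rewrite E subr0 => -[hX hY].
    by rewrite /lab /y /x /= PM QM h2 addrK.
  - move=> [P i]; rewrite /next_at; case E : (opp _ _ _) => [//|]/= _.
    rewrite /x /=; case: ifP => // PM.
    by have := rim_match i PM z01; rewrite E subr0.
  - move=> [P i]; rewrite /prev_at /= => E; rewrite /y /=; case: ifP => // PM.
    by have := rim_match (i - 1) PM o01; rewrite E subrr.
  move=> t; have [tM|tM] := boolP (t.1 \in cells M); last first.
    apply: (@leq_trans 1); last by rewrite /packing_bound muln_gt0.
    rewrite -[X in (_ <= X)%N](card1 t) subset_leq_card//; apply/fintype.subsetP => u; rewrite !inE /lab.
    by rewrite (negPf tM); case: ifP => // _ /eqP[->].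
  apply: leq_trans (packing (labelled_card3 G) (labelled_solid G) (labelled_conforming G) reg (vert t.1 t.2)).
  rewrite -(card_in_imset (f := fst)).
    apply/subset_leq_card/fintype.subsetP => P /imsetP[u]; rewrite !inE /lab tM.
    by case: ifP => // uM /eqP[h] ->; rewrite uM -h (mem_vert G).
  move=> [P i] [Q j]; rewrite !inE /lab tM /=.
  by case: ifP => // PM /eqP[h1]; case: ifP => // QM /eqP[h2] E; rewrite -E -h1 in h2 *;
    rewrite (vert_inj G PM h2).
rewrite (eq_bigr (fun P => \sum_i y X (P, i) * (x Y (P, i) - y Y (P, i)))); last first.
  by move=> P PM; apply: eq_bigr => i _; rewrite se te /y /x /= PM.
rewrite [leLHS]sum_cells_pairs [leLHS](eq_bigr (fun t => y X t * (x Y t - y Y t))); last first.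
  move=> [P i] _; rewrite /y /x /=; case PM : (P \in cells M); by rewrite ?mul0r.
apply: (le_trans (ler_norm _)); apply: (le_trans cyc).
rewrite -mulrA ler_wpM2l ?ler0n// mulr_sumr.
under [leRHS]eq_bigr do rewrite mulr_sumr.
rewrite sum_cells_pairs; apply: ler_sum => -[P i] _; rewrite /x /y /=.
case: ifP => PM; last by rewrite !subrr expr0n addr0.
rewrite jump_energyE mulrDr -!se.
have [_ hx] := hC _ (size_spoke_jump i (fun j => tX j PM)).
have [_ hy] := hC _ (size_spoke_jump i (fun j => tY j PM)).
exact: lerD.
Qed.

Lemma grad_energy_ge0 P i : P \in cells M -> 0 <= grad_energy P i.
Proof.
move=> PM; rewrite mulr_ge0 ?(ltW (jac_gt0 G PM))//; apply: tri_ge0 => s t _ _ _.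
by rewrite grad_sqrE divr_ge0 ?sqr_ge0// !addr_ge0 ?sqr_ge0.
Qed.

Lemma jump_energy_ge0 P i : 0 <= jump_energy P i.
Proof. by rewrite jump_energyE addr_ge0 ?int01_sqr_ge0. Qed.

Lemma korn_mesh (C1 C2 : R) : 0 < C1 ->
  (forall F : bp, tdeg k F -> int01 (sE F ^+ 2) <= C1 * tri (F ^+ 2) /\
                              int01 (tE F ^+ 2) <= C1 * tri (F ^+ 2)) ->
  (forall q : {poly R}, (size q <= k.+1)%N ->
     q.[0] ^+ 2 <= C2 * int01 (q ^+ 2) /\ q.[1] ^+ 2 <= C2 * int01 (q ^+ 2)) ->
  \sum_(P in cells M) \sum_i grad_energy P i <=
  120 * g ^+ 2 * (\sum_(P in cells M) \sum_i strain_energy P i) +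
  4 * (8 * C1 * (g + 1) + C2 + (2 * packing_bound gamma)%:R * C2) *
    \sum_(P in cells M) \sum_i jump_energy P i.
Proof.
move=> C10 hC1 hC2.
have g0 : 0 <= g by exact: normr_ge0.
(* Chosen so that the gradient part of the spoke terms is at most a quarter of [GG]; after the
   factor [2] of [h1], half of [GG] is absorbed. *)
pose eta := (8 * C1 * (g + 1))^-1.
have d0 : 0 < 8 * C1 * (g + 1) by rewrite !mulr_gt0//; lra.
have e0 : 0 < eta by rewrite invr_gt0.
set GG := \sum_(P in cells M) \sum_i grad_energy P i.
set SS := \sum_(P in cells M) \sum_i strain_energy P i.
set JJ := \sum_(P in cells M) \sum_i jump_energy P i.
have GG0 : 0 <= GG by apply: sumr_ge0 => P PM; apply: sumr_ge0 => i _; exact: grad_energy_ge0.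
have h1 : GG <= 60 * g ^+ 2 * SS + 2 * \sum_(P in cells M) \sum_i tri (jacobian P i).
  rewrite /SS !mulr_sumr -big_split /=; apply: ler_sum => P PM.
  rewrite !mulr_sumr -big_split /=; apply: ler_sum => i _.
  by have [] := korn_cell i PM.
have h2 : \sum_(P in cells M) \sum_i tri (jacobian P i) <=
    eta * C1 * (2 * g * GG) + eta^-1 * JJ
    + ((2 * packing_bound gamma)%:R * C2 * JJ + C2 * JJ).
  rewrite (eq_bigr _ sum_jacobian) !big_split /= sum_rims add0r.
  apply: lerD.
    rewrite /GG /JJ !mulr_sumr -big_split /=; apply: ler_sum => P PM.
    by apply: le_trans (spoke_bound PM C10 e0 hC1) _; rewrite [X in _ <= _ * X + _]mulr_sumr.
  apply: lerD; first exact: vertex_bound.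
  rewrite /JJ mulr_sumr; apply: ler_sum => P PM; exact: center_bound.
have h3 : eta * C1 * (2 * g * GG) <= 4^-1 * GG.
  rewrite (_ : eta * C1 * (2 * g * GG) = (eta * (C1 * 2 * g)) * GG); last by ring.
  rewrite ler_wpM2r// /eta mulrC ler_pdivrMr//; have := mulr_ge0 (ltW C10) g0; lra.
by move: h1 h2 h3; rewrite /eta invrK; lra.
Qed.
End fixed_mesh.
End korn.

(** * Discrete stresses and the inf-sup condition *)

Section stress_fields.
Context {R : realType}.
Notation bp := {poly {poly R}}.

Definition coor (a : R * R) (j : 'I_2) : R := if j == 0 then a.1 else a.2.

(** The factor [J^-1 ^+ 2] makes the form and, up to shape regularity, the squared norm of the
    stress both scale as [1 / J], like the strain and jump terms they are compared with. *)
Definition tensor (J : R) (a b : R * R) (fp fq fr : bp) (j l : 'I_2) : bp :=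
  (J^-1 ^+ 2)%:P *: ((coor a j * coor b l + coor b j * coor a l)%:P *: fp
    + (coor a j * coor a l)%:P *: fq + (coor b j * coor b l)%:P *: fr).

Lemma tensorC J a b fp fq fr j l :
  tensor J a b fp fq fr j l = tensor J a b fp fq fr l j.
Proof. by rewrite /tensor [X in X%:P *: fp]addrC ![coor a l * _]mulrC ![coor b l * _]mulrC. Qed.

Lemma horner_tensor J a b fp fq fr j l s t :
  (tensor J a b fp fq fr j l).[s, t] = (fp.[s, t] * (coor a j * coor b l + coor b j * coor a l)
    + fq.[s, t] * (coor a j * coor a l) + fr.[s, t] * (coor b j * coor b l)) / J ^+ 2.
Proof. by rewrite horner2Z !horner2D !horner2Z exprVn; ring. Qed.

Lemma tensor_sqr_bound J a b (g : R) fp fq fr s t : 0 < J ->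
  dot a a <= g * J -> dot b b <= g * J ->
  (tensor J a b fp fq fr 0 0).[s, t] ^+ 2 + (tensor J a b fp fq fr 0 1).[s, t] ^+ 2 +
  ((tensor J a b fp fq fr 1 0).[s, t] ^+ 2 + (tensor J a b fp fq fr 1 1).[s, t] ^+ 2)
  <= 48 * g ^+ 2 / J ^+ 2 * (fp.[s, t] ^+ 2 + fq.[s, t] ^+ 2 + fr.[s, t] ^+ 2).
Proof.
move=> J0; rewrite /dot -!expr2 => ha hb.
have cb x : dot x x <= g * J -> forall j, `|coor x j| ^+ 2 <= g * J.
  rewrite /dot -!expr2 => hx j; rewrite real_normK ?num_real// /coor.
  by have := sqr_ge0 x.1; have := sqr_ge0 x.2; case: ifP => _; lra.
have pb (x y : R) : `|x| ^+ 2 <= g * J -> `|y| ^+ 2 <= g * J -> `|x * y| <= g * J.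
  by move=> hx hy; rewrite normrM; have := sqr_ge0 (`|x| - `|y|); lra.
have ca j := cb a ha j; have cb' j := cb b hb j.
have gJ : 0 <= g * J by apply: le_trans ha; rewrite addr_ge0 ?sqr_ge0.
have e j l : (tensor J a b fp fq fr j l).[s, t] ^+ 2 <=
    12 * g ^+ 2 / J ^+ 2 * (fp.[s, t] ^+ 2 + fq.[s, t] ^+ 2 + fr.[s, t] ^+ 2).
  rewrite horner_tensor expr_div_n ler_pdivrMr ?exprn_gt0//.
  apply: le_trans (sqr_comb_bound (r := 2 * (g * J)) _ _ _ _ _ _) _.
  - by apply: le_trans (ler_normD _ _) _; have := pb _ _ (ca j) (cb' l); have := pb _ _ (cb' j) (ca l); lra.
  - by have := pb _ _ (ca j) (ca l); lra.
  - by have := pb _ _ (cb' j) (cb' l); lra.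
  by rewrite le_eqVlt; apply/orP; left; apply/eqP; field; rewrite gt_eqF.
have := e 0 0; have := e 0 1; have := e 1 0; have := e 1 1; lra.
Qed.

Definition divergence (J : R) a b (X Y : bp) (T : 'I_2 -> 'I_2 -> bp) : bp :=
  (J^-1)%:P *: (X * (b.2%:P *: (T 0 0)^`() - a.2%:P *: dY (T 0 0) + (a.1%:P *: dY (T 0 1) - b.1%:P *: (T 0 1)^`()))
     + Y * (b.2%:P *: (T 1 0)^`() - a.2%:P *: dY (T 1 0) + (a.1%:P *: dY (T 1 1) - b.1%:P *: (T 1 1)^`()))).

Lemma horner2M (F F' : bp) s t : (F * F').[s, t] = F.[s, t] * F'.[s, t].
Proof. by rewrite !hornerM. Qed.
Lemma horner2N (F : bp) s t : (- F).[s, t] = - F.[s, t].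
Proof. by rewrite !hornerN. Qed.

(** The derivatives along [a] and [b] are those in [s] and [t], so the divergence of [a b^T f] is
    [a] times the [t] derivative of [f], and pairing with [v] leaves oblique components. *)
Lemma divergence_tensor J a b X Y fp fq fr : J = cross a b -> J != 0 ->
  divergence J a b X Y (tensor J a b fp fq fr) =
  (J^-1 ^+ 2)%:P *: (along a X Y * dY fp + along b X Y * fp^`() + along a X Y * fq^`()
                     + along b X Y * dY fr).
Proof.
move=> JE J0; apply: bipoly_ext => s t.
have dt j l : (tensor J a b fp fq fr j l)^`() = tensor J a b fp^`() fq^`() fr^`() j l.
  by rewrite /tensor !(derivZ, derivD).
have yt j l : dY (tensor J a b fp fq fr j l) = tensor J a b (dY fp) (dY fq) (dY fr) j l.
  by rewrite /tensor !(dYZ, dYD).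
rewrite /divergence !dt !yt /along.
rewrite !(horner2Z, horner2D, horner2M, horner2N, horner_tensor) /coor /= exprVn.
move: X.[s, t] Y.[s, t] (_ fp).[s, t] (_ fp).[s, t] fp^`().[s, t] (_ fq).[s, t] fq^`().[s, t] (dY fr).[s, t] fr^`().[s, t].
move: J0; rewrite JE /cross => J0 *; field; exact: J0.
Qed.
End stress_fields.

Section int_edge_ext.
Context {R : realType} {V : finType} (M : mesh R V).

Lemma int_edge_ext (e : {set V}) (f g : R * R -> R) :
  (forall x, geom M e x -> f x = g x) -> int_edge M e f = int_edge M e g.
Proof.
move=> fg; rewrite /int_edge; case E : (enum e) => [|a [|b [|]]]//.
congr (_ * _); apply: eq_Rintegral => s; rewrite inE/= => s01; apply: fg.
have ab : a != b by have := enum_uniq e; rewrite E /= inE andbT.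
have -> : e = [set a; b]%SET by apply/finset.setP => c; rewrite -mem_enum E !inE.
by rewrite /geom hull_set2//; exists s.
Qed.
End int_edge_ext.

(** * The mesh stress assembled from reference stresses *)

Section discrete_stress.
Context {R : realType} {V : finType} (M : mesh R V) (vert : {set V} -> 'I_3 -> V).
Notation bp := {poly {poly R}}.
Notation p := (pos M).
Notation W := (V + {set V})%type.
Implicit Types (P Q : {set V}) (i : 'I_3) (e K : {set W}).
Hypothesis G : labelled_mesh M vert.
Notation arm := (arm M vert).
Notation jac := (jac M vert).
Notation subcell := (subcell vert).
Notation ptm := (pt M vert).
Context (Omega : set (R * R)) (nu : {set W} -> 'cV[R]_2) (k : nat) (gamma : R).
Hypothesis reg : shape_regular gamma M.
Hypothesis Hnu : unit_normals Omega (refine M) nu.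

Context (that : {set V} -> @sfield R) (tau : dgfield R W 2 2).
Hypothesis adm : forall P, admissible k (that P).

Definition cell_tensor P i := tensor (jac P) (arm P i) (arm P (i + 1))
  (fp (that P) i) (fq (that P) i) (fr (that P) i).

Hypothesis Htau : forall P i z, P \in cells M -> forall j l,
  tau (subcell P i) (ptm P i z) j l = (cell_tensor P i j l).[z.1, z.2].

Lemma pt_surj P i x : P \in cells M -> exists z, x = ptm P i z.
Proof.
move=> PM; exists (affinv (cen M P) (arm P i) (arm P (i + 1)) x).
by rewrite /pt affinvK// (cross_arm G)// lt0r_neq0// (jac_gt0 G).
Qed.

Lemma tau_piecewise_poly : piecewise_poly k (refine M) tau.
Proof.
move=> K /(mem_refine G)[P PM [i ->]] j l; apply/poly_leP.
have D0 : cross (arm P i) (arm P (i + 1)) != 0.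
  by rewrite (cross_arm G)// lt0r_neq0// (jac_gt0 G).
have -> : (fun x => tau (subcell P i) x j l) =
    (fun z : R * R => (cell_tensor P i j l).[z.1, z.2]) \o
      affinv (cen M P) (arm P i) (arm P (i + 1)).
  apply/funext => x.
  by have := Htau i (affinv (cen M P) (arm P i) (arm P (i + 1)) x) PM j l; rewrite /pt affinvK.
rewrite (funext (affinv_affmap _ _ _)); apply: polyfun_affmap.
exists (cell_tensor P i j l) => //; have [/(_ i)[hp hq hr] _ _] := adm P.
by apply: tdegZ; do 2?[apply: tdegD]; apply: tdegZ.
Qed.

Lemma tau_symmetric K : K \in cells (refine M) -> forall x, (tau K x)^T = tau K x.
Proof.
move=> /(mem_refine G)[P PM [i ->]] x; have [z ->] := pt_surj i x PM.
by apply/matrixP => j l; rewrite !mxE !Htau// /cell_tensor tensorC.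
Qed.

Lemma mulmx_col2 (A : 'M[R]_2) (n : 'cV[R]_2) j :
  (A *m n) j 0 = A j 0 * n 0 0 + A j 1 * n 1 0.
Proof.
rewrite !mxE !big_ord_recl big_ord0 addr0.
by congr (_ + _); congr (_ * _); congr (_ _ _); apply: val_inj.
Qed.

(* On a spoke only the component of the normal stress along the other arm
   survives, and the two admissibility conditions make both coefficients
   cancel. *)
Lemma tau_normal_continuous e : e \in dual_edges M -> forall x,
  geom (refine M) e x -> jump_normal (refine M) nu tau e x = 0.
Proof.
move=> /(dualP G)[P PM [i ->]] x /spoke_pt[s _ ->].
have [r [l [_ o1 o2 nE]]] := orient_spoke G Hnu i PM.
rewrite /jump_normal /jump (sum_spoke G)// o1 o2 scaleNr -scalerBr.
apply/matrixP => j c; rewrite ord1 mxE [X in _ * X]mxE [X in _ + X]mxE [RHS]mxE {c}.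
rewrite !mulmx_col2.
have [_ a1 a2] := adm P.
have e1 : (fr (that P) i).[s, 0] = (fq (that P) (i - 1)).[0, s].
  by rewrite -horner_sE a1 /tE polyC0.
have e2 : (fq (that P) (i - 1)).[0, s] = (fp (that P) i).[s, 0] + (fp (that P) (i - 1)).[0, s].
  by rewrite -e1 -!horner_sE a2 hornerD /tE polyC0.
have t1 m : tau (subcell P i) (ptm P i (s, 0)) j m = (cell_tensor P i j m).[s, 0].
  exact: Htau.
have t2 m : tau (subcell P (i - 1)) (ptm P i (s, 0)) j m = (cell_tensor P (i - 1) j m).[0, s].
  by rewrite -(@pt_prev _ _ M vert P i s PM) Htau.
rewrite !t1 !t2 /cell_tensor !horner_tensor subrK.
rewrite e1 e2 (armB G)// nE !mxE /perp.
move: (fp _ _).[_, _] (fp _ _).[_, _] => p1 p2.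
case: (arm P i) (arm P (i + 1)) => [a1' a2'] [b1 b2].
by rewrite /coor !coordE; case: (j == 0) => /=; ring.
Qed.

Definition tensor_energy P i : bp := cell_tensor P i 0 0 ^+ 2 + cell_tensor P i 0 1 ^+ 2 +
  (cell_tensor P i 1 0 ^+ 2 + cell_tensor P i 1 1 ^+ 2).

Lemma horner_tensor_energy P i s t : (tensor_energy P i).[s, t] =
  (cell_tensor P i 0 0).[s, t] ^+ 2 + (cell_tensor P i 0 1).[s, t] ^+ 2 +
  ((cell_tensor P i 1 0).[s, t] ^+ 2 + (cell_tensor P i 1 1).[s, t] ^+ 2).
Proof. by rewrite /tensor_energy !horner2D !horner_exp. Qed.

Lemma L2norm_formula : L2norm (refine M) tau =
  Num.sqrt (\sum_(P in cells M) \sum_i jac P * tri (tensor_energy P i)).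
Proof.
rewrite /L2norm (sum_refine G); congr Num.sqrt.
apply: eq_bigr => P PM; apply: eq_bigr => i _; apply: int_subcell => // z.
by rewrite horner_tensor_energy mdot_mx2 !Htau.
Qed.

Lemma L2norm_sqr_bound : L2norm (refine M) tau ^+ 2 <= 48 * `|2 * gamma| ^+ 2 *
  \sum_(P in cells M) (\sum_i tri (fp (that P) i ^+ 2 + fq (that P) i ^+ 2
    + fr (that P) i ^+ 2)) / jac P.
Proof.
rewrite L2norm_formula sqr_sqrtr; last first.
  apply: sumr_ge0 => P PM; apply: sumr_ge0 => i _; rewrite mulr_ge0//.
    by rewrite ltW// (jac_gt0 G).
  by apply: tri_ge0 => s t _ _ _; rewrite horner_tensor_energy !addr_ge0 ?sqr_ge0.
rewrite mulr_sumr; apply: ler_sum => P PM; have J0 := jac_gt0 G PM.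
rewrite mulrA mulrC mulr_sumr mulr_sumr; apply: ler_sum => i _.
rewrite -!triZ; apply: tri_le => s t.
rewrite !horner2Z horner_tensor_energy !horner2D !horner_exp.
have := tensor_sqr_bound (fp (that P) i) (fq (that P) i) (fr (that P) i) s t
  J0 (arm_bound_norm G reg i PM) (arm_bound_norm G reg (i + 1) PM).
move/(ler_wpM2l (ltW J0))/le_trans; apply.
by rewrite le_eqVlt; apply/orP; left; apply/eqP; field; rewrite gt_eqF.
Qed.

Section bilinear_form.
Context (v : dgfield R W 2 1) (X Y : {set V} -> 'I_3 -> bp).
Hypothesis Hv : Uh0 Omega k M nu v.
Hypothesis HX : forall P i z, P \in cells M ->
  v (subcell P i) (ptm P i z) 0 0 = (X P i).[z.1, z.2].
Hypothesis HY : forall P i z, P \in cells M ->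
  v (subcell P i) (ptm P i z) 1 0 = (Y P i).[z.1, z.2].

Definition power P i (n : 'cV[R]_2) : bp :=
  X P i * ((n 0 0)%:P *: cell_tensor P i 0 0 + (n 1 0)%:P *: cell_tensor P i 0 1) +
  Y P i * ((n 0 0)%:P *: cell_tensor P i 1 0 + (n 1 0)%:P *: cell_tensor P i 1 1).

Lemma powerP P i n z : P \in cells M ->
  mdot (v (subcell P i) (ptm P i z)) (tau (subcell P i) (ptm P i z) *m n) =
  (power P i n).[z.1, z.2].
Proof.
move=> PM; rewrite mdot_col2 !mulmx_col2 HX// HY// !Htau//.
by rewrite /power !horner2D !horner2M !horner2D !horner2Z; ring.
Qed.

Lemma div_power P i : P \in cells M -> int_cell (refine M) (subcell P i)
    (fun x => mdot (v (subcell P i) x) (divg (tau (subcell P i)) x)) =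
  (jac P)^-1 * tri (along (arm P i) (X P i) (Y P i) * dY (fp (that P) i)
   + along (arm P (i + 1)) (X P i) (Y P i) * (fp (that P) i)^`()
   + along (arm P i) (X P i) (Y P i) * (fq (that P) i)^`()
   + along (arm P (i + 1)) (X P i) (Y P i) * dY (fr (that P) i)).
Proof.
move=> PM; have J0 := jac_gt0 G PM.
have D0 : cross (arm P i) (arm P (i + 1)) != 0 by rewrite (cross_arm G)// gt_eqF.
rewrite (int_subcell G (F := divergence (jac P) (arm P i) (arm P (i + 1)) (X P i) (Y P i)
   (cell_tensor P i)))//; last first.
  move=> z; rewrite mdot_col2 !mxE !big_ord_recl !big_ord0 !addr0.
  have dE j l := derive_unitv (f := fun y => tau (subcell P i) y j l) z
    (fun z => Htau i z PM j l) D0.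
  rewrite HX// HY// (_ : lift ord0 ord0 = 1); last exact: val_inj.
  have [-> _] := dE 0 0; have [_ ->] := dE 0 1; have [-> _] := dE 1 0; have [_ ->] := dE 1 1.
  rewrite /divergence (cross_arm G)//; move: (cell_tensor P i) => T.
  rewrite !(horner2Z, horner2D, horner2M, horner2N).
  by ring.
rewrite divergence_tensor ?(cross_arm G)// ?gt_eqF// triZ mulrA; congr (_ * _).
by field; rewrite gt_eqF.
Qed.

Lemma powerZ P i r n : power P i (r *: n) = r%:P *: power P i n.
Proof.
apply: bipoly_ext => s t.
by rewrite /power !(horner2Z, horner2D, horner2M) !mxE; ring.
Qed.

(** The length of the rim times its outward normal is [perp] of the difference of the arms, whose
    product with either arm is [jac P]. *)
Lemma rim_power P i : P \in cells M ->
  int_edge (refine M) (rim vert P i) (fun x =>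
    mdot (v (subcell P i) x) (orientation (refine M) nu (subcell P i) (rim vert P i) *:
      (tau (subcell P i) x *m nu (rim vert P i)))) =
  (jac P)^-1 * int01 ((fp (that P) i * (along (arm P i) (X P i) (Y P i)
      + along (arm P (i + 1)) (X P i) (Y P i))
    + fq (that P) i * along (arm P i) (X P i) (Y P i)
    + fr (that P) i * along (arm P (i + 1)) (X P i) (Y P i)).[1 - 'X]).
Proof.
move=> PM; have J0 := jac_gt0 G PM.
have [nE _ _] := orient_rim G Hnu i PM.
set o := orientation _ _ _ _ in nE *; set n := nu _ in nE *.
rewrite (int_rim G (q := (power P i (o *: n)).[1 - 'X]))//; last first.
  by move=> s; rewrite scalemxAr powerP// horner_hyp.
rewrite -int01CM -hornerZ -powerZ nE -int01CM -hornerZ; congr (int01 _.[_]).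
apply: bipoly_ext => s t.
have -> : p (vert P (i + 1)) - p (vert P i) = arm P (i + 1) - arm P i.
  by rewrite !(pos_arm M); apply: pair_eq; rewrite !coordE; ring.
rewrite /power /cell_tensor /along -(cross_arm G i PM) !mxE /perp.
rewrite -(cross_arm G i PM) in J0.
rewrite !(horner2Z, horner2D, horner2M, horner_tensor) /coor.
move: (fp _ _).[_, _] (fq _ _).[_, _] (fr _ _).[_, _] (X P i).[_, _] (Y P i).[_, _] J0.
case: (arm P i) (arm P (i + 1)) => [a1 a2] [b1 b2] fps fqs frs x y.
rewrite !coordE /cross /= => J0; field; by rewrite gt_eqF.
Qed.

(** As [v] does not jump across a primal edge, its trace may be replaced by the value from each
    adjacent cell separately. *)
Lemma edge_power P i : P \in cells M ->
  int_edge (refine M) (rim vert P i) (fun x =>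
    mdot (trace_on (refine M) v (rim vert P i) x)
         (jump_normal (refine M) nu tau (rim vert P i) x)) =
  \sum_(K in cells (refine M) | rim vert P i \in sides K)
    int_edge (refine M) (rim vert P i) (fun x => mdot (v K x)
      (orientation (refine M) nu K (rim vert P i) *: (tau K x *m nu (rim vert P i)))).
Proof.
move=> PM; set e := rim vert P i.
pose F K x := mdot (v K x) (orientation (refine M) nu K e *: (tau K x *m nu e)).
have mdotD (A B C : 'cV[R]_2) : mdot A (B + C) = mdot A B + mdot A C.
  by rewrite !mdot_col2 !mxE; ring.
have q1 s : F (subcell P i) (ptm P i (1 - s, s)) =
    (power P i (orientation (refine M) nu (subcell P i) e *: nu e)).[1 - 'X].[s].
  by rewrite /F scalemxAr powerP// horner_hyp.
rewrite (sum_rim G) // (int_rim G PM q1).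
case E : (opp _ _ _) => [u|]; last first.
  rewrite addr0 -(int_rim G PM q1); apply: int_edge_ext => x xe.
  have [-> _] := rim_trace G Hnu Hv PM xe.
  by rewrite /jump_normal /jump (sum_rim G)// E addr0.
have oPu := E; move/(oppP G) : oPu => oPu; have /and4P[/= _ QM _ _] := oPu.
have q2 s : F (subcell u.1 u.2) (ptm P i (1 - s, s)) =
    ((power u.1 u.2 (orientation (refine M) nu (subcell u.1 u.2) e *: nu e)).[1 - 'X] \Po (1 - 'X)).[s].
  by rewrite horner_comp horner_hyp horner_hyp1 subKr -(opposite_pt s oPu) /F scalemxAr powerP.
rewrite (int_rim G PM q2) -mulrDr -int01D.
have q12 s := etrans (congr2 +%R (q1 s) (q2 s)) (esym (hornerD _ _ _)).
rewrite -(int_rim G (f := fun x => F (subcell P i) x + F (subcell u.1 u.2) x) PM q12).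
apply: int_edge_ext => x xe; have [-> ] := rim_trace G Hnu Hv PM xe.
by rewrite E /F => ->; rewrite /jump_normal /jump (sum_rim G)// E mdotD.
Qed.

(** On each sub-triangle the divergence theorem is applied to the four products of stress and
    displacement; the hypotenuse terms cancel those of [rim_power]. *)
Lemma bstar_formula : bstar M nu v tau = \sum_(P in cells M)
  bhat (fun i => along (arm P i) (X P i) (Y P i))
       (fun i => along (arm P (i + 1)) (X P i) (Y P i)) (that P) / jac P.
Proof.
rewrite /bstar (sum_refine G).
rewrite (eq_bigr (fun e => \sum_(K in cells (refine M) | e \in sides K)
    int_edge (refine M) e (fun x => mdot (v K x)
      (orientation (refine M) nu K e *: (tau K x *m nu e))))); last first.
  by move=> e /(mem_primal G)[P PM [i ->]]; exact: edge_power.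
rewrite (sum_primal_sides G (fun e K => int_edge (refine M) e (fun x => mdot (v K x)
      (orientation (refine M) nu K e *: (tau K x *m nu e))))).
rewrite -sumrN -big_split /=; apply: eq_bigr => P PM.
rewrite -sumrN -big_split /= /bhat mulr_suml; apply: eq_bigr => i _.
rewrite div_power// rim_power// -mulrN -mulrDr mulrC; congr (_ / _).
move: (along (arm P i) _ _) (along (arm P (i + 1)) _ _) => u1 u2.
move: (fp _ _) (fq _ _) (fr _ _) => p1 q1 r1.
have t1 := tri_derivX (p1 * u2); have t2 := tri_derivY (p1 * u1).
have t3 := tri_derivX (q1 * u1); have t4 := tri_derivY (r1 * u2).
move: t1 t2 t3 t4; rewrite !derivM !dYM -!/(sE _) -!/(tE _) !tEM !sEM !hornerM !triD.
rewrite !int01D !mulrDr !hornerD !hornerM !triD !int01D.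
rewrite ![u1 * _]mulrC ![u2 * _]mulrC.
lra.
Qed.
End bilinear_form.
End discrete_stress.

Section stress_positivity.
Context {R : realType}.
Notation bp := {poly {poly R}}.

(** Contraction with the basis dual to [a], [b] recovers the three components. *)
Lemma tensor_eq0 J a b (fp fq fr : bp) s t : J = cross a b -> J != 0 ->
  (forall j l, (tensor J a b fp fq fr j l).[s, t] = 0) ->
  [/\ fp.[s, t] = 0, fq.[s, t] = 0 & fr.[s, t] = 0].
Proof.
move=> JE J0 T0; pose T j l := (tensor J a b fp fq fr j l).[s, t].
have pE : fp.[s, t] = T 0 0 * (b.2 * - a.2) + T 0 1 * (b.2 * a.1)
    + T 1 0 * (- b.1 * - a.2) + T 1 1 * (- b.1 * a.1).
  rewrite /T !horner_tensor /coor /=; move: J0; rewrite JE /cross => J0.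
  by field.
have qE : fq.[s, t] = T 0 0 * (b.2 * b.2) + T 0 1 * (b.2 * - b.1)
    + T 1 0 * (- b.1 * b.2) + T 1 1 * (- b.1 * - b.1).
  rewrite /T !horner_tensor /coor /=; move: J0; rewrite JE /cross => J0.
  by field.
have rE : fr.[s, t] = T 0 0 * (- a.2 * - a.2) + T 0 1 * (- a.2 * a.1)
    + T 1 0 * (a.1 * - a.2) + T 1 1 * (a.1 * a.1).
  rewrite /T !horner_tensor /coor /=; move: J0; rewrite JE /cross => J0.
  by field.
by rewrite pE qE rE /T !T0 !mul0r !addr0.
Qed.

Section on_mesh.
Context {V : finType} (M : mesh R V) (vert : {set V} -> 'I_3 -> V).
Notation W := (V + {set V})%type.
Implicit Types (P Q : {set V}) (i : 'I_3) (e K : {set W}).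
Hypothesis G : labelled_mesh M vert.
Notation arm := (arm M vert).
Notation jac := (jac M vert).
Notation subcell := (subcell vert).
Context (that : {set V} -> @sfield R) (tau : dgfield R W 2 2).
Hypothesis Htau : forall P i z, P \in cells M -> forall j l,
  tau (subcell P i) (pt M vert P i z) j l = (cell_tensor M vert that P i j l).[z.1, z.2].

Lemma L2norm_eq0 : L2norm (refine M) tau = 0 -> forall P i, P \in cells M ->
  [/\ fp (that P) i = 0, fq (that P) i = 0 & fr (that P) i = 0].
Proof.
have T0 P i s t : 0 <= (tensor_energy M vert that P i).[s, t].
  by rewrite horner_tensor_energy !addr_ge0 ?sqr_ge0.
have JT P i : P \in cells M -> 0 <= jac P * tri (tensor_energy M vert that P i).
  move=> PM; rewrite mulr_ge0 ?(ltW (jac_gt0 G PM))//; exact: tri_ge0.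
rewrite (L2norm_formula G Htau) => /eqP; rewrite sqrtr_eq0 => h P i PM.
have : \sum_(P in cells M) \sum_i jac P * tri (tensor_energy M vert that P i) = 0.
  apply/eqP; rewrite eq_le h sumr_ge0// => Q QM; apply: sumr_ge0 => j _; exact: JT.
move/eqP; rewrite psumr_eq0; last by move=> Q QM; apply: sumr_ge0 => j _; exact: JT.
move/allP/(_ P (mem_index_enum _)); rewrite PM /= psumr_eq0; last by move=> j _; exact: JT.
move/allP/(_ i (mem_index_enum _)); rewrite mulf_eq0 (gt_eqF (jac_gt0 G PM)) /= => /eqP.
move/tri_eq0 => /(_ (fun s t _ _ _ => T0 P i s t)) TE.
have z s t : [/\ (fp (that P) i).[s, t] = 0, (fq (that P) i).[s, t] = 0
    & (fr (that P) i).[s, t] = 0].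
  have J0 := jac_gt0 G PM.
  apply: (@tensor_eq0 (jac P) (arm P i) (arm P (i + 1))); rewrite ?(cross_arm G) ?gt_eqF//.
  have := horner_tensor_energy M vert that P i s t; rewrite TE !horner0 => /esym/eqP.
  rewrite !paddr_eq0 ?addr_ge0 ?sqr_ge0// !sqrf_eq0.
  move=> /andP[/andP[/eqP h1 /eqP h2] /andP[/eqP h3 /eqP h4]].
  have I2 (j : 'I_2) : j = 0 \/ j = 1.
    by case: j => [[|[|//]] hj]; [left|right]; apply: val_inj.
  by move=> j l; case: (I2 j) => ->; case: (I2 l) => ->.
by split; apply: bipoly_ext => s t; rewrite !horner0; have [] := z s t.
Qed.

Lemma nonzero_of_L2norm : L2norm (refine M) tau != 0 -> nonzero (refine M) tau.
Proof.
move=> /eqP L0; apply: contrapT => nz; apply: L0.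
rewrite /L2norm (sum_refine G) big1 ?sqrtr0//.
move=> P PM; apply: big1 => i _.
have -> : int_cell (refine M) (subcell P i) (fun x => mdot (tau (subcell P i) x) (tau (subcell P i) x))
   = int_cell (refine M) (subcell P i) (fun=> 0).
  apply: eq_Rintegral => x; rewrite inE => xP.
  have -> : tau (subcell P i) x = 0.
    apply/eqP/negPn/negP => t0; apply: nz; exists (subcell P i), x; split => //.
    exact: subcell_refine.
  exact: mdot0l.
by rewrite (int_subcell G (F := 0))// ?tri0 ?mulr0// => z; rewrite !horner0.
Qed.
End on_mesh.

Lemma jump_pointwise a b (g x y : R) : 0 < cross a b ->
  dot a a <= g * cross a b -> dot b b <= g * cross a b ->
  x ^+ 2 + y ^+ 2 <= 2 * g / cross a b *
    ((a.1 * x + a.2 * y) ^+ 2 + (b.1 * x + b.2 * y) ^+ 2).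
Proof.
case: a b => [a1 a2] [b1 b2]; rewrite /dot /= => J0 ha hb.
set J := cross _ _ in J0 ha hb *.
have JE : J = a1 * b2 - a2 * b1 by [].
clearbody J.
set m := a1 * x + a2 * y; set n := b1 * x + b2 * y.
have xE : J * x = m * b2 - n * a2 by rewrite JE /m /n; ring.
have yE : J * y = n * a1 - m * b1 by rewrite JE /m /n; ring.
rewrite -(ler_pM2r (exprn_gt0 2 J0)).
have -> : (x ^+ 2 + y ^+ 2) * J ^+ 2 = (J * x) ^+ 2 + (J * y) ^+ 2 by ring.
have -> : 2 * g / J * (m ^+ 2 + n ^+ 2) * J ^+ 2 = 2 * (g * J) * (m ^+ 2 + n ^+ 2).
  by field; rewrite gt_eqF.
rewrite xE yE; have := ler_wpM2r (sqr_ge0 n) ha; have := ler_wpM2r (sqr_ge0 m) hb.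
have := sqr_ge0 (m * b2 + n * a2); have := sqr_ge0 (n * a1 + m * b1); lra.
Qed.
End stress_positivity.

Section jump_control.
Context {R : realType} {V : finType} (M : mesh R V) (vert : {set V} -> 'I_3 -> V).
Notation bp := {poly {poly R}}.
Hypothesis G : labelled_mesh M vert.
Context (gamma : R).
Hypothesis reg : shape_regular gamma M.
Context (X Y : {set V} -> 'I_3 -> bp).
Notation u1 P := (fun i => along (arm M vert P i) (X P i) (Y P i)).
Notation u2 P := (fun i => along (arm M vert P (i + 1)) (X P i) (Y P i)).

(** On spoke [i + 1] the two values of [jmp] are the components of the jump along the arms [i + 1]
    and [i + 2], since [A_i + A_(i+1) = - A_(i+2)]. These arms form a basis, to which
    [jump_pointwise] applies. *)
Lemma jump_energy_bound P : P \in cells M ->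
  \sum_i jump_energy X Y P i <= 2 * `|2 * gamma| *
    ((\sum_i \sum_b int01 (jmp (u1 P) (u2 P) i b ^+ 2)) / jac M vert P).
Proof.
move=> PM; have J0 := jac_gt0 G PM.
have tEZ' (c : R) (F : bp) : tE (c%:P *: F) = c%:P * tE F by rewrite /tE hornerZ.
have sEZ' (c : R) (F : bp) : sE (c%:P *: F) = c%:P * sE F by rewrite sEZ mul_polyC.
rewrite (reindex_inj (addIr (1 : 'I_3))) /= mulr_suml mulr_sumr.
apply: ler_sum => i _; rewrite big_bool /= -int01D.
rewrite (_ : _ * (_ / _) = int01 ((2 * `|2 * gamma| / jac M vert P) *:
   (jmp (u1 P) (u2 P) i true ^+ 2 + jmp (u1 P) (u2 P) i false ^+ 2))); last first.
  by rewrite int01Z; ring.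
apply: int01_le => s _; rewrite hornerZ !hornerD !horner_exp.
have -> : (jmp (u1 P) (u2 P) i false).[s] =
    (arm M vert P (i + 1)).1 * (spoke_jump X P (i + 1)).[s]
    + (arm M vert P (i + 1)).2 * (spoke_jump Y P (i + 1)).[s].
  rewrite /jmp /spoke_jump /along !sED !tED !sEZ' !tEZ' addrK.
  by rewrite !(hornerD, hornerN, hornerM, hornerC); ring.
have -> : (jmp (u1 P) (u2 P) i true).[s] =
    (arm M vert P (i + 1 + 1)).1 * (spoke_jump X P (i + 1)).[s]
    + (arm M vert P (i + 1 + 1)).2 * (spoke_jump Y P (i + 1)).[s].
  have [_ _ _ E] := ord3_neq i.
  rewrite /jmp /spoke_jump /along !sED !tED !sEZ' !tEZ' addrK E (armB G)//.
  by rewrite !(hornerD, hornerN, hornerM, hornerC) !coordE; ring.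
rewrite [X in _ * X]addrC -(cross_arm G (i + 1) PM) in J0 *.
apply: jump_pointwise => //; rewrite (cross_arm G)//; exact: (arm_bound_norm G reg).
Qed.
End jump_control.

Section existence.
Context {R : realType} {V : finType} (M : mesh R V).
Notation bp := {poly {poly R}}.
Notation W := (V + {set V})%type.

Lemma labelling_exists (x0 : V) :
  (forall P, P \in cells M -> #|P| = 3%N /\ (geom M P)° !=set0) ->
  (forall P Q, P \in cells M -> Q \in cells M -> P != Q ->
    geom M P `&` geom M Q = geom M (P :&: Q)%SET) ->
  exists vert, labelled_mesh M vert.
Proof.
move=> cellP conf.
have solid P (PM : P \in cells M) := (cellP P PM).2.
pose list3 (a b c : V) (i : 'I_3) := if i == 0 then a else if i == 1 then b else c.
pose good (P : {set V}) (f : 'I_3 -> V) := [/\ injective f,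
  P = [set f 0; f 1; f (- 1)]%SET &
  0 < cross (pos M (f 1) - pos M (f 0)) (pos M (f (- 1)) - pos M (f 0))].
have list3_good (P : {set V}) a b c : P = [set a; b; c]%SET -> a != b -> a != c -> b != c ->
    0 < cross (pos M b - pos M a) (pos M c - pos M a) -> good P (list3 a b c).
  move=> PE ab ac bc D0; split => //.
  have d x y : x != y :> V -> (x == y = false) * (y == x = false).
    by move=> xy; rewrite [y == x]eq_sym (negPf xy).
  move=> i j; elim/ord3_ind: i; elim/ord3_ind: j; rewrite /list3 //= => /eqP;
    by rewrite ?(d _ _ ab) ?(d _ _ ac) ?(d _ _ bc).
have /choice[vert vertP] (P : {set V}) : exists f, P \in cells M -> good P f.
  have [PM|] := boolP (P \in cells M); last by exists (fun=> x0).
  have P3 := (cellP P PM).1.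
  have /card_gt0P[a aP] : (0 < #|P|)%N by rewrite P3.
  have : #|(P :\ a)%SET| = 2%N by have := cardsD1 a P; rewrite aP P3 => -[].
  move/eqP/cards2P => [b [c [bc E]]].
  have : b \in (P :\ a)%SET by rewrite E !inE eqxx.
  have : c \in (P :\ a)%SET by rewrite E !inE eqxx orbT.
  rewrite !inE => /andP[ca _] /andP[ba _]; rewrite eq_sym in ca; rewrite eq_sym in ba.
  have PE : P = [set a; b; c]%SET by rewrite -(finset.setD1K aP) E finset.setUA.
  have PE' : P = [set a; c; b]%SET.
    by rewrite PE -!finset.setUA; congr (_ |: _)%SET; exact: finset.setUC.
  have PM' := PM; rewrite PE in PM'.
  have D0 := cell_nondegenerate solid PM' ba ca bc.
  have [Dp|Dn] := ltP 0 (cross (pos M b - pos M a) (pos M c - pos M a)).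
    by exists (list3 a b c) => _; exact: list3_good.
  exists (list3 a c b) => _; apply: list3_good => //; first by rewrite eq_sym.
  by rewrite cross_swap oppr_gt0 lt_neqAle D0.
exists vert; split => // P PM; have [] := vertP P PM => //.
by have [] := cellP P PM.
Qed.

Context (vert : {set V} -> 'I_3 -> V).
Hypothesis G : labelled_mesh M vert.

Lemma components_exist k (v : dgfield R W 2 1) (c : 'I_2) :
  piecewise_poly k (refine M) v -> exists X : {set V} -> 'I_3 -> bp,
    (forall P i, tdeg k (X P i)) /\
    (forall P i z, P \in cells M ->
      v (subcell vert P i) (pt M vert P i z) c 0 = (X P i).[z.1, z.2]).
Proof.
move=> vP.
have /choice[X XP] (t : {set V} * 'I_3) : exists F : bp, tdeg k F /\
    (t.1 \in cells M -> forall z, v (subcell vert t.1 t.2) (pt M vert t.1 t.2 z) c 0 = F.[z.1, z.2]).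
  have [PM|] := boolP (t.1 \in cells M); last by exists 0; split => //; exact: tdeg0.
  have /poly_leP h := vP _ (subcell_refine G t.2 PM) c 0.
  by have [F tF FE] := polyfun_affmap (cen M t.1) (arm M vert t.1 t.2) (arm M vert t.1 (t.2 + 1)) h; exists F.
exists (fun P i => X (P, i)); split=> [P i|P i z PM]; first by have [] := XP (P, i).
by have [_] := XP (P, i); apply.
Qed.

Lemma stress_exists (that : {set V} -> @sfield R) : exists tau : dgfield R W 2 2,
  forall P i z, P \in cells M -> forall j l,
    tau (subcell vert P i) (pt M vert P i z) j l =
    (cell_tensor M vert that P i j l).[z.1, z.2].
Proof.
have /choice[tau tauP] (K : {set W}) : exists T : R * R -> 'M[R]_2,
    forall P i, P \in cells M -> K = subcell vert P i -> forall z j l,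
    T (pt M vert P i z) j l = (cell_tensor M vert that P i j l).[z.1, z.2].
  have [/(mem_refine G)[P PM [i KE]]|KM] := boolP (K \in cells (refine M)); last first.
    by exists (fun=> 0) => P i PM KE; move: KM; rewrite KE (subcell_refine G).
  exists (fun x => \matrix_(j, l)
     (cell_tensor M vert that P i j l).[(affinv (cen M P) (arm M vert P i) (arm M vert P (i + 1)) x).1,
        (affinv (cen M P) (arm M vert P i) (arm M vert P (i + 1)) x).2]).
  move=> Q l QM; rewrite KE => /(subcell_inj G PM QM)[<- <-] z j m.
  by rewrite mxE /pt affmapK// (cross_arm G)// gt_eqF// (jac_gt0 G).
by exists tau => P i z PM j l; exact: tauP.
Qed.
End existence.

(** * Assembly of the inf-sup condition *)

Section mesh_infsup.
Context {R : realType} {V : finType} (M : mesh R V) (vert : {set V} -> 'I_3 -> V).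
Notation bp := {poly {poly R}}.
Notation W := (V + {set V})%type.
Hypothesis G : labelled_mesh M vert.
Context (Omega : set (R * R)) (nu : {set W} -> 'cV[R]_2) (k : nat) (gamma : R).
Hypothesis reg : shape_regular gamma M.
Hypothesis Hnu : unit_normals Omega (refine M) nu.
Context (v : dgfield R W 2 1).
Hypothesis Hv : Uh0 Omega k M nu v.
Hypothesis cells_neq0 : cells M != finset.set0.

Let g := `|2 * gamma|.

(** Fallback for the case where the optimal stress gives a zero form: the supremum still needs a
    nonzero competitor with nonnegative quotient. *)
Lemma nonneg_stress : exists tau : dgfield R W 2 2,
  [/\ Sigmahs k M nu tau, L2norm (refine M) tau != 0 & 0 <= bstar M nu v tau].
Proof.
have [X [_ HX]] := components_exist G 0 Hv.1.1.
have [Y [_ HY]] := components_exist G 1 Hv.1.1.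
(* On each primal triangle this is, up to scaling, the constant tensor
   [A_0 A_0^T + A_1 A_1^T + A_2 A_2^T]. *)
pose s1 : @sfield R := SField (fun=> 1%:P%:P) (fun=> 2%:P%:P) (fun=> 2%:P%:P).
have tEC (c : R) : tE c%:P%:P = c%:P by rewrite tE_inner.
have sEC (c : R) : sE c%:P%:P = c%:P by rewrite sE_inner hornerC.
have adm1 : admissible k s1.
  split=> i /=; first by split; exact: tdeg_const.
    by rewrite sEC tEC.
  by rewrite !sEC tEC -polyCD.
(* The combination [- 2 s1 + s1] is the opposite field, for which the form changes sign. *)
have adm2 := admissible_scomb (- 2) adm1 adm1.
pose b s := \sum_(P in cells M) bhat (fun i => along (arm M vert P i) (X P i) (Y P i))
       (fun i => along (arm M vert P (i + 1)) (X P i) (Y P i)) s / jac M vert P.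
have b2 : b (scomb (- 2) s1 s1) = - b s1.
  rewrite /b -sumrN; apply: eq_bigr => P _; rewrite bhat_linr; ring.
have [s [adms bs ps]] : exists s, [/\ admissible k s, 0 <= b s & fp s 0 != 0].
  have [b0|b0] := leP 0 (b s1).
    by exists s1; split => //; rewrite /= !polyC_eq0 oner_eq0.
  exists (scomb (- 2) s1 s1); split => //; first by rewrite b2 oppr_ge0 ltW.
  apply/eqP => /(congr1 (fun F : bp => F.[0, 0])).
  by rewrite /= horner2D horner2Z !hornerC ?horner0; lra.
have [tau Htau] := stress_exists G (fun=> s).
exists tau; split.
- split; first split.
  + exact: (tau_piecewise_poly G (fun=> adms) Htau).
  + exact: (tau_normal_continuous G Hnu (fun=> adms) Htau).
  + by move=> K KM x _; exact: (tau_symmetric G Htau KM).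
- apply/eqP => L0.
  have [P PM] := finset.set0Pn _ cells_neq0.
  have [p0 _ _] := L2norm_eq0 G Htau L0 0 PM.
  by rewrite p0 eqxx in ps.
- by rewrite (bstar_formula G Hnu Htau Hv HX HY).
Qed.

(** Both squared norms are bounded by multiples of the same form value [S]; multiplying the two
    bounds gives the product estimate with [S ^+ 2]. *)
Lemma mesh_infsup (C C1 C2 : R) : 0 < C -> 0 < C1 -> 0 < C2 ->
  (forall u1 u2 : 'I_3 -> bp, (forall i, tdeg k (u1 i)) -> (forall i, tdeg k (u2 i)) ->
    exists tau, [/\ admissible k tau,
    \sum_i \sum_d tri (strain u1 u2 i d ^+ 2)
      + \sum_i \sum_b int01 (jmp u1 u2 i b ^+ 2) <= C * bhat u1 u2 tau &
    \sum_i tri (fp tau i ^+ 2 + fq tau i ^+ 2 + fr tau i ^+ 2)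
      <= C * bhat u1 u2 tau]) ->
  (forall F : bp, tdeg k F -> int01 (sE F ^+ 2) <= C1 * tri (F ^+ 2) /\
                              int01 (tE F ^+ 2) <= C1 * tri (F ^+ 2)) ->
  (forall q : {poly R}, (size q <= k.+1)%N ->
     q.[0] ^+ 2 <= C2 * int01 (q ^+ 2) /\ q.[1] ^+ 2 <= C2 * int01 (q ^+ 2)) ->
  let A := 120 * g ^+ 2 + (4 * (8 * C1 * (g + 1) + C2 + (2 * packing_bound gamma)%:R * C2) + 1) * (2 * g) in
  exists tau : dgfield R W 2 2, [/\ Sigmahs k M nu tau, L2norm (refine M) tau != 0,
    0 <= bstar M nu v tau &
    H1norm M nu v ^+ 2 * L2norm (refine M) tau ^+ 2 <=
      (A * C) * (48 * g ^+ 2 * C) * bstar M nu v tau ^+ 2].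
Proof.
move=> C0 C10 C20 hC hC1 hC2; set B := 4 * _; set A := 120 * _ + _ => /=.
have g0 : 0 <= g by exact: normr_ge0.
have B0 : 0 <= B.
  by rewrite /B !mulr_ge0// !addr_ge0 ?mulr_ge0 ?ler0n ?ltW//; lra.
have A0 : 0 <= A.
  by rewrite /A addr_ge0 ?mulr_ge0 ?sqr_ge0//; lra.
have [X [tX HX]] := components_exist G 0 Hv.1.1.
have [Y [tY HY]] := components_exist G 1 Hv.1.1.
pose u1 P i := along (arm M vert P i) (X P i) (Y P i).
pose u2 P i := along (arm M vert P (i + 1)) (X P i) (Y P i).
have tu1 P i : tdeg k (u1 P i) by apply: tdegD; apply: tdegZ.
have tu2 P i : tdeg k (u2 P i) by apply: tdegD; apply: tdegZ.
have /choice[that thatP] P := hC (u1 P) (u2 P) (tu1 P) (tu2 P).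
have adm P : admissible k (that P) by have [] := thatP P.
have [tau Htau] := stress_exists G that.
have bE := bstar_formula G Hnu Htau Hv HX HY.
pose E P := \sum_i \sum_d tri (strain (u1 P) (u2 P) i d ^+ 2).
pose D P := \sum_i \sum_b int01 (jmp (u1 P) (u2 P) i b ^+ 2).
have E0 P : 0 <= E P by apply: sumr_ge0 => i _; apply: sumr_ge0 => d _; exact: tri_sqr_ge0.
have D0 P : 0 <= D P by apply: sumr_ge0 => i _; apply: sumr_ge0 => d _; exact: int01_sqr_ge0.
have J0 P : P \in cells M -> 0 <= (jac M vert P)^-1.
  by move=> PM; rewrite invr_ge0 ltW// (jac_gt0 G).
set S := bstar M nu v tau in bE *.
have ED : \sum_(P in cells M) (E P + D P) / jac M vert P <= C * S.
  rewrite bE mulr_sumr; apply: ler_sum => P PM; rewrite mulrA.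
  by apply: ler_wpM2r; [exact: J0 | have [] := thatP P].
have ED0 : 0 <= \sum_(P in cells M) (E P + D P) / jac M vert P.
  by apply: sumr_ge0 => P PM; rewrite mulr_ge0 ?J0// addr_ge0.
have S0 : 0 <= S by rewrite -(pmulr_rge0 _ C0) (le_trans ED0).
have L2 : L2norm (refine M) tau ^+ 2 <= 48 * g ^+ 2 * C * S.
  apply: (le_trans (L2norm_sqr_bound G reg Htau)); rewrite -[leRHS]mulrA.
  apply: ler_wpM2l; first by rewrite mulr_ge0// sqr_ge0.
  rewrite bE mulr_sumr; apply: ler_sum => P PM; rewrite mulrA.
  by apply: ler_wpM2r; [exact: J0 | have [] := thatP P].
have H1 : H1norm M nu v ^+ 2 <= A * C * S.
  rewrite (H1norm_formula G Hnu HX HY) sqr_sqrtr; last first.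
    apply: sumr_ge0 => P PM; apply: sumr_ge0 => i _; apply: addr_ge0.
      exact: (grad_energy_ge0 G).
    exact: (jump_energy_ge0 X Y).
  under eq_bigr do rewrite big_split /=; rewrite big_split /=.
  have korn := korn_mesh G reg Hnu Hv HX HY (fun P i _ => tX P i) (fun P i _ => tY P i) C10 hC1 hC2.
  rewrite -/g -/B in korn.
  have jb : \sum_(P in cells M) \sum_i jump_energy X Y P i <=
      2 * g * \sum_(P in cells M) D P / jac M vert P.
    by rewrite mulr_sumr; apply: ler_sum => P PM; exact: (jump_energy_bound G reg).
  have sb : \sum_(P in cells M) \sum_i strain_energy M vert X Y P i =
      \sum_(P in cells M) E P / jac M vert P.
    by apply: eq_bigr => P PM; rewrite /E mulr_suml.
  rewrite sb in korn.
  have split_ED : \sum_(P in cells M) (E P + D P) / jac M vert P =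
      \sum_(P in cells M) E P / jac M vert P + \sum_(P in cells M) D P / jac M vert P.
    by rewrite -big_split /=; apply: eq_bigr => P _; rewrite mulrDl.
  rewrite split_ED in ED.
  set SE := \sum_(P in cells M) E P / _ in ED korn; set SD := \sum_(P in cells M) D P / _ in ED jb.
  have SE0 : 0 <= SE by apply: sumr_ge0 => P PM; rewrite mulr_ge0 ?J0.
  have SD0 : 0 <= SD by apply: sumr_ge0 => P PM; rewrite mulr_ge0 ?J0.
  set GG := \sum_(P in cells M) \sum_i grad_energy _ _ _ _ _ _ in korn.
  set JJ := \sum_(P in cells M) \sum_i jump_energy _ _ _ _ in korn jb.
  have -> : A * C * S = A * (C * S) by ring.
  apply: (@le_trans _ _ (A * (SE + SD))); last by rewrite ler_wpM2l.
  apply: (@le_trans _ _ (GG + JJ)); first by [].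
  have k1 := ler_wpM2l (addr_ge0 B0 ler01) jb.
  have k2 : 0 <= (B + 1) * (2 * g) * SE by rewrite !mulr_ge0//; lra.
  have k3 : 0 <= 120 * g ^+ 2 * SD by rewrite !mulr_ge0 ?sqr_ge0.
  by rewrite /A; lra.
(* If [S] vanishes, so does the norm of [v], and any nonzero stress with nonnegative form will
   do. *)
have [Spos|S0'] := ltP 0 S; last first.
  have [t0 [ts tn tb]] := nonneg_stress.
  exists t0; split => //.
  have SE : S = 0 by apply/eqP; rewrite eq_le S0' S0.
  have -> : H1norm M nu v ^+ 2 = 0.
    by apply/eqP; rewrite eq_le sqr_ge0 andbT (le_trans H1)// SE mulr0.
  rewrite mul0r; apply: mulr_ge0; last exact: sqr_ge0.
  apply: mulr_ge0; first exact: mulr_ge0 A0 (ltW C0).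
  by apply: mulr_ge0; [rewrite mulr_ge0// sqr_ge0 | exact: ltW].
exists tau; split => //.
- split; first split.
  + exact: (tau_piecewise_poly G adm Htau).
  + exact: (tau_normal_continuous G Hnu adm Htau).
  + by move=> K KM x _; exact: (tau_symmetric G Htau KM).
- apply/eqP => L0.
  have := L2norm_eq0 G Htau L0 => z.
  move: Spos; rewrite bE big1 ?ltxx// => P PM; rewrite /bhat big1 ?mul0r// => i _.
  have [-> -> ->] := z P i PM.
  by rewrite !sE0 !tE0 !mul0r !addr0 !int010 tri0 !addr0.
- rewrite -/S (_ : A * C * (48 * g ^+ 2 * C) * S ^+ 2 = (A * C * S) * (48 * g ^+ 2 * C * S)); last by ring.
  by apply: ler_pM => //; exact: sqr_ge0.
Qed.
End mesh_infsup.

Unset Implicit Arguments.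

Theorem theorem4p3 (R : realType) (Omega : set (R * R)) (k : nat) (gamma : R)
    (hOmega : convex_polygonal_domain Omega) (hk : (1 <= k)%N) :
  exists2 beta : R, 0 < beta &
    forall (V : finType) (M : mesh R V)
      (nu : {set (V + {set V})%type} -> 'cV[R]_2),
      triangulation Omega M -> shape_regular gamma M ->
      unit_normals Omega (refine M) nu ->
      forall v : dgfield R (V + {set V})%type 2 1, Uh0 Omega k M nu v ->
        ((beta * H1norm M nu v)%:E <=
          ereal_sup [set (bstar M nu v tau / L2norm (refine M) tau)%:E |
                      tau in [set tau : dgfield R (V + {set V})%type 2 2 |
                               Sigmahs k M nu tau /\
                               nonzero (refine M) tau]])%E.
Proof.
have [C C0 hC] := @reference_infsup R k hk.
have [C1 C10 hC1] := @trace_bound R k.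
have [C2 C20 hC2] := @endpoint_bound R k.
pose g := `|2 * gamma|.
pose A := 120 * g ^+ 2 +
  (4 * (8 * C1 * (g + 1) + C2 + (2 * packing_bound gamma)%:R * C2) + 1) * (2 * g).
pose K := (A * C) * (48 * g ^+ 2 * C).
(* The added [1] keeps the denominator positive even when [K] is zero. *)
have K0 : 0 < Num.sqrt K + 1 by rewrite ltr_wpDl// sqrtr_ge0.
exists (Num.sqrt K + 1)^-1; first by rewrite invr_gt0.
move=> V M nu [cellP cover conf] reg Hnu v Hv.
(* A point of [Omega] lies in some cell, so the mesh carries a nonzero stress and the supremum is
   over a nonempty set. *)
have [x Ox] := hOmega.1.
have : closure Omega x by exact: subset_closure.
rewrite -cover => -[P0 /= PM0 _].
have cells_neq0 : cells M != finset.set0 by apply/finset.set0Pn; exists P0.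
have /card_gt0P[x0 _] : (0 < #|P0|)%N by rewrite (cellP P0 PM0).1.
have [vert G] := labelling_exists x0 cellP conf.
have [tau [tauS L0 S0]] := mesh_infsup G reg Hnu Hv cells_neq0 C0 C10 C20 hC hC1 hC2.
rewrite -/g -/A -/K => main.
apply: le_trans (ereal_sup_ubound _); last first.
  by exists tau => //; split => //; exact: (nonzero_of_L2norm G).
have Lp : 0 < L2norm (refine M) tau by rewrite lt_neqAle eq_sym L0 sqrtr_ge0.
have H0 : 0 <= H1norm M nu v by exact: sqrtr_ge0.
rewrite lee_fin ler_pdivlMr// -mulrA mulrC ler_pdivrMr//.
set S := bstar _ _ _ _ in S0 main *.
have HL : H1norm M nu v * L2norm (refine M) tau <= Num.sqrt K * S.
  have -> : Num.sqrt K * S = Num.sqrt (K * S ^+ 2).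
    have [Kp|Kn] := leP 0 K; first by rewrite (sqrtrM (S ^+ 2) Kp) sqrtr_sqr ger0_norm.
    by rewrite !ler0_sqrtr ?mul0r// ?(ltW Kn)// mulr_le0_ge0 ?sqr_ge0// ltW.
  rewrite -(ger0_norm (mulr_ge0 H0 (ltW Lp))) -sqrtr_sqr.
  by apply: ler_wsqrtr; rewrite exprMn.
by apply: (le_trans HL); rewrite mulrC ler_wpM2l// lerDl.
Qed.
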